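(* Assume $Q\in C^\infty(M_T)$ and $q\in C^\infty(N)$. Let $\hat v^{(1)},\hat v^{(2)}$ be formal Gaussian beams of degree $K$ along distinct lightlike geodesics intersecting at $p_0$, with phases $\Phi^{(1)},\Phi^{(2)}$, let $\Phi=\Phi^{(1)}+\Phi^{(2)}$, and let \[ F=e^{i\Phi/h}\sum_{l=0}^{2K}q\,b_lh^l, \] where the $b_l\in C_0^\infty(N_0)$ are the (localized) coefficients of the product $\hat v^{(1)}\hat v^{(2)}$ near $p_0$ given in the context. Assume that $\langle\nabla\Phi,\nabla\Phi\rangle_g\neq0$ in the neighbourhood $N_0$ of $p_0$. Then there exists a solution $\hat w\in C^\infty(M_T)$ of \[ (\square_g+Q)\hat w=F+\hat r\quad\text{in } M_T, \] which can be written in the form \[ \hat w=e^{i\Phi/h}\sum_{j=2}^{2K+2}c_jh^j\quad\text{in } M_T, \] where the $c_j\in C_0^\infty(N_0)$ are given recursively by $c_0=c_1=0$ and \[ c_j=\frac{q\,b_{j-2}-(\square_g+Q)c_{j-2}-i(\square_g\Phi)c_{j-1}-2i\langle\nabla\Phi,\nabla c_{j-1}\rangle_g}{\langle\nabla\Phi,\nabla\Phi\rangle_g},\quad j=2,\dots,2K+2, \] and where the error term $\hat r\in C_0^\infty(N_0)$ satisfies \[ \|\hat r\|_{H^k(M_T)}\le C\,h^{2K-k+1}. \]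
   Context: $(N,g)$ is a globally hyperbolic Lorentzian manifold of dimension $n+1$, signature $(-,+,\dots,+)$, identified with $\mathbb R\times M$; $M_T=[0,T]\times M$; $\square_gu=-|g|^{-1/2}\partial_a(|g|^{1/2}g^{ab}\partial_bu)$. $h\in(0,1)$ is the asymptotic parameter and $C$ is independent of $h$. Fermi coordinates along a lightlike geodesic $\gamma$ are coordinates $z=(s,z')=(s,z^1,\dots,z^n)\in I\times B_{\delta'}$ ($I$ an interval, $B_{\delta'}$ the ball of radius $\delta'$ about $0$ in $\mathbb R^n$) near $\gamma$ in which $\gamma(s)=(s,0)$, $g|_\gamma=2\,ds\otimes dz^1+\sum_{i=2}^n dz^i\otimes dz^i$ and $\partial_ig_{jk}|_\gamma=0$. Formal Gaussian beam of degree $K$ along $\gamma$ (for $\square_g+Q$): $\hat v=e^{i\Phi/h}a$ with $\Phi\in C^\infty(N)$, $a\in C_0^\infty(N)$ such that, with $\mathbf H\Phi=\langle\nabla\Phi,\nabla\Phi\rangle_g$ and $\mathbf Ta=2\langle\nabla\Phi,\nabla a\rangle_g-(\square_g\Phi)a$: (1) $\partial_z^\alpha\mathbf H\Phi(s,0)=0$ for $s\in I$, $|\alpha|\le K$; (2) $\operatorname{Im}\Phi|_\gamma=0$ and $\operatorname{Im}\Phi(z)\ge C|z'|^2$ on $I\times B_{\delta'}$; (3) $a=\chi\sum_{j=0}^Ka_jh^j$, $a_j=\sum_{i=0}^Ka_{j,i}$ with $a_{j,i}$ complex-valued homogeneous polynomials in $z^1,\dots,z^n$ with coefficients depending on $s$,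 and $\chi$ a nonnegative smooth cut-off equal to $1$ for $|z'|\le\delta'/4$ and $0$ for $|z'|\ge\delta'/2$; (4) $\partial_z^\alpha(\mathbf Ta_0)(s,0)=0$ and $\partial_z^\alpha(-i\mathbf Ta_k+(\square_g+Q)a_{k-1})(s,0)=0$ for $s\in I$, $|\alpha|\le K$, $1\le k\le K$. Write $\hat v^{(k)}=e^{i\Phi^{(k)}/h}\chi_k\sum_{l=0}^Ka^{(k)}_lh^l$, $k=1,2$. Let $\chi_B$ be a smooth cut-off supported in a small ball $B(p_0,\rho)$ around $p_0$, $\chi_{p_0}=\chi_1\chi_2\chi_B$, $N_0=\operatorname{supp}\chi_{p_0}$, and $b_l=\chi_{p_0}\sum_{m+m'=l}a^{(1)}_ma^{(2)}_{m'}$ for $0\le l\le2K$. $C_0^\infty(N_0)$ denotes smooth functions supported in $N_0$.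
   Formalization: In the recursion for c_j the gradient term is taken as +2i⟨∇Φ,∇c_{j-1}⟩_g instead of the printed −2i: with the stated sign convention for □_g the printed sign leaves an order-h residual and the error bound fails (e.g. n=3, K=1). *)

(* Defs.v *)
From HB Require Import structures.
From mathcomp Require Import all_boot all_order all_algebra.
From mathcomp Require Import all_classical all_reals all_analysis.
From mathcomp.real_closed Require Import complex.

Set Implicit Arguments.
Unset Strict Implicit.
Unset Printing Implicit Defensive.

Import Order.TTheory GRing.Theory Num.Theory.
Import numFieldNormedType.Exports.

Local Open Scope classical_set_scope.
Local Open Scope ring_scope.

Section Euclidean.
Context {R : realType} {m : nat}.
Implicit Types (U : set 'rV[R]_m) (x : 'rV[R]_m).

Definition pd (i : 'I_m) (f : 'rV[R]_m -> R) : 'rV[R]_m -> R :=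
  fun x => 'D_(delta_mx 0 i) f x.

Definition pds (s : seq 'I_m) (f : 'rV[R]_m -> R) : 'rV[R]_m -> R :=
  foldr pd f s.

(* C^oo on an open set U: all iterated partial derivatives exist and are
   continuous on U. *)
Definition smooth_on U (f : 'rV[R]_m -> R) : Prop :=
  forall s x, U x ->
    {for x, continuous (pds s f)} /\
    forall i, derivable (pds s f) x (delta_mx 0 i).

(* Complex-valued functions are differentiated through their real and
   imaginary parts. *)
Definition cpd (i : 'I_m) (f : 'rV[R]_m -> R[i]) : 'rV[R]_m -> R[i] :=
  fun x => (pd i (fun y => complex.Re (f y)) x +i*
            pd i (fun y => complex.Im (f y)) x)%C.

Definition csmooth_on U (f : 'rV[R]_m -> R[i]) : Prop :=
  smooth_on U (fun x => complex.Re (f x)) /\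
  smooth_on U (fun x => complex.Im (f x)).

Definition multi_pd (alpha : 'I_m -> nat) (f : 'rV[R]_m -> R[i]) :
    'rV[R]_m -> R[i] :=
  foldr cpd f (flatten [seq nseq (alpha i) i | i <- enum 'I_m]).

Definition esq x : R := \sum_i (x 0 i) ^+ 2.

End Euclidean.

(* Integral over R^m of a nonnegative Borel function, as an iterated one-
   dimensional Lebesgue integral (Tonelli). *)
Fixpoint iterint (R : realType) (m : nat) : ('rV[R]_m -> \bar R) -> \bar R :=
  match m with
  | 0 => fun f => f 0
  | m'.+1 => fun f =>
      (\int[@lebesgue_measure R]_t
         iterint (fun y : 'rV[R]_m' =>
           f (row_mx (const_mx t : 'rV[R]_1) y : 'rV[R]_m'.+1)))%E
  end.

Definition cexp (R : realType) (z : R[i]) : R[i] :=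
  (expR (complex.Re z))%:C%C * (cos (complex.Im z) +i* sin (complex.Im z))%C.

Definition csqnorm (R : realType) (z : R[i]) : R :=
  complex.Re z ^+ 2 + complex.Im z ^+ 2.

(* [cmap] is only meaningful on [cdom], and [cinv] on the image [cimg]. *)
Record chart (R : realType) (X : topologicalType) (m : nat) := Chart {
  cdom : set X;
  cmap : X -> 'rV[R]_m;
  cinv : 'rV[R]_m -> X }.

Section Charts.
Context {R : realType} {X : topologicalType} {m : nat}.
Implicit Types phi psi : chart R X m.

Definition cimg phi : set 'rV[R]_m := cmap phi @` cdom phi.

Definition is_chart phi : Prop :=
  [/\ open (cdom phi), open (cimg phi),
      forall p, cdom phi p -> cinv phi (cmap phi p) = p,
      forall p, cdom phi p -> {for p, continuous (cmap phi)} &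
      forall x, cimg phi x -> {for x, continuous (cinv phi)}].

Definition transition phi psi (i : 'I_m) : 'rV[R]_m -> R :=
  fun x => cmap psi (cinv phi x) 0 i.

Definition smooth_transition phi psi : Prop :=
  forall i, smooth_on (cmap phi @` (cdom phi `&` cdom psi))
                      (transition phi psi i).

End Charts.

(* The atlas is maximal, so that every admissible local coordinate system is
   one of its members. *)
Record manifold (R : realType) (X : topologicalType) (m : nat) := Manifold {
  atlas : set (chart R X m);
  manifold_hausdorff : hausdorff_space X;
  manifold_second_countable : @second_countable X;
  atlas_chart : forall phi, atlas phi -> is_chart phi;
  atlas_cover : forall p, exists2 phi, atlas phi & cdom phi p;
  atlas_smooth : forall phi psi, atlas phi -> atlas psi ->
    smooth_transition phi psi;
  atlas_maximal : forall phi, is_chart phi ->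
    (forall psi, atlas psi ->
      smooth_transition phi psi /\ smooth_transition psi phi) ->
    atlas phi }.

(* Some chart around p. It is used to define coordinate-invariant objects from
   their expression in coordinates. *)
Definition chart_at (R : realType) (X : topologicalType) (m : nat)
    (N : manifold R X m) (p : X) : chart R X m :=
  s2val (cid2 (atlas_cover N p)).

Section SmoothFunctions.
Context {R : realType} {X : topologicalType} {m : nat}.
Variable N : manifold R X m.

Definition smooth (f : X -> R) : Prop :=
  forall phi, atlas N phi -> smooth_on (cimg phi) (fun x => f (cinv phi x)).

Definition csmooth (u : X -> R[i]) : Prop :=
  forall phi, atlas N phi -> csmooth_on (cimg phi) (fun x => u (cinv phi x)).

(* C_0^oo(A), for a compact set A. *)
Definition csmooth_supp (A : set X) (u : X -> R[i]) : Prop :=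
  csmooth u /\ closure [set p | u p != 0] `<=` A.

Definition smooth_curve (gamma : R -> X) (J : set R) : Prop :=
  forall t, J t ->
    {for t, continuous gamma} /\
    forall phi, atlas N phi -> cdom phi (gamma t) ->
    forall k i, derivable (derive1n k (fun s => cmap phi (gamma s) 0 i)) t 1.

Definition velocity (phi : chart R X m) (gamma : R -> X) (t : R) : 'rV[R]_m :=
  \row_i derive1 (fun s => cmap phi (gamma s) 0 i) t.

(* jacobian phi psi p = (d psi^a / d phi^b)_(a, b) at p. *)
Definition jacobian (phi psi : chart R X m) (p : X) : 'M[R]_m :=
  \matrix_(a, b) pd b (transition phi psi a) (cmap phi p).

End SmoothFunctions.

Definition open_interval (R : realType) (J : set R) : Prop :=
  [/\ open J, is_interval J & J !=set0].

Definition prod_chart (R : realType) (M : topologicalType) (n : nat)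
    (phi : chart R M n) : chart R (R * M)%type n.+1 :=
  Chart (fun p : R * M => cdom phi p.2)
        (fun p => row_mx (const_mx p.1 : 'rV[R]_1) (cmap phi p.2) : 'rV_n.+1)
        (fun x : 'rV[R]_(1 + n) => (x 0 ord0, cinv phi (rsubmx x))).

(* N is the product manifold R x M: its maximal atlas contains (hence is
   generated by) the product charts. *)
Definition is_cylinder (R : realType) (M : topologicalType) (n : nat)
    (MM : manifold R M n) (N : manifold R (R * M)%type n.+1) : Prop :=
  forall phi, atlas MM phi -> atlas N (prod_chart phi).

Definition slab (R : realType) (M : topologicalType) (T : R) : set (R * M) :=
  [set p | 0 <= p.1 <= T].

Definition minkowski (R : realType) (n : nat) : 'M[R]_n.+1 :=
  diag_mx (\row_i (if i == ord0 then -1 else 1)).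

(* [gmx phi p] is the matrix (g_ab) of g at p in the coordinates phi. *)
Record lorentzian (R : realType) (X : topologicalType) (n : nat)
    (N : manifold R X n.+1) := Lorentzian {
  gmx : chart R X n.+1 -> X -> 'M[R]_n.+1;
  g_sym : forall phi p, atlas N phi -> cdom phi p ->
    (gmx phi p)^T = gmx phi p;
  g_signature : forall phi p, atlas N phi -> cdom phi p ->
    exists2 P, P \in unitmx & P^T *m gmx phi p *m P = minkowski R n;
  g_smooth : forall phi, atlas N phi -> forall a b,
    smooth_on (cimg phi) (fun x => gmx phi (cinv phi x) a b);
  g_tensor : forall phi psi p, atlas N phi -> atlas N psi ->
    cdom phi p -> cdom psi p ->
    gmx phi p = (jacobian phi psi p)^T *m gmx psi p *m jacobian phi psi p }.

Section Lorentz.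
Context {R : realType} {X : topologicalType} {n : nat}.
Context {N : manifold R X n.+1}.
Variable g : lorentzian N.
Implicit Types (u v : X -> R[i]) (phi : chart R X n.+1).

Definition inner_in phi u v (p : X) : R[i] :=
  \sum_a \sum_b (invmx (gmx g phi p) a b)%:C%C
    * cpd a (fun x => u (cinv phi x)) (cmap phi p)
    * cpd b (fun x => v (cinv phi x)) (cmap phi p).

(* <grad u, grad v>_g = g^{ab} d_a u d_b v, extended bilinearly to complex-
   valued functions. *)
Definition inner u v (p : X) : R[i] := inner_in (chart_at N p) u v p.

Definition box_in phi u (p : X) : R[i] :=
  let G := fun x => gmx g phi (cinv phi x) in
  let dens := fun x => Num.sqrt `|\det (G x)| in
  - ((dens (cmap phi p))^-1)%:C%C *
    \sum_a cpd a (fun x =>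
      \sum_b (dens x * invmx (G x) a b)%:C%C
             * cpd b (fun y => u (cinv phi y)) x) (cmap phi p).

(* The wave operator with the sign convention
   - |g|^{-1/2} d_a (|g|^{1/2} g^{ab} d_b u). *)
Definition box u (p : X) : R[i] := box_in (chart_at N p) u p.

Definition transport (Phi u : X -> R[i]) (p : X) : R[i] :=
  2%:R * inner Phi u p - box Phi p * u p.

Definition christoffel phi (c a b : 'I_n.+1) (p : X) : R :=
  let dg := fun i j k =>
    pd i (fun x => gmx g phi (cinv phi x) j k) (cmap phi p) in
  2^-1 * \sum_d invmx (gmx g phi p) c d * (dg a b d + dg b a d - dg d a b).

Definition speed2 phi (gamma : R -> X) (t : R) : R :=
  let v := velocity phi gamma t in (v *m gmx g phi (gamma t) *m v^T) 0 0.

Definition geodesic (gamma : R -> X) (J : set R) : Prop :=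
  smooth_curve N gamma J /\
  forall t phi, J t -> atlas N phi -> cdom phi (gamma t) ->
  forall c : 'I_n.+1,
    derive1n 2 (fun s => cmap phi (gamma s) 0 c) t
    + \sum_a \sum_b christoffel phi c a b (gamma t)
        * velocity phi gamma t 0 a * velocity phi gamma t 0 b = 0.

Definition lightlike_geodesic (gamma : R -> X) (J : set R) : Prop :=
  geodesic gamma J /\
  forall t phi, J t -> atlas N phi -> cdom phi (gamma t) ->
    velocity phi gamma t != 0 /\ speed2 phi gamma t = 0.

Definition timelike_curve (gamma : R -> X) (J : set R) : Prop :=
  smooth_curve N gamma J /\
  forall t phi, J t -> atlas N phi -> cdom phi (gamma t) ->
    speed2 phi gamma t < 0.

Definition inextendible (gamma : R -> X) (J : set R) : Prop :=
  ~ (exists p : X, forall V, nbhs p V ->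
       exists2 t0, J t0 & forall t, J t -> t0 <= t -> V (gamma t)) /\
  ~ (exists p : X, forall V, nbhs p V ->
       exists2 t0, J t0 & forall t, J t -> t <= t0 -> V (gamma t)).

Definition cauchy_hypersurface (S : set X) : Prop :=
  forall gamma J, open_interval J -> timelike_curve gamma J ->
    inextendible gamma J -> exists! t, J t /\ S (gamma t).

(* There is a continuous timelike vector field; [V phi p] is the column of its
   components at p in the coordinates phi. *)
Definition time_orientable : Prop :=
  exists V : chart R X n.+1 -> X -> 'cV[R]_n.+1,
    (forall phi psi p, atlas N phi -> atlas N psi -> cdom phi p -> cdom psi p ->
       V psi p = jacobian phi psi p *m V phi p) /\
    (forall phi, atlas N phi ->
       (forall i x, cimg phi x ->
          {for x, continuous (fun y => V phi (cinv phi y) i 0)}) /\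
       (forall p, cdom phi p -> ((V phi p)^T *m gmx g phi p *m V phi p) 0 0 < 0)).

Definition globally_hyperbolic : Prop :=
  time_orientable /\ exists S, cauchy_hypersurface S.

(* In Fermi coordinates, coordinate 0 is s and coordinates 1, ..., n are z'. *)
Definition tsq (z : 'rV[R]_n.+1) : R := \sum_(i < n) (z 0 (lift ord0 i)) ^+ 2.

Definition axis (s : R) : 'rV[R]_n.+1 := s *: delta_mx 0 ord0.

(* The Gram matrix of 2 ds dz^1 + sum_{i >= 2} dz^i dz^i, where ds dz^1 is the
   symmetric product: the (0, 1) and (1, 0) entries are 1. *)
Definition fermi_gram : 'M[R]_n.+1 :=
  \matrix_(i, j) (((i + j)%N == 1%N) || ((i == j) && (1 < i)%N))%:R.

Definition fermi_coordinates (gamma : R -> X) (I : set R) (delta : R)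
    (z : chart R X n.+1) : Prop :=
  [/\ atlas N z, open_interval I, 0 < delta,
      cimg z = [set x : 'rV[R]_n.+1 | I (x 0 ord0) /\ tsq x < delta ^+ 2] &
      forall s, I s ->
        [/\ gamma s = cinv z (axis s), gmx g z (gamma s) = fermi_gram &
            forall i j k, pd i (fun x : 'rV[R]_n.+1 => gmx g z (cinv z x) j k) (axis s) = 0]].

End Lorentz.

(* [beam_coef j alpha] is the coefficient, a function of s, of the monomial
   z'^alpha in a_j; only the multi-indices with |alpha| <= K are used. *)
Record beam_data (R : realType) (X : topologicalType) (n K : nat) := BeamData {
  beam_geod : R -> X;
  beam_int : set R;
  beam_rad : R;
  beam_fermi : chart R X n.+1;
  beam_phase : X -> R[i];
  beam_cut : X -> R;
  beam_coef : nat -> {ffun 'I_n -> 'I_K.+1} -> R -> R[i] }.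

Section Beams.
Context {R : realType} {X : topologicalType} {n K : nat}.
Implicit Type D : beam_data R X n K.

(* a_{j,i}, homogeneous of degree i in z'. It is meaningful on the domain of
   the Fermi coordinates. *)
Definition beam_hom D (j i : nat) (p : X) : R[i] :=
  let z := cmap (beam_fermi D) p in
  \sum_(alpha : {ffun 'I_n -> 'I_K.+1} | (\sum_k alpha k == i)%N)
    beam_coef D j alpha (z 0 ord0)
    * \prod_k ((z 0 (lift ord0 k))%:C%C ^+ alpha k).

Definition beam_amp D (j : nat) (p : X) : R[i] :=
  \sum_(i < K.+1) beam_hom D j i p.

(* The beam e^{i Phi / h} chi (a_0 + a_1 h + ... + a_K h^K). *)
Definition beam D (h : R) (p : X) : R[i] :=
  cexp ('i%C * beam_phase D p / h%:C%C) *
  ((beam_cut D p)%:C%C * \sum_(j < K.+1) beam_amp D j p * h%:C%C ^+ j).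

Context {N : manifold R X n.+1}.

(* [A] stands for M_T. The potential Q is only meaningful on A, so the transport
   equations involving Q are imposed at the points of the geodesic in A.
   The cut-off is extended by 0 outside the Fermi tube; smoothness of the
   amplitude is required in the tube, and the amplitude is compactly supported in
   the transversal variables z'. It is not required to vanish towards the ends
   of I: with the transport equation for a_0 that would force a_0 to be flat
   along the geodesic. *)
Record formal_beam (g : lorentzian N) (A : set X) (Q : X -> R[i]) D : Prop :=
  FormalBeam {
  beam_geodP : lightlike_geodesic g (beam_geod D) (beam_int D);
  beam_fermiP : fermi_coordinates g (beam_geod D) (beam_int D) (beam_rad D)
                  (beam_fermi D);
  beam_phase_smooth : csmooth N (beam_phase D);
  beam_eikonal : forall s (alpha : 'I_n.+1 -> nat),
    beam_int D s -> (\sum_i alpha i <= K)%N ->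
    multi_pd alpha (fun x => inner g (beam_phase D) (beam_phase D)
                               (cinv (beam_fermi D) x)) (axis s) = 0;
  beam_phase_real : forall s, beam_int D s ->
    complex.Im (beam_phase D (beam_geod D s)) = 0;
  beam_phase_Im : exists2 C : R, 0 < C &
    forall p, cdom (beam_fermi D) p ->
      C * tsq (cmap (beam_fermi D) p) <= complex.Im (beam_phase D p);
  beam_cut_ge0 : forall p, 0 <= beam_cut D p;
  beam_cut_smooth : smooth_on (cimg (beam_fermi D))
    (fun x => beam_cut D (cinv (beam_fermi D) x));
  beam_cut1 : forall p, cdom (beam_fermi D) p ->
    tsq (cmap (beam_fermi D) p) <= (beam_rad D / 4) ^+ 2 -> beam_cut D p = 1;
  beam_cut0 : forall p, cdom (beam_fermi D) p ->
    (beam_rad D / 2) ^+ 2 <= tsq (cmap (beam_fermi D) p) -> beam_cut D p = 0;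
  beam_cut_out : forall p, ~ cdom (beam_fermi D) p -> beam_cut D p = 0;
  beam_amp_smooth : forall j, (j <= K)%N ->
    csmooth_on (cimg (beam_fermi D))
               (fun x => beam_amp D j (cinv (beam_fermi D) x));
  beam_transport0 : forall s (alpha : 'I_n.+1 -> nat),
    beam_int D s -> (\sum_i alpha i <= K)%N ->
    multi_pd alpha (fun x => transport g (beam_phase D) (beam_amp D 0)
                               (cinv (beam_fermi D) x)) (axis s) = 0;
  beam_transport : forall k s (alpha : 'I_n.+1 -> nat), (1 <= k <= K)%N ->
    beam_int D s -> A (beam_geod D s) -> (\sum_i alpha i <= K)%N ->
    multi_pd alpha (fun x => let p := cinv (beam_fermi D) x in
      - 'i%C * transport g (beam_phase D) (beam_amp D k) p
      + (box g (beam_amp D k.-1) p + Q p * beam_amp D k.-1 p)) (axis s) = 0 }.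

(* Both geodesics pass through p0 and they have different germs there, i.e.
   they are not two arcs of one geodesic. *)
Definition distinct_geodesics_through D1 D2 (p0 : X) : Prop :=
  [/\ (beam_geod D1 @` beam_int D1) p0, (beam_geod D2 @` beam_int D2) p0 &
      forall V, nbhs p0 V ->
        V `&` (beam_geod D1 @` beam_int D1)
        <> V `&` (beam_geod D2 @` beam_int D2)].

(* chi is a smooth function supported in a ball B(p0, rho) of some local
   coordinate system, whose closure lies in both Fermi tubes. *)
Definition cutoff_near D1 D2 (p0 : X) (chi : X -> R) : Prop :=
  smooth N chi /\
  exists (beta : chart R X n.+1) (rho : R),
    [/\ atlas N beta, cdom beta p0, 0 < rho,
        forall x, esq (x - cmap beta p0) <= rho ^+ 2 ->
          cimg beta x /\ cdom (beam_fermi D1) (cinv beta x)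
                      /\ cdom (beam_fermi D2) (cinv beta x) &
        closure [set p | chi p != 0] `<=`
          cinv beta @` [set x | esq (x - cmap beta p0) < rho ^+ 2]].

Definition chi_p0 D1 D2 (chiB : X -> R) (p : X) : R :=
  beam_cut D1 p * beam_cut D2 p * chiB p.

Definition supp_p0 D1 D2 (chiB : X -> R) : set X :=
  closure [set p | chi_p0 D1 D2 chiB p != 0].

(* The coefficients b_l. *)
Definition prod_coef D1 D2 (chiB : X -> R) (l : nat) (p : X) : R[i] :=
  (chi_p0 D1 D2 chiB p)%:C%C *
  \sum_(m < K.+1) \sum_(m' < K.+1 | (m + m')%N == l)
    beam_amp D1 m p * beam_amp D2 m' p.

Definition sum_phase D1 D2 (p : X) : R[i] := beam_phase D1 p + beam_phase D2 p.

Definition source D1 D2 (chiB : X -> R) (q : X -> R[i]) (h : R) (p : X) : R[i] :=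
  cexp ('i%C * sum_phase D1 D2 p / h%:C%C) *
  \sum_(l < (2 * K).+1) q p * prod_coef D1 D2 chiB l p * h%:C%C ^+ l.

End Beams.

(* The right-hand side of the recursion for c_j (1 < j) at p. The term in
   <grad Phi, grad c_(j-1)> has the sign that makes c a formal solution for the
   above convention for [box]: the coefficient of h^(j-2) in
   e^(-i Phi / h) (box + Q) (e^(i Phi / h) sum_j c_j h^j) is
   <grad Phi, grad Phi> c_j + i (box Phi) c_(j-1)
     - 2 i <grad Phi, grad c_(j-1)> + (box + Q) c_(j-2),
   so the numerator is
   q b_(j-2) - (box + Q) c_(j-2) + i (transport Phi c_(j-1)). *)
Definition recursion_rhs (R : realType) (X : topologicalType) (n : nat)
    (N : manifold R X n.+1) (g : lorentzian N) (Q q Phi : X -> R[i])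
    (b c : nat -> X -> R[i]) (j : nat) (p : X) : R[i] :=
  (q p * b (j - 2)%N p
   - (box g (c (j - 2)%N) p + Q p * c (j - 2)%N p)
   - 'i%C * box g Phi p * c (j - 1)%N p
   + 2%:R * 'i%C * inner g Phi (c (j - 1)%N) p) / inner g Phi Phi p.

Record partition_of_unity (R : realType) (X : topologicalType) (m : nat)
    (N : manifold R X m) := PartitionOfUnity {
  pu_chart : nat -> chart R X m;
  pu_fun : nat -> X -> R;
  pu_atlas : forall i, atlas N (pu_chart i);
  pu_smooth : forall i, smooth N (pu_fun i);
  pu_ge0 : forall i p, 0 <= pu_fun i p;
  pu_compact : forall i, compact (closure [set p | pu_fun i p != 0]);
  pu_supp : forall i, closure [set p | pu_fun i p != 0] `<=` cdom (pu_chart i);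
  pu_locally_finite : forall p : X, exists2 V, nbhs p V &
    finite_set [set i | (V `&` closure [set p | pu_fun i p != 0]) !=set0];
  pu_sum : forall p : X, (\sum_(i <oo) (pu_fun i p)%:E)%E = 1%E :> \bar R }.

(* The H^k(A) norm
   (sum_i sum_{|alpha| <= k} || d^alpha (pu_fun i * u) ||^2_{L^2(A)})^{1/2},
   computed in the coordinates pu_chart i. For functions supported in a fixed
   compact set, different partitions of unity give equivalent norms. *)
Definition sobolev_norm (R : realType) (X : topologicalType) (m : nat)
    (N : manifold R X m) (P : partition_of_unity N) (A : set X) (k : nat)
    (u : X -> R[i]) : \bar R :=
  sqrte (\sum_(i <oo)
    \sum_(alpha : {ffun 'I_m -> 'I_k.+1} | (\sum_a alpha a <= k)%N)
      iterint (fun x : 'rV[R]_m =>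
        (\1_(cmap (pu_chart P i) @` (cdom (pu_chart P i) `&` A)) x *
         csqnorm (multi_pd (fun a => alpha a : nat)
           (fun y => let p := cinv (pu_chart P i) y in
                     (pu_fun P i p)%:C%C * u p) x))%:E))%E.

(* Main.v *)
(* With L_j = (box + Q) c_j and M_j = i (box Phi) c_j - 2 i <grad Phi, grad c_j>,
   conjugating box + Q by e^(i Phi / h) turns the sum of the c_j h^j into the sum
   of h^j L_j + h^(j-1) M_j + h^(j-2) <grad Phi, grad Phi> c_j. The recursion for
   c_j makes this telescope: only q b_(j-2) h^(j-2) and the three top-order
   terms survive, so the residual is
   e^(i Phi / h) (h^(2K+1) (L_(2K+1) + M_(2K+2)) + h^(2K+2) L_(2K+2)).
   Every c_j vanishes off N_0, and the division is harmless because the numerator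
   vanishes off N_0 while the denominator does not vanish on N_0. On N_0 the phase
   has Im Phi >= 0, so |e^(i Phi / h)| <= 1 and each of the k derivatives costs at
   most a factor 1/h; a compact support meets finitely many charts of the
   partition of unity.
   Since box and inner are computed in a chart depending on the point, their
   smoothness rests on their invariance under changes of coordinates, which for
   box is Piola's identity sum_a d_a (adj J)_(a c) = 0. *)

Require Import Defs.
From HB Require Import structures.
From mathcomp Require Import all_boot all_order all_algebra.
From mathcomp Require Import all_classical all_reals all_analysis.
From mathcomp.real_closed Require Import complex.
From mathcomp Require Import perm ring lra.

Set Implicit Arguments.
Unset Strict Implicit.
Unset Printing Implicit Defensive.

Import Order.TTheory GRing.Theory Num.Theory.
Import numFieldNormedType.Exports.

Local Open Scope classical_set_scope.
Local Open Scope ring_scope.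

(** * Differentiability and the chain rule *)

(** Smoothness here means that all iterated partial derivatives exist and are continuous; no total
    derivative is given. A change of coordinates needs the chain rule, which forces the passage from
    continuous partials to differentiability at the start. Schwarz's theorem is there because
    Piola's identity rests on it. [box] and [inner] at p use [chart_at N p], a choice that varies
    with p without any regularity. Identities at a single point (Leibniz rule, rule for
    exponentials, locality) are proved inside that one chart and need no invariance. Invariance
    enters only when p moves: it shows that [box g u] and [inner g u v] are again smooth, which the
    recursion requires at each step, since it differentiates the earlier c_j. Because the
    coefficients of g are real, invariance is proved for real functions and applied to real and
    imaginary parts. The constant C has to be chosen before h. So the derivatives of e^(i Phi / h) a
    are written as e^(i Phi / h) times a polynomial in 1/h whose coefficients are free of h;
    compactness bounds these coefficients once and for all. *)

Section Calculus.
Context {R : realType}.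

(** The one-variable mean value theorem for t |-> f (t v + y). The sign of a is free, so the
    intermediate t is located only by its absolute value; for a < 0 the theorem is used on
    [a, 0]. *)
Lemma mvt_dir (V : normedModType R) (f : V -> R) (y v : V) (a : R) :
  (forall t : R, `|t| <= `|a| -> derivable f (t *: v + y) v) ->
  exists2 t : R, `|t| <= `|a| & f (a *: v + y) - f y = a * 'D_v f (t *: v + y).
Proof.
move=> df; pose G (t : R) := f (t *: v + y).
have dG (t : R) : `|t| <= `|a| -> is_derive t (1 : R) G ('D_v f (t *: v + y)).
  move=> /df dft.
  have E : (fun h : R => h^-1 *: ((G \o shift t) (h *: 1) - G t)) =
           (fun h : R => h^-1 *: ((f \o shift (t *: v + y)) (h *: v)
                                  - f (t *: v + y))).
    apply/funext => h; rewrite /G /= addrA -scalerDl.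
    by rewrite [h%:A](mulr1 h).
  have dGt : derivable G t (1 : R) by rewrite /derivable E.
  by split=> //; rewrite /derive E.
have cG (t : R) : `|t| <= `|a| -> {for t, continuous G}.
  by move=> /dG dGt; apply: differentiable_continuous; apply/derivable1_diffP.
have -> : f y = G 0 by rewrite /G scale0r add0r.
rewrite -/(G a).
have [a0|a0] := leP 0 a.
- have Ha t : t \in `[0, a] -> `|t| <= `|a|.
    by rewrite in_itv/= => /andP[t0 ta]; rewrite !ger0_norm.
  have [] := @MVT_segment R G (fun t => 'D_v f (t *: v + y)) 0 a a0.
  + by move=> t ht; apply/dG/Ha; apply: subset_itv_oo_cc ht.
  + by apply: continuous_in_subspaceT => t; rewrite inE /= => /Ha/cG.
  + move=> t /Ha ta; rewrite subr0 => E; exists t => //.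
    by rewrite E mulrC.
- have Ha t : t \in `[a, 0] -> `|t| <= `|a|.
    by rewrite in_itv/= => /andP[t0 ta]; rewrite !ler0_norm ?lerN2// ltW.
  have [] := @MVT_segment R G (fun t => 'D_v f (t *: v + y)) a 0 (ltW a0).
  + by move=> t ht; apply/dG/Ha; apply: subset_itv_oo_cc ht.
  + by apply: continuous_in_subspaceT => t; rewrite inE /= => /Ha/cG.
  + move=> t /Ha ta; rewrite sub0r => E; exists t => //.
    by rewrite -opprB E mulrN opprK mulrC.
Qed.

Lemma continuous_row (T : topologicalType) m (Y : T -> 'rV[R]_m) (x : T) :
  (forall j, {for x, continuous (fun t => Y t 0 j)}) -> {for x, continuous Y}.
Proof.
move=> cY; apply/cvgrPdist_le => /= e e0.
near=> t; rewrite /Num.Def.normr/= mx_normrE (bigmax_le _ (ltW e0))//= => -[i j] _.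
rewrite !mxE/= ord1.
move: j; near: t; apply: filter_forall => j.
by have /cvgrPdist_le/(_ _ e0) := cY j.
Unshelve. all: by end_near. Qed.

Lemma mx_entry_le m n (A : 'M[R]_(m, n)) i j : `|A i j| <= `|A|.
Proof.
rewrite [leRHS]/Num.Def.normr/= mx_normrE.
by apply: le_trans; last exact: (le_bigmax _ _ (i, j)).
Qed.

Lemma mx_norm_le m n (A : 'M[R]_(m, n)) (e : R) : 0 <= e ->
  (forall i j, `|A i j| <= e) -> `|A| <= e.
Proof.
move=> e0 H; by rewrite /Num.Def.normr/= mx_normrE (bigmax_le _ e0)//= => -[i j] _.
Qed.

End Calculus.

Local Notation vbase i := (delta_mx 0 i).

Section C1.
Context {R : realType} {m : nat}.
Implicit Types (U : set 'rV[R]_m) (f g : 'rV[R]_m -> R) (x y v : 'rV[R]_m).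

(** Corners of the staircase from 0 to v that changes one coordinate at a time; each step is
    parallel to an axis, where only a partial derivative is needed. *)
Definition trunc k v : 'rV[R]_m := \row_i (if (i < k)%N then v 0 i else 0).

Lemma truncS (i : 'I_m) v : trunc i.+1 v = v 0 i *: vbase i + trunc i v.
Proof.
apply/rowP => j; rewrite !mxE eqxx/= ltnS leq_eqVlt.
have [->|ne] := eqVneq j i; first by rewrite eqxx ltnn/= mulr1 addr0.
by rewrite -(inj_eq val_inj) in ne; rewrite (negbTE ne) mulr0 add0r.
Qed.

(** In the sup norm the staircase never leaves the ball of radius |v|, so hypotheses on that ball
    cover every intermediate point. *)
Lemma trunc_line (i : 'I_m) v (t : R) : `|t| <= `|v 0 i| ->
  `|t *: vbase i + trunc i v| <= `|v|.
Proof.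
move=> tv; apply: mx_norm_le => // a j; rewrite !mxE (ord1 a) eqxx /=.
have [->|ne] := eqVneq j i.
  by rewrite ltnn mulr1 addr0 (le_trans tv)// mx_entry_le.
rewrite mulr0 add0r; case: ifP => _; last by rewrite normr0.
by rewrite mx_entry_le.
Qed.

(** The mean value theorem is summed over the m steps of the staircase; each step errs by at most e
    |v_i| <= e |v|, hence the factor m. With L the gradient at x this is the remainder estimate for
    differentiability. *)
Lemma pd_telescope f x v (L : 'I_m -> R) (e : R) :
  (forall y i, `|y| <= `|v| -> derivable f (y + x) (vbase i) /\
    `|pd i f (y + x) - L i| <= e) ->
  `|f (v + x) - f x - \sum_i v 0 i * L i| <= m%:R * e * `|v|.
Proof.
move=> H.
have key k : (k <= m)%N ->
  `|f (trunc k v + x) - f x - \sum_(i < m | (i < k)%N) v 0 i * L i|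
   <= k%:R * e * `|v|.
  elim: k => [_|k IH km].
    have -> : trunc 0 v = 0 by apply/rowP => j; rewrite !mxE.
    by rewrite add0r subrr big_pred0// subrr normr0 !mul0r.
  have {}IH := IH (ltnW km).
  pose i := Ordinal km.
  rewrite (bigD1 i)//= (eq_bigl (fun j : 'I_m => (j < k)%N)); last first.
    move=> j /=; rewrite ltnS leq_eqVlt -(inj_eq val_inj)/=.
    by case: (ltngtP j k) => //.
  rewrite (truncS i) /=.
  have [|t tv E] := @mvt_dir R _ f (trunc k v + x) (vbase i) (v 0 i).
    move=> t tv; rewrite addrA.
    by have [] := H _ i (trunc_line tv).
  rewrite !addrA in E.
  have -> : f (v 0 i *: vbase i + trunc k v + x) - f x -
     (v 0 i * L i + \sum_(j < m | (j < k)%N) v 0 j * L j) =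
     v 0 i * (pd i f (t *: vbase i + trunc k v + x) - L i) +
     (f (trunc k v + x) - f x - \sum_(j < m | (j < k)%N) v 0 j * L j).
    by rewrite mulrBr /pd -E; ring.
  rewrite (le_trans (ler_normD _ _))// -[k.+1]addn1 natrD !mulrDl addrC lerD//.
  rewrite mul1r normrM mulrC ler_pM// ?mx_entry_le//.
  by have [] := H _ i (trunc_line tv).
have := key m (leqnn m).
have -> : trunc m v = v by apply/rowP => j; rewrite !mxE ltn_ord.
by rewrite (eq_bigl xpredT)// => i; rewrite ltn_ord.
Qed.

Lemma C1_differentiable f x :
  (\forall y \near x, forall i, derivable f y (vbase i)) ->
  (forall i, {for x, continuous (pd i f)}) ->
  differentiable f x.
Proof.
move=> df cf.
pose A : 'cV[R]_m := \col_i pd i f x.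
pose L (v : 'rV[R]_m) : R := (v *m A) 0 0.
have LE v : L v = \sum_i v 0 i * pd i f x.
  by rewrite /L mxE; apply: eq_bigr => i _; rewrite mxE.
have Llin : linear L.
  by move=> a u v; rewrite /L mulmxDl -scalemxAl !mxE.
pose HL := GRing.isLinear.Build _ _ _ _ L Llin.
pose Lm : {linear 'rV[R]_m -> R} := HB.pack L HL.
have cL : continuous Lm.
  move=> v; rewrite /Lm /= /L.
  have -> : (fun v : 'rV[R]_m => (v *m A) 0 0) = \sum_i (fun v : 'rV[R]_m => v 0 i * pd i f x).
    by apply/funext => u; rewrite fct_sumE -LE.
  apply: (@big_ind _ (fun h : 'rV[R]_m -> R => {for v, continuous h})).
  - exact: cst_continuous.
  - by move=> *; exact: continuousD.
  - move=> i _; apply: continuousM; last exact: cst_continuous.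
    exact: coord_continuous.
have fo : f \o shift x = cst (f x) + Lm +o_ (0 : 'rV[R]_m) id.
  apply/eqaddoP => _/posnumP[e].
  (* Dividing by m + 1 makes the m step errors add up to at most e |v|, and stays meaningful for m =
     0. *)
  pose d : R := e%:num / m.+1%:R.
  have d0 : 0 < d by rewrite divr_gt0.
  have : \forall y \near x, forall i, derivable f y (vbase i) /\ `|pd i f y - pd i f x| <= d.
    have H i : \forall y \near x, `|pd i f y - pd i f x| <= d.
      have /cvgrPdist_le/(_ _ d0) := cf i.
      by apply: filterS => y; rewrite distrC.
    have {}H : \forall y \near x, forall i, `|pd i f y - pd i f x| <= d.
      exact: (@filter_forall _ _ (fun i y => `|pd i f y - pd i f x| <= d) (nbhs x) _ H).
    by move: df H; apply: filterS2 => y H1 H2 i; split.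
  move=> /nbhs_ballP[r /= r0 rH].
  near=> v.
  rewrite !fctE /= /Lm /= opprD addrA LE.
  apply: (le_trans (@pd_telescope f x v (fun i => pd i f x) d _)).
    move=> y i yv; apply: rH.
    rewrite -ball_normE /= opprD addrCA subrr addr0 normrN.
    apply: le_lt_trans yv _.
    near: v; exact: (@nbhs0_lt _ 'rV[R]_m _ r0).
  rewrite ler_wpM2r// /d mulrCA ler_piMr// ler_pdivrMr ?ltr0n// mul1r ler_nat.
  exact: leqnSn.
have dE := diff_unique cL fo.
by apply/diff_locallyP; rewrite dE.
Unshelve. all: by end_near. Qed.

Lemma diff_row f x (v : 'rV[R]_m) : differentiable f x ->
  'd f x v = \sum_i v 0 i * pd i f x.
Proof.
move=> df; rewrite {1}(row_sum_delta v) linear_sum; apply: eq_bigr => i _.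
by rewrite linearZ /= /pd deriveE.
Qed.

End C1.

Lemma derive_line (R : numFieldType) (V W : normedModType R) (f : V -> W) (x v : V) :
  'D_v f x = 'D_1 (fun h : R => f (h *: v + x)) 0.
Proof.
rewrite /derive; set g1 := fun h => h^-1 *: _; set g2 := fun h => h^-1 *: _.
suff -> : g1 = g2 by [].
by rewrite funeqE /g1 /g2 => h /=; rewrite addr0 scale0r add0r [_%:A]mulr1.
Qed.

Section ChainRule.
Context {R : realType} {m p : nat}.

(** Only the outer f needs a total derivative. Along the line h |-> Y (h v + x) the inner map is a
    curve, for which derivability and differentiability agree. *)
Lemma derive_comp_row (f : 'rV[R]_p -> R) (Y : 'rV[R]_m -> 'rV[R]_p) x (v : 'rV[R]_m) :
  differentiable f (Y x) ->
  (forall j, derivable (fun y => Y y 0 j) x v) ->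
  is_derive x v (f \o Y) (\sum_j 'D_v (fun y => Y y 0 j) x * pd j f (Y x)).
Proof.
move=> df dY.
have dYv : derivable Y x v by apply/derivable_mxP => i j; rewrite ord1.
pose c (h : R) := Y (h *: v + x).
have dc : differentiable c 0 by apply/derivable1_diffP; move/derivable1P: dYv.
have c0 : c 0 = Y x by rewrite /c scale0r add0r.
have df0 : differentiable f (c 0) by rewrite c0.
have dfc : differentiable (f \o c) 0 by apply: differentiable_comp.
have dd : derivable (f \o Y) x v.
  by apply/derivable1P/derivable1_diffP.
split=> //.
have -> : 'D_v (f \o Y) x = 'D_1 (f \o c) 0 by rewrite [LHS]derive_line.
have E : 'd c 0 1 = 'D_v Y x.
  by rewrite [RHS]derive_line -/c (deriveE _ dc).
rewrite deriveE// diff_comp//= E c0 diff_row//.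
by apply: eq_bigr => j _; rewrite derive_mx// mxE.
Qed.

End ChainRule.

(** * Smooth functions on open sets *)

Lemma near_eq_continuous (S T : topologicalType) (f g : S -> T) (x : S) :
  (\forall y \near x, f y = g y) ->
  {for x, continuous f} -> {for x, continuous g}.
Proof.
move=> fg; rewrite /prop_for /continuous_at -(nbhs_singleton fg).
by apply: cvg_trans; apply: near_eq_cvg; apply: filterS fg => y ->.
Qed.

Section PartialDerivatives.
Context {R : realType} {m : nat}.
Implicit Types (U : set 'rV[R]_m) (f g : 'rV[R]_m -> R) (x y v : 'rV[R]_m).

Lemma pd_near i f g x : (\forall y \near x, f y = g y) -> pd i f x = pd i g x.
Proof. exact: near_eq_derive. Qed.

Lemma pd_cst i (a : R) x : pd i (fun=> a) x = 0.
Proof. exact: derive_cst. Qed.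

Lemma derivable_oppr f x v : derivable f x v -> derivable (fun y => - f y) x v.
Proof. exact: derivableN. Qed.

Lemma derivable_mul f g x v : derivable f x v -> derivable g x v ->
  derivable (fun y => f y * g y) x v.
Proof. exact: derivableM. Qed.

Lemma pdD i f g x : derivable f x (vbase i) -> derivable g x (vbase i) ->
  pd i (fun y => f y + g y) x = pd i f x + pd i g x.
Proof. exact: deriveD. Qed.

Lemma pdN i f x : derivable f x (vbase i) ->
  pd i (fun y => - f y) x = - pd i f x.
Proof. exact: deriveN. Qed.

Lemma pdM i f g x : derivable f x (vbase i) -> derivable g x (vbase i) ->
  pd i (fun y => f y * g y) x = f x * pd i g x + g x * pd i f x.
Proof. exact: deriveM. Qed.

Lemma derivable_bigsum (I : Type) (r : seq I) (P : pred I)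
    (f : I -> 'rV[R]_m -> R) x v :
  (forall k, P k -> derivable (f k) x v) ->
  derivable (fun y => \sum_(k <- r | P k) f k y) x v.
Proof.
move=> df; have -> : (fun y => \sum_(k <- r | P k) f k y) = \sum_(k <- r | P k) f k.
  by apply/funext => y; rewrite fct_sumE.
elim/big_ind : _ => [|f1 f2 d1 d2|k Pk].
- exact: (@derivable_cst R _ _ (0 : R) x v).
- exact: derivableD.
- exact: df.
Qed.

Lemma pd_sum (I : Type) (r : seq I) (P : pred I) (f : I -> 'rV[R]_m -> R) i x :
  (forall k, P k -> derivable (f k) x (vbase i)) ->
  pd i (fun y => \sum_(k <- r | P k) f k y) x = \sum_(k <- r | P k) pd i (f k) x.
Proof.
move=> df; elim: r => [|k r IH].
  rewrite big_nil (_ : (fun _ => _) = (fun=> 0)) ?pd_cst//.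
  by apply/funext => y; rewrite big_nil.
rewrite big_cons (_ : (fun _ => _) = (fun y => (if P k then f k y else 0) +
   \sum_(k <- r | P k) f k y)); last first.
  by apply/funext => y; rewrite big_cons; case: (P k) => //; rewrite add0r.
have dk := @derivable_bigsum _ r P f x (vbase i) df.
case: (boolP (P k)) => Pk; first by rewrite (pdD (df k Pk) dk) IH.
have d0 : derivable (fun=> 0 : R) x (vbase i) by exact: derivable_cst.
by rewrite (pdD d0 dk) pd_cst add0r IH.
Qed.

Lemma is_derive_comp1 (phi : R -> R) f x v d : derivable f x v ->
  is_derive (f x) 1 phi d -> is_derive x v (fun y => phi (f y)) (d * 'D_v f x).
Proof.
move=> df [dphi <-].
pose c (h : R) := f (h *: v + x).
have dc : derivable c 0 1 by move/derivable1P: df.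
have c0 : c 0 = f x by rewrite /c scale0r add0r.
have dphic : derivable phi (c 0) 1 by rewrite c0; exact: dphi.
have dd : derivable (phi \o c) 0 1.
  apply/derivable1_diffP; move/derivable1_diffP: dc => dc'.
  by move/derivable1_diffP: dphic => dphic'; exact: differentiable_comp.
split; first exact/derivable1P.
have := derive1_comp dc dphic; rewrite !derive1E c0 => E.
by rewrite [LHS]derive_line [in RHS](derive_line f) -E.
Qed.

(** [smooth_on] speaks of all sequences of derivatives at once and gives no handle for products,
    quotients or compositions. Counting the derivatives makes induction possible; each step peels
    off the derivative that is applied first. *)
Fixpoint Ck k U f : Prop := match k with
  | 0 => forall x, U x -> {for x, continuous f}
  | k'.+1 => [/\ forall x, U x -> {for x, continuous f},
      forall i x, U x -> derivable f x (vbase i) & forall i, Ck k' U (pd i f)]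
  end.

Lemma smooth_on_pd U f i : smooth_on U f -> smooth_on U (pd i f).
Proof. by move=> sf s x Ux; have := sf (rcons s i) x Ux; rewrite /pds foldr_rcons. Qed.

Lemma smooth_on_cont U f x : smooth_on U f -> U x -> {for x, continuous f}.
Proof. by move=> sf /(sf [::])[]. Qed.

Lemma smooth_on_derivable U f i x : smooth_on U f -> U x -> derivable f x (vbase i).
Proof. by move=> sf /(sf [::])[_ /(_ i)]. Qed.

Lemma smooth_onP U f : smooth_on U f <-> forall k, Ck k U f.
Proof.
split=> [+ k|].
  elim: k f => [|k IH] f sf /=; first by move=> x; exact: smooth_on_cont.
  split=> [x|i x|i]; [exact: smooth_on_cont|exact: smooth_on_derivable|].
  exact/IH/smooth_on_pd.
move=> + s; elim/last_ind: s f => [|s i IH] f sf x Ux.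
  by have [cf df _] := sf 1%N; split; [exact: cf|move=> i; exact: df].
rewrite /pds foldr_rcons; apply: IH => // k.
by case: (sf k.+1) => _ _; apply.
Qed.

Lemma CkW k U f : Ck k.+1 U f -> Ck k U f.
Proof.
elim: k f => [|k IH] f; first by case.
by move=> [cf df sf]; split=> // i; apply/IH.
Qed.

Lemma Ck_eq k U f g : open U -> (forall x, U x -> f x = g x) ->
  Ck k U f -> Ck k U g.
Proof.
move=> oU; elim: k f g => [|k IH] f g fg.
  move=> /= cf x Ux; apply: near_eq_continuous (cf x Ux).
  by have := open_nbhs_nbhs (conj oU Ux); apply: filterS => y; exact: fg.
have near x : U x -> \forall y \near x, f y = g y.
  by move=> Ux; have := open_nbhs_nbhs (conj oU Ux); apply: filterS => y; exact: fg.
case=> cf df sf; split=> [x Ux|i x Ux|i].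
- exact: near_eq_continuous (near _ Ux) (cf x Ux).
- by apply: near_eq_derivable (near _ Ux) (df i x Ux).
- by apply: IH (sf i) => x Ux; apply: pd_near; exact: near.
Qed.

Lemma Ck_cst k U (a : R) : Ck k U (fun=> a).
Proof.
elim: k a => [|k IH] a; first by move=> x _; exact: cst_continuous.
split=> [x _|i x _|i]; [exact: cst_continuous|exact: derivable_cst|].
rewrite (_ : pd i _ = (fun=> 0))//; apply/funext => x; exact: pd_cst.
Qed.

Lemma CkD k U f g : open U -> Ck k U f -> Ck k U g -> Ck k U (fun x => f x + g x).
Proof.
move=> oU; elim: k f g => [|k IH] f g.
  by move=> /= cf cg x Ux; apply: continuousD; [exact: cf|exact: cg].
move=> [cf df sf] [cg dg sg]; split=> [x Ux|i x Ux|i].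
- by apply: continuousD; [exact: cf|exact: cg].
- by apply: derivableD; [exact: df|exact: dg].
- apply: (Ck_eq oU _ (IH _ _ (sf i) (sg i))) => x Ux.
  by rewrite (pdD (df i x Ux) (dg i x Ux)).
Qed.

Lemma CkM k U f g : open U -> Ck k U f -> Ck k U g -> Ck k U (fun x => f x * g x).
Proof.
move=> oU; elim: k f g => [|k IH] f g.
  by move=> /= cf cg x Ux; apply: continuousM; [exact: cf|exact: cg].
move=> F G; have [cf df sf] := F; have [cg dg sg] := G; split=> [x Ux|i x Ux|i].
- by apply: continuousM; [exact: cf|exact: cg].
- by apply: derivableM; [exact: df|exact: dg].
- apply: (@Ck_eq _ _ (fun x => f x * pd i g x + g x * pd i f x) _ oU).
    by move=> x Ux; rewrite (pdM (df i x Ux) (dg i x Ux)).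
  exact: (CkD oU (IH _ _ (CkW F) (sg i)) (IH _ _ (CkW G) (sf i))).
Qed.

Lemma Ck_sum k U (I : Type) (r : seq I) (P : pred I) (f : I -> 'rV[R]_m -> R) :
  open U -> (forall i, P i -> Ck k U (f i)) ->
  Ck k U (fun x => \sum_(i <- r | P i) f i x).
Proof.
move=> oU H.
rewrite (_ : (fun x => _) = \sum_(i <- r | P i) f i); last first.
  by apply/funext => y; rewrite fct_sumE.
elim/big_ind : _ => [|f1 f2 c1 c2|i Pi].
- exact: (Ck_cst k U 0).
- exact: CkD.
- exact: H.
Qed.

(** The partials of phi o f are (dphi o f) times those of f, so order k for dphi o f yields order k
    + 1 for phi o f. For exp, sin, cos and the inverse, dphi is built from the same functions and
    the induction closes on itself; for ln it is the inverse. *)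
Lemma Ck_comp1_step k U f (phi dphi : R -> R) : open U ->
  (forall x, U x -> is_derive (f x) 1 phi (dphi (f x))) ->
  Ck k.+1 U f -> Ck k U (fun x => dphi (f x)) -> Ck k.+1 U (fun x => phi (f x)).
Proof.
move=> oU dp F G; have [cf df sf] := F.
have dd i x : U x -> is_derive x (vbase i) (fun y => phi (f y)) (dphi (f x) * pd i f x).
  by move=> Ux; apply: is_derive_comp1; [exact: df|exact: dp].
split=> [x Ux|i x Ux|i].
- have : {for f x, continuous phi}.
    by apply: differentiable_continuous; apply/derivable1_diffP; case: (dp x Ux).
  by apply: continuous_comp; exact: cf.
- by case: (dd i x Ux).
- apply: (@Ck_eq _ _ (fun x => dphi (f x) * pd i f x) _ oU).
    by move=> x Ux; case: (dd i x Ux).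
  exact: (CkM oU G (sf i)).
Qed.

End PartialDerivatives.

Section SmoothClosure.
Context {R : realType} {m : nat}.
Implicit Types (U : set 'rV[R]_m) (f g : 'rV[R]_m -> R) (x y v : 'rV[R]_m).

Lemma smooth_on_eq U f g : open U -> (forall x, U x -> f x = g x) ->
  smooth_on U f -> smooth_on U g.
Proof. by move=> oU fg /smooth_onP sf; apply/smooth_onP => k; exact: Ck_eq (sf k). Qed.

Lemma smooth_on_sub U V f : V `<=` U -> smooth_on U f -> smooth_on V f.
Proof. by move=> VU sf s x /VU; exact: sf. Qed.

Lemma smooth_on_local U f :
  (forall x, U x -> exists2 W, W x & smooth_on W f) -> smooth_on U f.
Proof. by move=> H s x /H[W Wx]; exact. Qed.

Lemma smooth_on_cst U (a : R) : smooth_on U (fun=> a).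
Proof. by apply/smooth_onP => k; exact: Ck_cst. Qed.

Lemma smooth_onD U f g : open U -> smooth_on U f -> smooth_on U g ->
  smooth_on U (fun x => f x + g x).
Proof. by move=> oU /smooth_onP F /smooth_onP G; apply/smooth_onP => k; exact: CkD. Qed.

Lemma smooth_onM U f g : open U -> smooth_on U f -> smooth_on U g ->
  smooth_on U (fun x => f x * g x).
Proof. by move=> oU /smooth_onP F /smooth_onP G; apply/smooth_onP => k; exact: CkM. Qed.

Lemma smooth_onN U f : open U -> smooth_on U f -> smooth_on U (fun x => - f x).
Proof.
move=> oU F; apply: (smooth_on_eq oU _ (smooth_onM oU (@smooth_on_cst U (-1)) F)).
by move=> x _; rewrite mulN1r.
Qed.

Lemma smooth_onB U f g : open U -> smooth_on U f -> smooth_on U g ->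
  smooth_on U (fun x => f x - g x).
Proof. by move=> oU F G; exact: (smooth_onD oU F (smooth_onN oU G)). Qed.

Lemma smooth_on_sum U (I : Type) (r : seq I) (P : pred I) (f : I -> 'rV[R]_m -> R) :
  open U -> (forall i, P i -> smooth_on U (f i)) ->
  smooth_on U (fun x => \sum_(i <- r | P i) f i x).
Proof.
move=> oU H; apply/smooth_onP => k; apply: Ck_sum => // i Pi.
by move: k; apply/smooth_onP; exact: H.
Qed.

Lemma smooth_on_prod U (I : Type) (r : seq I) (P : pred I) (f : I -> 'rV[R]_m -> R) :
  open U -> (forall i, P i -> smooth_on U (f i)) ->
  smooth_on U (fun x => \prod_(i <- r | P i) f i x).
Proof.
move=> oU H; elim: r => [|i r IH].
  by apply: (smooth_on_eq oU _ (@smooth_on_cst U 1)) => x _; rewrite big_nil.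
have [Pi|nPi] := boolP (P i).
  by apply: (smooth_on_eq oU _ (smooth_onM oU (H i Pi) IH)) => x _; rewrite big_cons Pi.
by apply: (smooth_on_eq oU _ IH) => x _; rewrite big_cons (negbTE nPi).
Qed.

Lemma smooth_onV U f : open U -> (forall x, U x -> f x != 0) -> smooth_on U f ->
  smooth_on U (fun x => (f x)^-1).
Proof.
move=> oU f0 /smooth_onP F; apply/smooth_onP; elim=> [|k IH].
  by move=> x Ux; apply: continuousV; [exact: f0|exact: (F 0%N)].
apply: (@Ck_comp1_step R m k U f (fun t => t^-1) (fun t => - (t^-1 * t^-1)) oU _ (F k.+1)).
  move=> x Ux; split; first by apply: derivableV => //; exact: f0.
  rewrite deriveV//; last exact: f0.
  rewrite derive_id -[LHS]/(_ * _) mulr1.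
  by rewrite expr2 invfM.
apply: (Ck_eq oU _ (CkM oU (Ck_cst k U (-1)) (CkM oU IH IH))) => x _.
by rewrite mulN1r.
Qed.

Lemma smooth_on_expR U f : open U -> smooth_on U f ->
  smooth_on U (fun x => expR (f x)).
Proof.
move=> oU /smooth_onP F; apply/smooth_onP; elim=> [|k IH].
  by move=> x Ux; apply: continuous_comp; [exact: (F 0%N)|exact: continuous_expR].
apply: (@Ck_comp1_step R m k U f expR expR oU _ (F k.+1) IH).
Qed.

Lemma smooth_on_sincos U f : open U -> smooth_on U f ->
  smooth_on U (fun x => sin (f x)) /\ smooth_on U (fun x => cos (f x)).
Proof.
move=> oU /smooth_onP F.
suff H k : Ck k U (fun x => sin (f x)) /\ Ck k U (fun x => cos (f x)).
  by split; apply/smooth_onP => k; case: (H k).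
elim: k => [|k [IHs IHc]].
  split=> x Ux; apply: continuous_comp; try exact: (F 0%N).
  - exact: continuous_sin.
  - exact: continuous_cos.
split.
  exact: (@Ck_comp1_step R m k U f sin cos oU _ (F k.+1) IHc).
apply: (@Ck_comp1_step R m k U f cos (fun t => - sin t) oU _ (F k.+1)).
apply: (Ck_eq oU _ (CkM oU (Ck_cst k U (-1)) IHs)) => x _.
by rewrite mulN1r.
Qed.

(** For f > 0 the root is exp (ln f / 2), a composition of functions already treated. *)
Lemma smooth_on_sqrt U f : open U -> (forall x, U x -> 0 < f x) -> smooth_on U f ->
  smooth_on U (fun x => Num.sqrt (f x)).
Proof.
move=> oU f0 F.
have lnf : smooth_on U (fun x => ln (f x)).
  apply/smooth_onP => -[|k].
    move=> x Ux; apply: continuous_comp; first exact: (smooth_on_cont F).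
    by apply: continuous_ln; exact: f0.
  apply: (@Ck_comp1_step R m k U f (@ln R) (fun t => t^-1) oU).
  - by move=> x Ux; apply: is_derive1_ln; exact: f0.
  - by move/smooth_onP : F.
  - move: k; apply/smooth_onP; apply: smooth_onV => // x Ux.
    by rewrite gt_eqF// f0.
have c2 := smooth_onM oU (@smooth_on_cst U 2^-1) lnf.
apply: (smooth_on_eq oU _ (smooth_on_expR oU c2)) => x Ux.
rewrite -powR12_sqrt; last exact/ltW/f0.
by rewrite /powR gt_eqF ?f0.
Qed.

End SmoothClosure.

Section Composition.
Context {R : realType} {m p : nat}.

Lemma smooth_on_differentiable (V : set 'rV[R]_p) f y :
  open V -> smooth_on V f -> V y -> differentiable f y.
Proof.
move=> oV sf Vy; apply: C1_differentiable => [|i].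
  have := open_nbhs_nbhs (conj oV Vy); apply: filterS => z Vz i.
  exact: smooth_on_derivable sf Vz.
by have := smooth_on_cont (smooth_on_pd i sf) Vy.
Qed.

Lemma is_derive_pd_comp (V : set 'rV[R]_p) f (Y : 'rV[R]_m -> 'rV[R]_p) x i :
  open V -> smooth_on V f -> V (Y x) ->
  (forall j, derivable (fun y => Y y 0 j) x (vbase i)) ->
  is_derive x (vbase i) (fun y => f (Y y))
    (\sum_j pd i (fun y => Y y 0 j) x * pd j f (Y x)).
Proof.
by move=> oV sf VY dY; apply: derive_comp_row => //; exact: smooth_on_differentiable VY.
Qed.

(** The induction on the order is for all f at once: the chain rule replaces f by its partials,
    which are again smooth on V, and multiplies them by partials of Y. *)
Lemma smooth_on_comp (U : set 'rV[R]_m) (V : set 'rV[R]_p) f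
    (Y : 'rV[R]_m -> 'rV[R]_p) : open U -> open V ->
  (forall j, smooth_on U (fun x => Y x 0 j)) -> (forall x, U x -> V (Y x)) ->
  smooth_on V f -> smooth_on U (fun x => f (Y x)).
Proof.
move=> oU oV sY UV sf; apply/smooth_onP => k; elim: k f sf => [|k IH] f sf.
  move=> x Ux; apply: continuous_comp; last exact/(smooth_on_cont sf)/UV.
  by apply: continuous_row => j; exact: smooth_on_cont (sY j) Ux.
have D i x (Ux : U x) : is_derive x (vbase i) (fun y => f (Y y))
    (\sum_j pd i (fun y => Y y 0 j) x * pd j f (Y x)).
  apply: is_derive_pd_comp (UV _ Ux) _ => // j.
  exact: smooth_on_derivable (sY j) Ux.
split=> [x Ux|i x Ux|i].
- apply: continuous_comp; last exact/(smooth_on_cont sf)/UV.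
  by apply: continuous_row => j; exact: smooth_on_cont (sY j) Ux.
- by case: (D i x Ux).
- apply: (@Ck_eq _ _ _ _ (fun x => \sum_j pd i (fun y => Y y 0 j) x * pd j f (Y x))) => //.
    by move=> x Ux; case: (D i x Ux).
  apply: Ck_sum => // j _; apply: CkM => //; last exact/IH/smooth_on_pd.
  by move: k {IH}; apply/smooth_onP; exact: smooth_on_pd.
Qed.

End Composition.

(** * Symmetry of second partial derivatives *)

Section MixedPartials.
Context {R : realType} {m : nat}.
Implicit Types (U : set 'rV[R]_m) (f : 'rV[R]_m -> R) (x y w v : 'rV[R]_m).

Lemma shift_line (f : 'rV[R]_m -> R) w x v :
  (fun h : R => f (w + (h *: v + x))) = (fun h : R => f (h *: v + (w + x))).
Proof. by apply/funext => h; rewrite addrCA. Qed.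

Lemma derive_shiftE f w x v : 'D_v (fun y => f (w + y)) x = 'D_v f (w + x).
Proof. by rewrite [LHS]derive_line [RHS]derive_line shift_line. Qed.

Lemma derivable_shiftE f w x v : derivable f (w + x) v ->
  derivable (fun y => f (w + y)) x v.
Proof. by move=> /derivable1P H; apply/derivable1P; rewrite shift_line. Qed.

Lemma norm_vbase (i : 'I_m) : `|vbase i : 'rV[R]_m| <= 1.
Proof.
apply: mx_norm_le => // a b; rewrite mxE.
by case: (_ && _); rewrite ?normr1 ?normr0.
Qed.

(** The mean value theorem is applied twice, along i to the difference of f in direction j, then
    along j to the i-th partial. The left side is symmetric in i and j, the right side is a mixed
    partial in one prescribed order. All points used are within 2 |a| of x. *)
Lemma second_difference f x (i j : 'I_m) (a : R) :
  (forall y, `|y| <= `|a| + `|a| -> derivable f (y + x) (vbase i) /\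
     derivable (pd i f) (y + x) (vbase j)) ->
  exists s t : R, [/\ `|s| <= `|a|, `|t| <= `|a| &
   f (a *: vbase j + (a *: vbase i + x)) - f (a *: vbase i + x)
   - (f (a *: vbase j + x) - f x) =
   a * (a * pd j (pd i f) (s *: vbase j + (t *: vbase i + x)))].
Proof.
move=> H.
have nZ (k : 'I_m) (t : R) : `|t| <= `|a| -> `|t *: (vbase k : 'rV[R]_m)| <= `|a|.
  by move=> ta; rewrite normrZ -[leRHS]mulr1 ler_pM// norm_vbase.
pose phi y := f (a *: vbase j + y) - f y.
have d1 (t : R) : `|t| <= `|a| -> derivable f (a *: vbase j + (t *: vbase i + x)) (vbase i).
  move=> ta; rewrite addrA; apply: (H _ _).1.
  by rewrite (le_trans (ler_normD _ _))// lerD// nZ.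
have d2 (t : R) : `|t| <= `|a| -> derivable f (t *: vbase i + x) (vbase i).
  move=> ta; apply: (H _ _).1; rewrite (le_trans (nZ _ _ ta))//.
  by rewrite lerDl.
have [t ta Et] : exists2 t : R, `|t| <= `|a| & phi (a *: vbase i + x) - phi x =
    a * 'D_(vbase i) phi (t *: vbase i + x).
  apply: mvt_dir => t ta; apply: derivableB; last exact: d2.
  by apply: derivable_shiftE; exact: d1.
have [s sa Es] : exists2 s : R, `|s| <= `|a| &
    pd i f (a *: vbase j + (t *: vbase i + x)) - pd i f (t *: vbase i + x) =
    a * 'D_(vbase j) (pd i f) (s *: vbase j + (t *: vbase i + x)).
  apply: mvt_dir => s sa; rewrite addrA; apply: (H _ _).2.
  by rewrite (le_trans (ler_normD _ _))// lerD// nZ.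
exists s, t; split => //.
rewrite -[LHS]/(phi (a *: vbase i + x) - phi x) Et; congr (_ * _).
rewrite /pd -Es deriveB; [|by apply: derivable_shiftE; exact: d1|exact: d2].
by rewrite derive_shiftE.
Qed.

Lemma dist_thirds (p q r : R) : 0 < `|p - q| / 3 ->
  `|p - r| < `|p - q| / 3 -> `|r - q| < `|p - q| / 3 -> False.
Proof. by move=> d0 H1 H2; have := ler_distD r p q; lra. Qed.

(** Schwarz's theorem, by contradiction. The second difference, read in both orders, makes the two
    mixed partials agree at two points near x; continuity puts each common value within a third of
    the supposed gap of both values at x. *)
Lemma pd_comm U f x i j : open U -> smooth_on U f -> U x ->
  pd i (pd j f) x = pd j (pd i f) x.
Proof.
move=> oU sf Ux; apply/eqP; rewrite -subr_eq0 -normr_eq0 -[_ == 0]negbK.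
apply/negP => ne0; set d := `|_ - _| in ne0.
have d0 : 0 < d / 3 by rewrite divr_gt0// lt_neqAle eq_sym ne0 normr_ge0.
have near k l : \forall y \near x, `|pd k (pd l f) x - pd k (pd l f) y| < d / 3.
  have := smooth_on_cont (smooth_on_pd k (smooth_on_pd l sf)) Ux.
  by move=> /cvgrPdist_lt/(_ _ d0).
have : \forall y \near x, [/\ U y, `|pd i (pd j f) x - pd i (pd j f) y| < d / 3 &
   `|pd j (pd i f) x - pd j (pd i f) y| < d / 3].
  move: (near i j) (near j i) (open_nbhs_nbhs (conj oU Ux)).
  by apply: filterS3 => y; split.
move=> /nbhs_ballP[r /= r0 rH].
(* The evaluation points lie within 2 |a| < r of x, inside the ball where both continuity estimates
   hold. *)
pose a : R := r / 3.
have a0 : 0 < a by rewrite divr_gt0.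
have na : `|a| = a by rewrite ger0_norm// ltW.
have inr y : `|y| <= `|a| + `|a| -> ball x r (y + x).
  rewrite -ball_normE /= opprD addrCA subrr addr0 normrN => /le_lt_trans; apply.
  by rewrite na /a; lra.
have der k l y : `|y| <= `|a| + `|a| -> derivable f (y + x) (vbase k) /\
     derivable (pd k f) (y + x) (vbase l).
  move=> /inr/rH[Uy _ _]; split.
    exact: smooth_on_derivable sf Uy.
  exact: smooth_on_derivable (smooth_on_pd k sf) Uy.
have [s [t [sa ta E1]]] := second_difference (der i j).
have [s' [t' [sa' ta' E2]]] := second_difference (der j i).
have inr2 k l (u v : R) : `|u| <= `|a| -> `|v| <= `|a| ->
    ball x r (u *: vbase k + (v *: vbase l + x)).
  move=> ua va; rewrite addrA; apply: inr.
  rewrite (le_trans (ler_normD _ _))// lerD// normrZ -[leRHS]mulr1 ler_pM//;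
  exact: norm_vbase.
have {sa ta}[_ _ B1] := rH _ (inr2 j i _ _ sa ta).
have {sa' ta'}[_ B2 _] := rH _ (inr2 i j _ _ sa' ta').
have E : pd j (pd i f) (s *: vbase j + (t *: vbase i + x)) =
         pd i (pd j f) (s' *: vbase i + (t' *: vbase j + x)).
  apply: (mulfI (lt0r_neq0 a0)); apply: (mulfI (lt0r_neq0 a0)).
  apply: (etrans (esym E1)); apply: (etrans _ E2).
  have -> : a *: vbase j + (a *: vbase i + x) = a *: vbase i + (a *: vbase j + x).
    by rewrite addrCA.
  move: (f (a *: vbase i + (a *: vbase j + x))) (f (a *: vbase i + x)).
  move: (f (a *: vbase j + x)) (f x) => p1 p2 p3 p4; ring.
rewrite E distrC in B1.
exact: (dist_thirds d0 B2 B1).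
Qed.

End MixedPartials.

(** * Determinants and Piola's identity *)

Section Determinants.
Context {R : realType} {m n : nat}.
Implicit Types (A : 'rV[R]_m -> 'M[R]_n) (x : 'rV[R]_m).

Lemma is_derive_prod (I : eqType) (r : seq I) (f : I -> 'rV[R]_m -> R) (df : I -> R) x v :
  uniq r -> (forall k, is_derive x v (f k) (df k)) ->
  is_derive x v (fun y => \prod_(k <- r) f k y)
    (\sum_(k <- r) df k * \prod_(j <- r | j != k) f j x).
Proof.
move=> + dfk; elim: r => [_|k r IH /= /andP[kr ur]].
  rewrite big_nil (_ : (fun _ => _) = cst 1); first exact: is_derive_cst.
  by apply/funext => y; rewrite big_nil.
rewrite (_ : (fun _ => _) = f k * (fun y => \prod_(j <- r) f j y)); last first.
  by apply/funext => y; rewrite big_cons.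
have D := is_deriveM (dfk k) (IH ur).
apply: is_derive_eq; rewrite big_cons big_cons eqxx /= addrC.
congr (_ + _).
  rewrite -[LHS]/(_ * _) [LHS]mulrC; congr (_ * _).
  rewrite [RHS]big_seq_cond [LHS]big_seq_cond; apply: eq_bigl => j.
  have [->|_] := eqVneq j k; last by [].
  by rewrite (negbTE kr).
rewrite -[LHS]/(_ * _) mulr_sumr; apply: eq_big_seq => j jr.
rewrite big_cons.
have -> : k != j by apply: contraNneq kr => ->.
by rewrite mulrCA.
Qed.

(** Jacobi's formula. Differentiating the Leibniz expansion gives the sum over k of the determinants
    of [B k], where row k of A is replaced by its derivative; expanding each along that row produces
    the cofactors. *)
Lemma is_derive_det A x v :
  (forall k l, derivable (fun y => A y k l) x v) ->
  is_derive x v (fun y => \det (A y))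
   (\sum_k \sum_l 'D_v (fun y => A y k l) x * cofactor (A x) k l).
Proof.
move=> dA; pose D k l := 'D_v (fun y => A y k l) x.
pose B k := \matrix_(a, b) if a == k then D a b else A x a b.
have -> : \sum_k \sum_l 'D_v (fun y => A y k l) x * cofactor (A x) k l =
    \sum_k \det (B k).
  apply: eq_bigr => k _; rewrite (expand_det_row (B k) k).
  apply: eq_bigr => l _; rewrite mxE eqxx; congr (_ * (_ * \det _)).
  by apply/matrixP => a b; rewrite !mxE eq_sym (negbTE (neq_lift _ _)).
have -> : (fun y => \det (A y)) =
   \sum_(s : {perm 'I_n}) (fun y => (-1) ^+ s * \prod_k A y k (s k)).
  by apply/funext => y; rewrite fct_sumE.
have -> : \sum_k \det (B k) = \sum_(s : {perm 'I_n})
   (-1) ^+ s * (\sum_k D k (s k) * \prod_(j | j != k) A x j (s j)).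
  rewrite /determinant exchange_big/=; apply: eq_bigr => s _.
  rewrite -mulr_sumr; congr (_ * _); apply: eq_bigr => k _.
  rewrite (bigD1 k)//= mxE eqxx; congr (_ * _).
  by apply: eq_bigr => j /negbTE jk; rewrite mxE jk.
have step (s : {perm 'I_n}) : is_derive x v (fun y => (-1) ^+ s * \prod_k A y k (s k))
   ((-1) ^+ s * (\sum_k D k (s k) * \prod_(j | j != k) A x j (s j))).
  have Dp := @is_derive_prod _ (index_enum 'I_n) (fun k y => A y k (s k))
    (fun k => D k (s k)) x v (index_enum_uniq _)
    (fun k => derivableP (dA k (s k))).
  by have := is_deriveZ ((-1) ^+ s) Dp.
elim/big_ind2 : _ => //; first exact: (is_derive_cst (0 : R)).
by move=> *; exact: is_deriveD.
Qed.

Lemma smooth_on_det U A : open U ->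
  (forall k l, smooth_on U (fun y => A y k l)) ->
  smooth_on U (fun y => \det (A y)).
Proof.
move=> oU sA; apply: smooth_on_sum => // s _; apply: smooth_onM => //.
  exact: smooth_on_cst.
by apply: smooth_on_prod => // k _; exact: sA.
Qed.

End Determinants.

Section Adjugate.
Context {R : realType} {m n : nat}.
Implicit Types (A : 'rV[R]_m -> 'M[R]_n).

Lemma smooth_on_adj U A a b : open U ->
  (forall k l, smooth_on U (fun y => A y k l)) ->
  smooth_on U (fun y => (\adj (A y)) a b).
Proof.
move=> oU sA.
apply: (@smooth_on_eq _ _ _ (fun y => cofactor (A y) b a)) => //.
  by move=> x _; rewrite mxE.
apply: smooth_onM => //; first exact: smooth_on_cst.
apply: smooth_on_det => // k l.
by apply: (@smooth_on_eq _ _ _ (fun y => A y (lift b k) (lift a l))) => // x _; rewrite !mxE.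
Qed.

Lemma smooth_on_invmx U A a b : open U ->
  (forall x, U x -> A x \in unitmx) ->
  (forall k l, smooth_on U (fun y => A y k l)) ->
  smooth_on U (fun y => invmx (A y) a b).
Proof.
move=> oU uA sA.
apply: (@smooth_on_eq _ _ _ (fun y => (\det (A y))^-1 * (\adj (A y)) a b)) => //.
  by move=> x Ux; rewrite /invmx uA// [RHS]mxE.
apply: smooth_onM => //; last exact: smooth_on_adj.
apply: smooth_onV => //; last exact: smooth_on_det.
by move=> x /uA; rewrite unitmxE unitfE.
Qed.

End Adjugate.

Section Piola.
Context {R : realType} {m : nat}.

(** Differentiate J adj(J) = det(J) I along a and multiply by adj(J) on the left: det(J) d_a adj(J)
    = (d_a det J) adj(J) - adj(J) (d_a J) adj(J). With Jacobi's formula for d_a det J, the sums over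
    a of the (a, c) entries of the two terms agree after relabelling, because d_a J_kl = d_l J_ka by
    symmetry of second derivatives. *)
Lemma piola (U : set 'rV[R]_m) (Y : 'I_m -> 'rV[R]_m -> R) x c :
  open U -> (forall k, smooth_on U (Y k)) -> U x ->
  let J y : 'M[R]_m := \matrix_(k, l) pd l (Y k) y in
  \det (J x) != 0 ->
  \sum_a pd a (fun y => (\adj (J y)) a c) x = 0.
Proof.
move=> oU sY Ux J dJ.
have sJ k l : smooth_on U (fun y => J y k l).
  apply: (smooth_on_eq _ _ (smooth_on_pd l (sY k))) => // y _.
  by rewrite mxE.
have sadj a b : smooth_on U (fun y => (\adj (J y)) a b) by exact: smooth_on_adj.
pose H a l k := pd a (pd l (Y k)) x.
have HJ a k l : pd a (fun y => J y k l) x = H a l k.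
  by apply: pd_near; near=> y; rewrite mxE.
have Hsym a l k : H a l k = H l a k by exact: (pd_comm _ _ oU (sY k)).
pose dJm a : 'M[R]_m := \matrix_(k, l) H a l k.
pose dadj a : 'M[R]_m := \matrix_(k, l) pd a (fun y => (\adj (J y)) k l) x.
pose ddet a := \sum_k \sum_l H a l k * (\adj (J x)) l k.
have det' a : pd a (fun y => \det (J y)) x = ddet a.
  have [|_ E] := @is_derive_det R m m J x (vbase a).
    by move=> k l; exact: smooth_on_derivable (sJ k l) Ux.
  rewrite /pd E; apply: eq_bigr => k _; apply: eq_bigr => l _.
  by rewrite -HJ [in RHS]mxE.
have prod' a : dJm a *m \adj (J x) + J x *m dadj a = (ddet a)%:M.
  apply/matrixP => k l; rewrite [RHS]mxE -det'.
  have -> : pd a (fun y => \det (J y)) x *+ (k == l) =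
            pd a (fun y => \sum_j J y k j * (\adj (J y)) j l) x.
    transitivity (pd a (fun y => \det (J y) * (k == l)%:R) x).
      rewrite pdM; last 2 first.
      - exact: smooth_on_derivable (smooth_on_det oU sJ) Ux.
      - exact: derivable_cst.
      by rewrite pd_cst mulr0 add0r mulrC mulr_natr.
    apply: pd_near; near=> y.
    have := congr1 (fun M : 'M[R]_m => M k l) (mul_mx_adj (J y)).
    by rewrite !mxE mulr_natr.
  rewrite pd_sum; last first.
    move=> j _; apply: derivableM.
      exact: smooth_on_derivable (sJ k j) Ux.
    exact: smooth_on_derivable (sadj j l) Ux.
  rewrite !mxE -big_split/=; apply: eq_bigr => j _.
  rewrite pdM; last 2 first.
  - exact: smooth_on_derivable (sJ k j) Ux.
  - exact: smooth_on_derivable (sadj j l) Ux.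
  by rewrite HJ addrC [dJm a k j]mxE [dadj a j l]mxE [_ * H _ _ _]mulrC.
have main a : \det (J x) * pd a (fun y => (\adj (J y)) a c) x =
    ddet a * (\adj (J x)) a c - (\adj (J x) *m dJm a *m \adj (J x)) a c.
  have := congr1 (fun M : 'M[R]_m => (\adj (J x) *m M) a c) (prod' a).
  rewrite mulmxDr !mulmxA mul_adj_mx mul_scalar_mx mul_mx_scalar => /= E.
  have -> : pd a (fun y => (\adj (J y)) a c) x = dadj a a c by rewrite mxE.
  have EE : (\adj (J x) *m dJm a *m \adj (J x)) a c + \det (J x) * dadj a a c =
     ddet a * (\adj (J x)) a c.
    by move: E; rewrite mxE [X in _ + X]mxE [X in _ = X]mxE.
  by rewrite -EE addrC addKr.
apply: (mulfI dJ); rewrite mulr0 mulr_sumr (eq_bigr _ (fun a _ => main a)).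
rewrite sumrB; apply/eqP; rewrite subr_eq0; apply/eqP.
under eq_bigr do rewrite mulr_suml.
under [RHS]eq_bigr do rewrite mxE.
rewrite [RHS]exchange_big/=; apply: eq_bigr => a _.
under [RHS]eq_bigr do rewrite mxE mulr_suml.
rewrite [RHS]exchange_big/=; apply: eq_bigr => k _.
rewrite mulr_suml; apply: eq_bigr => l _.
by rewrite [dJm l k a]mxE Hsym [_ * H _ _ _]mulrC.
Unshelve. all: by end_near. Qed.

End Piola.

(** * Charts and invariance of the wave operator *)

(** Local constancy of the sign lets |det J| be differentiated as a fixed number times det J; it
    also gives non-vanishing near a point. *)
Lemma near_sgr (R : realType) (T : topologicalType) (f : T -> R) (x : T) :
  {for x, continuous f} -> f x != 0 ->
  \forall y \near x, Num.sg (f y) = Num.sg (f x).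
Proof.
move=> cf fx0.
have : \forall y \near x, `|f x - f y| < `|f x|.
  by move/cvgrPdist_lt : cf; apply; rewrite normr_gt0.
apply: filterS => y; case: (ltrgt0P (f x)) fx0 => // fx _.
- rewrite ltr_norml => /andP[_ H]; rewrite !gtr0_sg//; lra.
- rewrite ltr_norml => /andP[H _]; rewrite !ltr0_sg//; lra.
Qed.

Section Charts.
Context {R : realType} {X : topologicalType} {m : nat}.
Implicit Types (phi psi : chart R X m).

Lemma cimg_cmap phi p : cdom phi p -> cimg phi (cmap phi p).
Proof. by exists p. Qed.

Lemma cinvK phi x : is_chart phi -> cimg phi x ->
  cdom phi (cinv phi x) /\ cmap phi (cinv phi x) = x.
Proof. by case=> _ _ K _ _ [p dp <-]; rewrite K. Qed.

Lemma chart_near phi p (P : set X) : is_chart phi -> cdom phi p ->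
  nbhs p P -> \forall x \near cmap phi p, P (cinv phi x).
Proof.
case=> _ _ K _ C dp nP.
have := C _ (cimg_cmap dp); rewrite /prop_for /continuous_at K//.
by apply.
Qed.

Lemma chart_image_open phi (A : set X) : is_chart phi -> open A ->
  open (cmap phi @` (cdom phi `&` A)).
Proof.
move=> ch oA; have [od oi K _ _] := ch.
rewrite openE => _ [p [dp Ap] <-]; rewrite /interior.
have n1 := chart_near ch dp (open_nbhs_nbhs (conj oA Ap)).
have n2 := open_nbhs_nbhs (conj oi (cimg_cmap dp)).
move: n1 n2; apply: filterS2 => y Ay [q dq yq].
by move: Ay; rewrite -yq K// => Aq; exists q.
Qed.

End Charts.

Section Manifolds.
Context {R : realType} {X : topologicalType} {m : nat}.
Variable N : manifold R X m.
Implicit Types (phi psi : chart R X m).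

Lemma chart_at_atlas p : atlas N (chart_at N p).
Proof. by rewrite /chart_at; case: cid2. Qed.

Lemma chart_at_cdom p : cdom (chart_at N p) p.
Proof. by rewrite /chart_at; case: cid2. Qed.

Lemma atlas_cimg_open phi : atlas N phi -> open (cimg phi).
Proof. by move=> /atlas_chart[]. Qed.

Lemma overlap_open phi psi : atlas N phi -> atlas N psi ->
  open (cmap phi @` (cdom phi `&` cdom psi)).
Proof.
move=> aphi apsi; apply: chart_image_open; first exact: atlas_chart aphi.
by case: (atlas_chart apsi).
Qed.

Lemma overlap_mem phi psi x : atlas N phi ->
  (cmap phi @` (cdom phi `&` cdom psi)) x ->
  [/\ cimg phi x, cdom phi (cinv phi x), cdom psi (cinv phi x) & cmap phi (cinv phi x) = x].
Proof.
move=> aphi [p [dp dq] <-]; have [_ _ K _ _] := atlas_chart aphi.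
by rewrite K//; split=> //; exact: cimg_cmap.
Qed.

Lemma smooth_on_transfer phi psi (f : X -> R) : atlas N phi -> atlas N psi ->
  smooth_on (cimg phi) (fun x => f (cinv phi x)) ->
  smooth_on (cmap psi @` (cdom psi `&` cdom phi)) (fun x => f (cinv psi x)).
Proof.
move=> aphi apsi sf.
have oU := overlap_open apsi aphi.
apply: (@smooth_on_eq _ _ _ (fun x => f (cinv phi (cmap phi (cinv psi x))))) => //.
  move=> x /(overlap_mem apsi)[_ _ d _].
  by have [_ _ -> //] := atlas_chart aphi.
apply: (@smooth_on_comp _ _ _ _ (cimg phi) (fun y => f (cinv phi y))
  (fun x => cmap phi (cinv psi x))) => //.
- exact: (atlas_cimg_open aphi).
- exact: (atlas_smooth apsi aphi).
- by move=> x /(overlap_mem apsi)[_ _ d _]; exact: cimg_cmap.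
Qed.

Lemma pd_change phi psi (f : X -> R) p a : atlas N phi -> atlas N psi ->
  cdom phi p -> cdom psi p -> smooth N f ->
  pd a (fun x => f (cinv phi x)) (cmap phi p) =
  \sum_c Defs.jacobian phi psi p c a * pd c (fun x => f (cinv psi x)) (cmap psi p).
Proof.
move=> aphi apsi dphi dpsi sf.
have [_ _ K _ _] := atlas_chart aphi.
have Kpsi : forall q, cdom psi q -> cinv psi (cmap psi q) = q.
  by case: (atlas_chart apsi).
have od : open (cdom psi) by case: (atlas_chart apsi).
have -> : pd a (fun x => f (cinv phi x)) (cmap phi p) =
          pd a (fun x => f (cinv psi (cmap psi (cinv phi x)))) (cmap phi p).
  apply: pd_near.
  have := chart_near (atlas_chart aphi) dphi (open_nbhs_nbhs (conj od dpsi)).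
  by apply: filterS => x dx; rewrite Kpsi.
have [||||_ E] := @is_derive_pd_comp _ _ _ (cimg psi)
    (fun x => f (cinv psi x)) (fun x => cmap psi (cinv phi x)) (cmap phi p) a.
- exact: (atlas_cimg_open apsi).
- exact: sf.
- by rewrite K//; exact: cimg_cmap.
- move=> j; apply: (smooth_on_derivable (atlas_smooth aphi apsi j)).
  by exists p.
- by apply: (etrans E); rewrite K//; apply: eq_bigr => c _; rewrite mxE.
Qed.

End Manifolds.

Section Metric.
Context {R : realType} {X : topologicalType} {n : nat}.
Context {N : manifold R X n.+1}.
Variable g : lorentzian N.
Implicit Types (phi psi : chart R X n.+1) (f k : X -> R).

Lemma det_gmx_neq0 phi p : atlas N phi -> cdom phi p -> \det (gmx g phi p) != 0.
Proof.
move=> aphi dp; have [P uP E] := g_signature g aphi dp.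
have : \det (Defs.minkowski R n) != 0.
  rewrite /Defs.minkowski det_diag; apply/prodf_neq0 => i _; rewrite mxE.
  by case: ifP; rewrite ?oppr_eq0 oner_eq0.
by rewrite -E !det_mulmx !mulf_eq0 !negb_or => /andP[/andP[]].
Qed.

Lemma gmx_unit phi p : atlas N phi -> cdom phi p -> gmx g phi p \in unitmx.
Proof. by move=> ? ?; rewrite unitmxE unitfE det_gmx_neq0. Qed.

Lemma det_gmx_change phi psi p : atlas N phi -> atlas N psi ->
  cdom phi p -> cdom psi p ->
  \det (gmx g phi p) = \det (Defs.jacobian phi psi p) ^+ 2 * \det (gmx g psi p).
Proof.
move=> aphi apsi dphi dpsi; rewrite (g_tensor g aphi apsi dphi dpsi).
by rewrite !det_mulmx det_tr expr2 mulrAC.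
Qed.

(** Read off from det g = (det J)^2 det g', whose left side is nonzero; this spares differentiating
    the inverse transition map. *)
Lemma det_jacobian_neq0 phi psi p : atlas N phi -> atlas N psi ->
  cdom phi p -> cdom psi p -> \det (Defs.jacobian phi psi p) != 0.
Proof.
move=> aphi apsi dphi dpsi; have := det_gmx_neq0 aphi dphi.
rewrite (det_gmx_change aphi apsi dphi dpsi) mulf_eq0 negb_or => /andP[+ _].
by rewrite sqrf_eq0.
Qed.

Lemma invmx_gmx_change phi psi p : atlas N phi -> atlas N psi ->
  cdom phi p -> cdom psi p ->
  let J := Defs.jacobian phi psi p in
  J *m invmx (gmx g phi p) *m J^T = invmx (gmx g psi p).
Proof.
move=> aphi apsi dphi dpsi J.
have uJ : J \in unitmx by rewrite unitmxE unitfE det_jacobian_neq0.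
have uG := gmx_unit apsi dpsi.
have uJt : J^T \in unitmx by rewrite unitmx_tr.
have uJG : J^T *m gmx g psi p \in unitmx by rewrite unitmx_mul uJt.
rewrite (g_tensor g aphi apsi dphi dpsi) -/J.
have -> : invmx (J^T *m gmx g psi p *m J) = invmx J *m invmx (gmx g psi p) *m invmx J^T.
  have u3 : J^T *m gmx g psi p *m J \in unitmx by rewrite unitmx_mul uJG.
  apply: (can_inj (mulKmx u3)); rewrite mulmxV//.
  by rewrite -!mulmxA (mulKVmx uJ) (mulKVmx uG) mulmxV.
by rewrite !mulmxA mulmxV// mul1mx -mulmxA mulVmx// mulmx1.
Qed.

Definition rgrad phi f p : 'rV[R]_n.+1 :=
  \row_a pd a (fun x => f (cinv phi x)) (cmap phi p).

Lemma rgrad_change phi psi f p : atlas N phi -> atlas N psi ->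
  cdom phi p -> cdom psi p -> smooth N f ->
  rgrad phi f p = rgrad psi f p *m Defs.jacobian phi psi p.
Proof.
move=> aphi apsi dphi dpsi sf; apply/rowP => a; rewrite !mxE.
rewrite (pd_change _ aphi apsi dphi dpsi sf).
by apply: eq_bigr => c _; rewrite mulrC [rgrad _ _ _ _ _]mxE.
Qed.

Definition rinner_in phi f k (p : X) : R :=
  \sum_a \sum_b invmx (gmx g phi p) a b
    * pd a (fun x => f (cinv phi x)) (cmap phi p)
    * pd b (fun x => k (cinv phi x)) (cmap phi p).

Lemma rinner_inE phi f k p : rinner_in phi f k p =
  (rgrad phi f p *m invmx (gmx g phi p) *m (rgrad phi k p)^T) 0 0.
Proof.
rewrite /rinner_in exchange_big mxE; apply: eq_bigr => b _.
rewrite mxE mulr_suml; apply: eq_bigr => a _.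
by rewrite !mxE [_ * invmx _ _ _]mulrC.
Qed.

Lemma rinner_in_change phi psi f k p : atlas N phi -> atlas N psi ->
  cdom phi p -> cdom psi p -> smooth N f -> smooth N k ->
  rinner_in phi f k p = rinner_in psi f k p.
Proof.
move=> aphi apsi dphi dpsi sf sk; rewrite !rinner_inE.
rewrite (rgrad_change aphi apsi dphi dpsi sf) (rgrad_change aphi apsi dphi dpsi sk).
rewrite -(invmx_gmx_change aphi apsi dphi dpsi) trmx_mul.
by rewrite !mulmxA.
Qed.

Definition dens phi x := Num.sqrt `|\det (gmx g phi (cinv phi x))|.

(** Component a of the vector density |g|^(1/2) grad f, whose coordinate divergence enters the wave
    operator. *)
Definition rflux phi f a x : R :=
  \sum_b dens phi x * invmx (gmx g phi (cinv phi x)) a b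
    * pd b (fun y => f (cinv phi y)) x.

Definition rbox_in phi f p : R :=
  - (dens phi (cmap phi p))^-1 * \sum_a pd a (rflux phi f a) (cmap phi p).

Lemma gmx_cinv_unit phi x : atlas N phi -> cimg phi x ->
  gmx g phi (cinv phi x) \in unitmx.
Proof.
by move=> aphi /(cinvK (atlas_chart aphi))[d _]; exact: gmx_unit.
Qed.

Lemma smooth_on_invg phi a b : atlas N phi ->
  smooth_on (cimg phi) (fun x => invmx (gmx g phi (cinv phi x)) a b).
Proof.
move=> aphi; apply: smooth_on_invmx; first exact: (atlas_cimg_open aphi).
  by move=> x; exact: gmx_cinv_unit.
by move=> c d; exact: (g_smooth g aphi).
Qed.

Lemma dens_gt0 phi x : atlas N phi -> cimg phi x -> 0 < dens phi x.
Proof.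
move=> aphi ix; have := gmx_cinv_unit aphi ix.
by rewrite unitmxE unitfE /dens sqrtr_gt0 normr_gt0.
Qed.

(** The absolute value is handled as |G| = sqrt (G G), the root of a positive smooth function, which
    avoids a discussion of the sign of the determinant. *)
Lemma smooth_on_dens phi : atlas N phi -> smooth_on (cimg phi) (dens phi).
Proof.
move=> aphi; have oU := atlas_cimg_open aphi.
pose G x := \det (gmx g phi (cinv phi x)).
rewrite (_ : dens phi = (fun x => Num.sqrt `|G x|))//.
have G0 x : cimg phi x -> 0 < G x * G x.
  move=> /(gmx_cinv_unit aphi); rewrite unitmxE unitfE -/(G x) -expr2.
  by rewrite exprn_even_gt0.
have sG : smooth_on (cimg phi) G by apply: smooth_on_det => // a b; exact: (g_smooth g aphi).
clearbody G.
have sG2 := smooth_on_sqrt oU G0 (smooth_onM oU sG sG).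
have pos x : cimg phi x -> 0 < Num.sqrt (G x * G x) by move=> ?; rewrite sqrtr_gt0 G0.
apply: (smooth_on_eq oU _ (smooth_on_sqrt oU pos sG2)) => x _.
by rewrite -expr2 sqrtr_sqr.
Qed.

Lemma smooth_on_rflux phi f a : atlas N phi -> smooth N f ->
  smooth_on (cimg phi) (rflux phi f a).
Proof.
move=> aphi sf; have oU := atlas_cimg_open aphi.
apply: smooth_on_sum => // b _; apply: smooth_onM => //; last first.
  by apply: smooth_on_pd; exact: sf.
by apply: smooth_onM => //; [exact: smooth_on_dens|exact: smooth_on_invg].
Qed.

(** The Piola transform of a vector density: the density contributes |det J|, the raised gradient
    contributes J^(-1), and |det J| J^(-1) = sgn(det J) adj(J). In this form only polynomial
    expressions in J have to be differentiated. *)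
Lemma rflux_change phi psi f x : atlas N phi -> atlas N psi -> smooth N f ->
  (cmap phi @` (cdom phi `&` cdom psi)) x ->
  let J := Defs.jacobian phi psi (cinv phi x) in
  forall a, rflux phi f a x =
   Num.sg (\det J) * \sum_c (\adj J) a c * rflux psi f c (cmap psi (cinv phi x)).
Proof.
move=> aphi apsi sf ox J a.
have [ix dphi dpsi Kx] := overlap_mem aphi ox.
set q := cinv phi x in J dphi dpsi Kx *.
have Kq : cinv psi (cmap psi q) = q by have [_ _ ->] := atlas_chart apsi.
have dJ : \det J != 0 by exact: det_jacobian_neq0.
have uJ : J \in unitmx by rewrite unitmxE unitfE.
have uJt : J^T \in unitmx by rewrite unitmx_tr.
have densE : dens phi x = `|\det J| * dens psi (cmap psi q).
  rewrite /dens -/q Kq (det_gmx_change aphi apsi dphi dpsi) normrM sqrtrM//.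
  by rewrite normrX real_normK ?num_real// sqrtr_sqr.
have fluxE ph y b : y = cmap ph (cinv ph y) -> rflux ph f b y =
   dens ph y * (invmx (gmx g ph (cinv ph y)) *m (rgrad ph f (cinv ph y))^T) b 0.
  move=> Ey; rewrite mxE mulr_sumr; apply: eq_bigr => d _.
  by rewrite !mxE -Ey mulrA.
rewrite fluxE ?Kx// densE -/q (rgrad_change aphi apsi dphi dpsi sf) -/J.
have -> : invmx (gmx g phi q) *m (rgrad psi f q *m J)^T =
          invmx J *m (invmx (gmx g psi q) *m (rgrad psi f q)^T).
  rewrite -(invmx_gmx_change aphi apsi dphi dpsi) -/J trmx_mul !mulmxA.
  by rewrite mulVmx// mul1mx.
rewrite mxE !mulr_sumr; apply: eq_bigr => c _.
rewrite (fluxE psi) Kq// /invmx uJ.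
move: (_ c 0) => V; rewrite mxE.
have -> : `|\det J| = Num.sg (\det J) * \det J by rewrite normrEsg.
by field.
Qed.

(** Take the divergence of s adj(J) (V o Y), with s the locally constant sign of det J. The terms
    that differentiate adj(J) vanish by [piola]; in the others J adj(J) = det(J) I leaves s det(J) =
    |det J| times the divergence of V, and |det J| cancels against the ratio of the densities. *)
Lemma rbox_in_change phi psi f p : atlas N phi -> atlas N psi ->
  cdom phi p -> cdom psi p -> smooth N f ->
  rbox_in phi f p = rbox_in psi f p.
Proof.
move=> aphi apsi dphi dpsi sf.
have [_ _ K _ _] := atlas_chart aphi.
have oU := overlap_open aphi apsi; set U := _ @` _ in oU.
pose x0 := cmap phi p; have Ux0 : U x0 by exists p.
have Kx0 : cinv phi x0 = p by rewrite /x0 K.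
pose Y x := cmap psi (cinv phi x).
have Y0 : Y x0 = cmap psi p by rewrite /Y Kx0.
pose J x : 'M[R]_n.+1 := \matrix_(k, l) pd l (transition phi psi k) x.
have JE x : U x -> Defs.jacobian phi psi (cinv phi x) = J x.
  by move=> /(overlap_mem aphi)[_ _ _ Kx]; rewrite /Defs.jacobian Kx.
have dJ : \det (J x0) != 0.
  by rewrite -JE// Kx0 det_jacobian_neq0.
have sJ i j : smooth_on U (fun y => J y i j).
  apply: (@smooth_on_eq _ _ _ (pd j (transition phi psi i))) => //.
    by move=> x _; rewrite mxE.
  by apply: smooth_on_pd; exact: (atlas_smooth aphi apsi).
have sadj a c : smooth_on U (fun y => (\adj (J y)) a c) by exact: smooth_on_adj.
pose V c := rflux psi f c.
have sV c : smooth_on (cimg psi) (V c) by exact: smooth_on_rflux.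
have UY x : U x -> cimg psi (Y x).
  by move=> /(overlap_mem aphi)[_ _ d _]; exact: cimg_cmap.
have dVY c a : is_derive x0 (vbase a) (fun x => V c (Y x))
    (\sum_e J x0 e a * pd e (V c) (cmap psi p)).
  have := @is_derive_pd_comp _ _ _ (cimg psi) (V c) Y x0 a
    (atlas_cimg_open apsi) (sV c) (UY _ Ux0) _.
  rewrite Y0 => H; have {}H := H (fun j => smooth_on_derivable (atlas_smooth aphi apsi j) Ux0).
  by apply: is_derive_eq; apply: eq_bigr => e _; rewrite mxE.
pose s := Num.sg (\det (J x0)).
have fluxE a : \forall x \near x0,
    rflux phi f a x = \sum_c s * ((\adj (J x)) a c * V c (Y x)).
  have nU := open_nbhs_nbhs (conj oU Ux0).
  have cdet : {for x0, continuous (fun x => \det (J x))}.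
    exact: smooth_on_cont (smooth_on_det oU sJ) Ux0.
  move: nU (near_sgr cdet dJ); apply: filterS2 => x Ux sx.
  by rewrite (rflux_change aphi apsi sf Ux) JE// sx mulr_sumr.
have dflux a : pd a (rflux phi f a) x0 = s *
    \sum_c ((\adj (J x0)) a c * (\sum_e J x0 e a * pd e (V c) (cmap psi p))
       + V c (cmap psi p) * pd a (fun y => (\adj (J y)) a c) x0).
  rewrite (pd_near a (fluxE a)) pd_sum; last first.
    move=> c _; apply: derivable_mul; first exact: derivable_cst.
    apply: derivable_mul; first exact: smooth_on_derivable (sadj a c) Ux0.
    by case: (dVY c a).
  rewrite mulr_sumr; apply: eq_bigr => c _.
  have d1 : derivable (fun y => (\adj (J y)) a c) x0 (vbase a).
    exact: smooth_on_derivable (sadj a c) Ux0.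
  have [d2 E2] := dVY c a.
  have d3 : derivable (fun=> s : R) x0 (vbase a) by exact: derivable_cst.
  rewrite (pdM d3 (derivable_mul d1 d2)) pd_cst mulr0 addr0 (pdM d1 d2).
  by rewrite [pd a (fun x => V c (Y x)) x0]E2 -Y0.
have total : \sum_a pd a (rflux phi f a) x0 =
    s * (\det (J x0) * \sum_c pd c (V c) (cmap psi p)).
  apply: (etrans (eq_bigr _ (fun a _ => dflux a))).
  rewrite -mulr_sumr; congr (_ * _).
  rewrite exchange_big/= mulr_sumr; apply: eq_bigr => c _.
  rewrite big_split/= -mulr_sumr.
  rewrite (piola c oU (atlas_smooth aphi apsi) Ux0 dJ) mulr0 addr0.
  under eq_bigr do rewrite mulr_sumr.
  rewrite exchange_big/= (bigD1 c)//= [X in _ + X]big1 ?addr0.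
    have := congr1 (fun M : 'M[R]_n.+1 => M c c) (mul_mx_adj (J x0)).
    rewrite !mxE eqxx mulr1n => <-; rewrite mulr_suml.
    by apply: eq_bigr => a _; rewrite mulrCA mulrA.
  move=> e ec; have := congr1 (fun M : 'M[R]_n.+1 => M e c) (mul_mx_adj (J x0)).
  rewrite /= [LHS]mxE [RHS]mxE (negbTE ec) mulr0n => E.
  apply: (@etrans _ _ ((\sum_a J x0 e a * (\adj (J x0)) a c) * pd e (V c) (cmap psi p))).
    by rewrite mulr_suml; apply: eq_bigr => a _; rewrite mulrCA mulrA.
  by rewrite E mul0r.
apply: (@etrans _ _ (- (dens phi x0)^-1 *
    (s * (\det (J x0) * \sum_c pd c (V c) (cmap psi p))))).
  by rewrite -total.
rewrite /rbox_in.
have d0 : 0 < dens psi (cmap psi p) by rewrite dens_gt0//; exact: cimg_cmap.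
have -> : dens phi x0 = `|\det (J x0)| * dens psi (cmap psi p).
  have [_ _ Kpsi _ _] := atlas_chart apsi.
  rewrite /dens Kx0 Kpsi// (det_gmx_change aphi apsi dphi dpsi) normrM sqrtrM//.
  by rewrite normrX real_normK ?num_real// sqrtr_sqr -JE// Kx0.
rewrite [s * _]mulrA -normrEsg -/(V _).
have n0 : `|\det (J x0)| != 0 by rewrite normr_eq0.
have d1 := lt0r_neq0 d0.
rewrite -[\sum_a pd a (rflux _ _ _) _]/(\sum_c pd c (V c) (cmap psi p)).
move: (\sum_c _) => S; field.
by rewrite d1.
Qed.

End Metric.

(** * Complex-valued functions *)

Section ComplexParts.
Context {R : realType}.
Implicit Types z w : R[i].

Lemma cReD z w : complex.Re (z + w) = complex.Re z + complex.Re w.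
Proof. by case: z w => [? ?] []. Qed.

Lemma cImD z w : complex.Im (z + w) = complex.Im z + complex.Im w.
Proof. by case: z w => [? ?] []. Qed.

Lemma cReM z w :
  complex.Re (z * w) = complex.Re z * complex.Re w - complex.Im z * complex.Im w.
Proof. by case: z w => [? ?] []. Qed.

Lemma cImM z w :
  complex.Im (z * w) = complex.Re z * complex.Im w + complex.Im z * complex.Re w.
Proof. by case: z w => [? ?] []. Qed.

Lemma cRe_sum (I : Type) (r : seq I) (P : pred I) (F : I -> R[i]) :
  complex.Re (\sum_(i <- r | P i) F i) = \sum_(i <- r | P i) complex.Re (F i).
Proof. by apply: (big_morph (@complex.Re R)) => //; exact: cReD. Qed.

Lemma cIm_sum (I : Type) (r : seq I) (P : pred I) (F : I -> R[i]) :
  complex.Im (\sum_(i <- r | P i) F i) = \sum_(i <- r | P i) complex.Im (F i).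
Proof. by apply: (big_morph (@complex.Im R)) => //; exact: cImD. Qed.

Lemma cReZ (a : R) z : complex.Re (a%:C%C * z) = a * complex.Re z.
Proof. by rewrite cReM /= mul0r subr0. Qed.

Lemma cImZ (a : R) z : complex.Im (a%:C%C * z) = a * complex.Im z.
Proof. by rewrite cImM /= mul0r addr0. Qed.

Lemma eqReIm z w : complex.Re z = complex.Re w -> complex.Im z = complex.Im w -> z = w.
Proof. by case: z w => [? ?] [? ?] /= -> ->. Qed.

Lemma cReV z : complex.Re z^-1 =
  complex.Re z * (complex.Re z ^+ 2 + complex.Im z ^+ 2)^-1.
Proof. by case: z => a b. Qed.

Lemma cImV z : complex.Im z^-1 =
  - complex.Im z * (complex.Re z ^+ 2 + complex.Im z ^+ 2)^-1.
Proof. by case: z => a b /=; rewrite mulNr. Qed.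

Lemma Re_cexp z : complex.Re (cexp z) = expR (complex.Re z) * cos (complex.Im z).
Proof. by rewrite /cexp cReZ. Qed.

Lemma Im_cexp z : complex.Im (cexp z) = expR (complex.Re z) * sin (complex.Im z).
Proof. by rewrite /cexp cImZ. Qed.

Lemma sqnorm_neq0 z : z != 0 -> complex.Re z ^+ 2 + complex.Im z ^+ 2 != 0.
Proof.
by case: z => a b; rewrite eq_complex /= paddr_eq0 ?sqr_ge0// !sqrf_eq0.
Qed.

End ComplexParts.

Section ComplexCalculus.
Context {R : realType} {m : nat}.
Implicit Types (U : set 'rV[R]_m) (u v : 'rV[R]_m -> R[i]) (x : 'rV[R]_m).

Lemma csmooth_on_eq U u v : open U -> (forall x, U x -> u x = v x) ->
  csmooth_on U u -> csmooth_on U v.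
Proof.
move=> oU uv [sr si]; split.
- by apply: (smooth_on_eq oU _ sr) => x Ux; rewrite uv.
- by apply: (smooth_on_eq oU _ si) => x Ux; rewrite uv.
Qed.

Lemma csmooth_on_sub U V u : V `<=` U -> csmooth_on U u -> csmooth_on V u.
Proof. by move=> VU [sr si]; split; exact: smooth_on_sub VU _. Qed.

Lemma csmooth_on_local U u :
  (forall x, U x -> exists2 W, W x & csmooth_on W u) -> csmooth_on U u.
Proof.
by move=> H; split; apply: smooth_on_local => x /H[W Wx []]; exists W.
Qed.

Lemma csmooth_on_cst U (a : R[i]) : csmooth_on U (fun=> a).
Proof. by split; exact: smooth_on_cst. Qed.

Lemma csmooth_on_real U (f : 'rV[R]_m -> R) : smooth_on U f ->
  csmooth_on U (fun x => (f x)%:C%C).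
Proof. by move=> sf; split; [exact: sf|exact: smooth_on_cst]. Qed.

Lemma csmooth_onD U u v : open U -> csmooth_on U u -> csmooth_on U v ->
  csmooth_on U (fun x => u x + v x).
Proof.
move=> oU [ur ui] [vr vi]; split.
- apply: (smooth_on_eq oU _ (smooth_onD oU ur vr)) => x _.
  by rewrite cReD.
- apply: (smooth_on_eq oU _ (smooth_onD oU ui vi)) => x _.
  by rewrite cImD.
Qed.

Lemma csmooth_onM U u v : open U -> csmooth_on U u -> csmooth_on U v ->
  csmooth_on U (fun x => u x * v x).
Proof.
move=> oU [ur ui] [vr vi]; split.
- apply: (smooth_on_eq oU _ (smooth_onB oU (smooth_onM oU ur vr) (smooth_onM oU ui vi))).
  by move=> x _; rewrite cReM.
- apply: (smooth_on_eq oU _ (smooth_onD oU (smooth_onM oU ur vi) (smooth_onM oU ui vr))).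
  by move=> x _; rewrite cImM.
Qed.

Lemma csmooth_on_sum U (I : Type) (r : seq I) (P : pred I) (u : I -> 'rV[R]_m -> R[i]) :
  open U -> (forall i, P i -> csmooth_on U (u i)) ->
  csmooth_on U (fun x => \sum_(i <- r | P i) u i x).
Proof.
move=> oU H; split.
- apply: (smooth_on_eq oU _ (smooth_on_sum r oU (fun i Pi => (H i Pi).1))) => x _.
  by rewrite cRe_sum.
- apply: (smooth_on_eq oU _ (smooth_on_sum r oU (fun i Pi => (H i Pi).2))) => x _.
  by rewrite cIm_sum.
Qed.

Lemma csmooth_onV U u : open U -> (forall x, U x -> u x != 0) -> csmooth_on U u ->
  csmooth_on U (fun x => (u x)^-1).
Proof.
move=> oU u0 [ur ui].
have sn : smooth_on U (fun x => (complex.Re (u x) ^+ 2 + complex.Im (u x) ^+ 2)^-1).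
  apply: (smooth_onV oU); first by move=> x /u0/sqnorm_neq0.
  exact: (smooth_onD oU (smooth_onM oU ur ur) (smooth_onM oU ui ui)).
split.
- apply: (smooth_on_eq oU _ (smooth_onM oU ur sn)) => x _.
  by rewrite cReV.
- apply: (smooth_on_eq oU _ (smooth_onM oU (smooth_onN oU ui) sn)) => x _.
  by rewrite cImV.
Qed.

Lemma csmooth_on_cexp U u : open U -> csmooth_on U u ->
  csmooth_on U (fun x => cexp (u x)).
Proof.
move=> oU [ur ui]; have [ss sc] := smooth_on_sincos oU ui.
have se := smooth_on_expR oU ur; split.
- apply: (smooth_on_eq oU _ (smooth_onM oU se sc)) => x _.
  by rewrite Re_cexp.
- apply: (smooth_on_eq oU _ (smooth_onM oU se ss)) => x _.
  by rewrite Im_cexp.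
Qed.

Lemma csmooth_on_cpd U u i : csmooth_on U u -> csmooth_on U (cpd i u).
Proof. by move=> [ur ui]; split; exact: smooth_on_pd. Qed.

Lemma cpd_near i u v x : (\forall y \near x, u y = v y) -> cpd i u x = cpd i v x.
Proof.
by move=> uv; apply: eqReIm; apply: pd_near; apply: filterS uv => y ->.
Qed.

Lemma cpd_eq U i u v x : open U -> U x -> (forall y, U y -> u y = v y) ->
  cpd i u x = cpd i v x.
Proof.
move=> oU Ux uv; apply: cpd_near.
by apply: filterS (open_nbhs_nbhs (conj oU Ux)); exact: uv.
Qed.

Lemma cpd_cst i (a : R[i]) x : cpd i (fun=> a) x = 0.
Proof. by rewrite /cpd !pd_cst. Qed.

Section Pointwise.
Variables (U : set 'rV[R]_m) (x : 'rV[R]_m).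
Hypothesis (Ux : U x).

Lemma cpdD i u v : csmooth_on U u -> csmooth_on U v ->
  cpd i (fun y => u y + v y) x = cpd i u x + cpd i v x.
Proof.
move=> [ur ui] [vr vi]; apply: eqReIm; rewrite ?cReD ?cImD /=.
- rewrite (_ : (fun y => complex.Re _) =
      (fun y => complex.Re (u y) + complex.Re (v y))).
    by apply: pdD; [exact: smooth_on_derivable ur Ux|exact: smooth_on_derivable vr Ux].
  by apply/funext => y; rewrite cReD.
- rewrite (_ : (fun y => complex.Im _) =
      (fun y => complex.Im (u y) + complex.Im (v y))).
    by apply: pdD; [exact: smooth_on_derivable ui Ux|exact: smooth_on_derivable vi Ux].
  by apply/funext => y; rewrite cImD.
Qed.

Lemma cpdM i u v : csmooth_on U u -> csmooth_on U v ->
  cpd i (fun y => u y * v y) x = u x * cpd i v x + v x * cpd i u x.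
Proof.
move=> [ur ui] [vr vi].
have d1 := smooth_on_derivable (i := i) ur Ux.
have d2 := smooth_on_derivable (i := i) ui Ux.
have d3 := smooth_on_derivable (i := i) vr Ux.
have d4 := smooth_on_derivable (i := i) vi Ux.
apply: eqReIm; rewrite ?cReD ?cImD ?cReM ?cImM /=.
- rewrite (_ : (fun y => complex.Re _) = (fun y => complex.Re (u y) * complex.Re (v y)
      + - (complex.Im (u y) * complex.Im (v y)))).
    rewrite (pdD (derivable_mul d1 d3) (derivable_oppr (derivable_mul d2 d4))).
    by rewrite (pdN (derivable_mul d2 d4)) (pdM d1 d3) (pdM d2 d4); ring.
  by apply/funext => y; rewrite cReM.
- rewrite (_ : (fun y => complex.Im _) = (fun y => complex.Re (u y) * complex.Im (v y)
      + complex.Im (u y) * complex.Re (v y))).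
    rewrite (pdD (derivable_mul d1 d4) (derivable_mul d2 d3)).
    by rewrite (pdM d1 d4) (pdM d2 d3); ring.
  by apply/funext => y; rewrite cImM.
Qed.

Lemma cpdZ i (a : R[i]) u : csmooth_on U u ->
  cpd i (fun y => a * u y) x = a * cpd i u x.
Proof.
by move=> su; rewrite (cpdM i (csmooth_on_cst U a) su) cpd_cst mulr0 addr0.
Qed.

Lemma cpd_sum i (I : Type) (r : seq I) (P : pred I) (u : I -> 'rV[R]_m -> R[i]) :
  (forall k, P k -> csmooth_on U (u k)) ->
  cpd i (fun y => \sum_(k <- r | P k) u k y) x = \sum_(k <- r | P k) cpd i (u k) x.
Proof.
move=> su; apply: eqReIm; rewrite ?cRe_sum ?cIm_sum /=.
- rewrite (_ : (fun y => complex.Re _) =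
      (fun y => \sum_(k <- r | P k) complex.Re (u k y))).
    by rewrite pd_sum// => k Pk; exact: smooth_on_derivable (su k Pk).1 Ux.
  by apply/funext => y; rewrite cRe_sum.
- rewrite (_ : (fun y => complex.Im _) =
      (fun y => \sum_(k <- r | P k) complex.Im (u k y))).
    by rewrite pd_sum// => k Pk; exact: smooth_on_derivable (su k Pk).2 Ux.
  by apply/funext => y; rewrite cIm_sum.
Qed.

Lemma cpd_cexp i u : csmooth_on U u ->
  cpd i (fun y => cexp (u y)) x = cexp (u x) * cpd i u x.
Proof.
move=> [ur ui].
have d1 := smooth_on_derivable (i := i) ur Ux.
have d2 := smooth_on_derivable (i := i) ui Ux.
have e1 := is_derive_comp1 d1 (is_derive_expR (complex.Re (u x))).
have e2 := is_derive_comp1 d2 (is_derive_cos (complex.Im (u x))).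
have e3 := is_derive_comp1 d2 (is_derive_sin (complex.Im (u x))).
have [dx1 E1] := e1; have [dx2 E2] := e2; have [dx3 E3] := e3.
rewrite -!/(pd i _ x) in E1 E2 E3.
have H1 : (fun y => complex.Re (cexp (u y))) =
    (fun y => expR (complex.Re (u y)) * cos (complex.Im (u y))).
  by apply/funext => y; rewrite Re_cexp.
have H2 : (fun y => complex.Im (cexp (u y))) =
    (fun y => expR (complex.Re (u y)) * sin (complex.Im (u y))).
  by apply/funext => y; rewrite Im_cexp.
rewrite /cpd H1 H2 (pdM dx1 dx2) (pdM dx1 dx3) E1 E2 E3.
have -> : cexp (u x) = (expR (complex.Re (u x)) * cos (complex.Im (u x)) +i*
    (expR (complex.Re (u x)) * sin (complex.Im (u x))))%C.
  by apply: eqReIm; rewrite ?Re_cexp ?Im_cexp.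
by apply: eqReIm => /=; ring.
Qed.

End Pointwise.

End ComplexCalculus.

Section SmoothFunctions.
Context {R : realType} {X : topologicalType} {m : nat}.
Variable N : manifold R X m.
Implicit Types (u v : X -> R[i]).

Lemma csmooth_parts u : csmooth N u ->
  smooth N (fun p => complex.Re (u p)) /\ smooth N (fun p => complex.Im (u p)).
Proof. by move=> su; split=> phi /su[]. Qed.

Lemma csmooth_cst (a : R[i]) : csmooth N (fun=> a).
Proof. by move=> phi _; exact: csmooth_on_cst. Qed.

Lemma csmoothD u v : csmooth N u -> csmooth N v -> csmooth N (fun p => u p + v p).
Proof.
by move=> su sv phi ap; exact: (csmooth_onD (atlas_cimg_open ap) (su phi ap) (sv phi ap)).
Qed.

Lemma csmoothM u v : csmooth N u -> csmooth N v -> csmooth N (fun p => u p * v p).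
Proof.
by move=> su sv phi ap; exact: (csmooth_onM (atlas_cimg_open ap) (su phi ap) (sv phi ap)).
Qed.

Lemma csmoothZ (a : R[i]) u : csmooth N u -> csmooth N (fun p => a * u p).
Proof. by apply: csmoothM; exact: csmooth_cst. Qed.

Lemma csmoothN u : csmooth N u -> csmooth N (fun p => - u p).
Proof.
move=> su; have := csmoothZ (-1) su.
by congr csmooth; apply/funext => p; rewrite mulN1r.
Qed.

Lemma csmooth_sum (I : Type) (r : seq I) (P : pred I) (u : I -> X -> R[i]) :
  (forall i, P i -> csmooth N (u i)) -> csmooth N (fun p => \sum_(i <- r | P i) u i p).
Proof.
move=> su phi ap.
exact: (csmooth_on_sum _ (atlas_cimg_open ap) (fun i Pi => su i Pi phi ap)).
Qed.

Lemma csmooth_cexp u : csmooth N u -> csmooth N (fun p => cexp (u p)).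
Proof. by move=> su phi ap; exact: (csmooth_on_cexp (atlas_cimg_open ap) (su phi ap)). Qed.

(** Two kinds of points: near a point of A the denominator is nonzero by continuity, also at
    neighbours outside A; the complement of A is open and the quotient is 0 there, whatever value v
    takes. *)
Lemma csmooth_div (A : set X) u v : closed A -> csmooth N u -> csmooth N v ->
  (forall p, ~ A p -> u p = 0) -> (forall p, A p -> v p != 0) ->
  csmooth N (fun p => u p / v p).
Proof.
move=> cA su sv u0 v0 phi ap; have oU := atlas_cimg_open ap.
apply: csmooth_on_local => x ix.
have [dx Kx] := cinvK (atlas_chart ap) ix.
have [Ap|nAp] := pselect (A (cinv phi x)).
(* The squared modulus of v is a real continuous function, so persistence of its sign keeps v away
   from 0 near x. *)
- pose s y := complex.Re (v (cinv phi y)) * complex.Re (v (cinv phi y))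
             + complex.Im (v (cinv phi y)) * complex.Im (v (cinv phi y)).
  have [svr svi] := sv _ ap.
  have cs := smooth_on_cont (smooth_onD oU (smooth_onM oU svr svr) (smooth_onM oU svi svi)) ix.
  have s0 : s x != 0 by rewrite /s -!expr2; apply: sqnorm_neq0; exact: v0.
  have : \forall y \near x, cimg phi y /\ v (cinv phi y) != 0.
    move: (open_nbhs_nbhs (conj oU ix)) (near_sgr cs s0).
    apply: filterS2 => y iy sy; split=> //; apply: contra_neqN s0 => /eqP vy.
    by apply/eqP; rewrite -sgr_eq0 -sy sgr_eq0 /s vy /= mulr0 addr0.
  move=> H; have {H} : nbhs x [set y | cimg phi y /\ v (cinv phi y) != 0] by exact: H.
  rewrite nbhsE => -[W [oW Wx] WH]; exists W => //.
  apply: (csmooth_onM oW).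
    by apply: csmooth_on_sub (su _ ap) => y /WH[].
  apply: (csmooth_onV oW) => [y /WH[]//|].
  by apply: csmooth_on_sub (sv _ ap) => y /WH[].
- exists (cmap phi @` (cdom phi `&` ~` A)); first by exists (cinv phi x).
  have oW : open (cmap phi @` (cdom phi `&` ~` A)).
    by apply: chart_image_open; [exact: atlas_chart ap|exact: closed_openC].
  apply: (csmooth_on_eq oW _ (csmooth_on_cst _ 0)) => y [p [dp nA] <-].
  by have [_ _ -> //] := atlas_chart ap; rewrite u0// mul0r.
Qed.

Lemma csmooth_suppP (A : set X) u : closed A ->
  csmooth_supp N A u <-> csmooth N u /\ forall p, ~ A p -> u p = 0.
Proof.
move=> cA; split=> -[su H]; split=> //.
- move=> p nA; apply/eqP; apply: contrapT => /negP up; apply/nA/H.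
  exact: subset_closure.
- rewrite (_ : A = closure A); last by apply/closure_id.
  by apply: closureS => p /= up; apply: contrapT => /H E; move: up; rewrite E eqxx.
Qed.

End SmoothFunctions.

(** * Leibniz and exponential rules for the wave operator *)

Lemma sum_lin1 (R : pzRingType) (I : finType) (s : R) (F G : I -> R) :
  \sum_a s * (F a + G a) = s * (\sum_a F a + \sum_a G a).
Proof. by rewrite -mulr_sumr big_split. Qed.

Lemma sum_lin2 (R : pzRingType) (I : finType) (s t : R) (F G H K : I -> R) :
  \sum_a (s * F a + t * G a + (H a + K a)) =
  s * (\sum_a F a) + t * (\sum_a G a) + (\sum_a H a + \sum_a K a).
Proof. by rewrite !big_split !mulr_sumr. Qed.

(** Last step of [boxM] with its sums turned into atoms: d is the density at the point, s and t the
    values of the factors, y and z flux divergences, i the inner product. *)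
Lemma leibniz_cancel (F : fieldType) (d s t i y z : F) : d != 0 ->
  - d^-1 * (s * y + t * z + (d * i + d * i)) =
  s * (- d^-1 * y) + t * (- d^-1 * z) - 2%:R * i.
Proof. by move=> d0; field. Qed.

Lemma cexp_cancel (F : fieldType) (d s i y : F) : d != 0 ->
  - d^-1 * (s * (y + d * i)) = s * (- d^-1 * y - i).
Proof. by move=> d0; field. Qed.

Section WaveOperator.
Context {R : realType} {X : topologicalType} {n : nat}.
Context {N : manifold R X n.+1}.
Variable g : lorentzian N.
Implicit Types (phi psi : chart R X n.+1) (u v : X -> R[i]).

Definition cflux phi u a x : R[i] :=
  \sum_b (dens g phi x * invmx (gmx g phi (cinv phi x)) a b)%:C%C
    * cpd b (fun y => u (cinv phi y)) x.

Lemma box_inE phi u p : box_in g phi u p =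
  - ((dens g phi (cmap phi p))^-1)%:C%C * \sum_a cpd a (cflux phi u a) (cmap phi p).
Proof. by []. Qed.

Lemma cflux_parts phi u a x :
  complex.Re (cflux phi u a x) = rflux g phi (fun p => complex.Re (u p)) a x /\
  complex.Im (cflux phi u a x) = rflux g phi (fun p => complex.Im (u p)) a x.
Proof.
rewrite /cflux cRe_sum cIm_sum; split; apply: eq_bigr => b _.
- by rewrite cReZ.
- by rewrite cImZ.
Qed.

(** The coefficients of the operator are real, so it acts separately on the two parts; this carries
    the real invariance over to complex functions. *)
Lemma box_in_parts phi u p :
  complex.Re (box_in g phi u p) = rbox_in g phi (fun p => complex.Re (u p)) p /\
  complex.Im (box_in g phi u p) = rbox_in g phi (fun p => complex.Im (u p)) p.
Proof.
rewrite box_inE -raddfN cReZ cImZ cRe_sum cIm_sum /rbox_in.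
split; congr (_ * _); apply: eq_bigr => a _.
- rewrite -[LHS]/(pd a (fun x => complex.Re (cflux phi u a x)) (cmap phi p)).
  by congr pd; apply/funext => x; case: (cflux_parts phi u a x).
- rewrite -[LHS]/(pd a (fun x => complex.Im (cflux phi u a x)) (cmap phi p)).
  by congr pd; apply/funext => x; case: (cflux_parts phi u a x).
Qed.

Lemma inner_in_parts phi u v p :
  complex.Re (inner_in g phi u v p) =
    rinner_in g phi (fun p => complex.Re (u p)) (fun p => complex.Re (v p)) p
    - rinner_in g phi (fun p => complex.Im (u p)) (fun p => complex.Im (v p)) p /\
  complex.Im (inner_in g phi u v p) =
    rinner_in g phi (fun p => complex.Re (u p)) (fun p => complex.Im (v p)) p
    + rinner_in g phi (fun p => complex.Im (u p)) (fun p => complex.Re (v p)) p.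
Proof.
rewrite /inner_in cRe_sum cIm_sum; split.
- rewrite -sumrB; apply: eq_bigr => a _; rewrite cRe_sum -sumrB.
  by apply: eq_bigr => b _; rewrite cReM cReZ cImZ.
- rewrite -big_split; apply: eq_bigr => a _; rewrite cIm_sum -big_split.
  by apply: eq_bigr => b _; rewrite cImM cReZ cImZ.
Qed.

Lemma box_in_change phi psi u p : atlas N phi -> atlas N psi ->
  cdom phi p -> cdom psi p -> csmooth N u -> box_in g phi u p = box_in g psi u p.
Proof.
move=> aphi apsi dphi dpsi /csmooth_parts[sr si].
have [r1 i1] := box_in_parts phi u p; have [r2 i2] := box_in_parts psi u p.
apply: eqReIm.
- exact: (etrans r1 (etrans (rbox_in_change g aphi apsi dphi dpsi sr) (esym r2))).
- exact: (etrans i1 (etrans (rbox_in_change g aphi apsi dphi dpsi si) (esym i2))).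
Qed.

Lemma inner_in_change phi psi u v p : atlas N phi -> atlas N psi ->
  cdom phi p -> cdom psi p -> csmooth N u -> csmooth N v ->
  inner_in g phi u v p = inner_in g psi u v p.
Proof.
move=> aphi apsi dphi dpsi /csmooth_parts[sr si] /csmooth_parts[tr ti].
have [r1 i1] := inner_in_parts phi u v p; have [r2 i2] := inner_in_parts psi u v p.
have C f k (sf : smooth N f) (sk : smooth N k) :=
  rinner_in_change g aphi apsi dphi dpsi sf sk.
apply: eqReIm.
- by apply: (etrans r1 (etrans _ (esym r2))); rewrite (C _ _ sr tr) (C _ _ si ti).
- by apply: (etrans i1 (etrans _ (esym i2))); rewrite (C _ _ sr ti) (C _ _ si tr).
Qed.

(** Replaces the chart chosen at p by one chart valid at all nearby points, without which [box g u]
    could not be differentiated. *)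
Lemma boxE phi u p : atlas N phi -> cdom phi p -> csmooth N u ->
  box g u p = box_in g phi u p.
Proof.
move=> ap dp su; apply: box_in_change => //.
- exact: chart_at_atlas.
- exact: chart_at_cdom.
Qed.

Lemma innerE phi u v p : atlas N phi -> cdom phi p -> csmooth N u -> csmooth N v ->
  inner g u v p = inner_in g phi u v p.
Proof.
move=> ap dp su sv; apply: inner_in_change => //.
- exact: chart_at_atlas.
- exact: chart_at_cdom.
Qed.

Lemma csmooth_on_cflux phi u a : atlas N phi -> csmooth N u ->
  csmooth_on (cimg phi) (cflux phi u a).
Proof.
move=> ap su; have oU := atlas_cimg_open ap.
apply: (csmooth_on_sum _ oU) => b _; apply: (csmooth_onM oU).
  apply: csmooth_on_real; apply: (smooth_onM oU); first exact: smooth_on_dens.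
  exact: smooth_on_invg.
by apply: csmooth_on_cpd; exact: su.
Qed.

Lemma csmooth_box u : csmooth N u -> csmooth N (box g u).
Proof.
move=> su phi ap; have oU := atlas_cimg_open ap.
have sd : csmooth_on (cimg phi) (fun x => (- (dens g phi x)^-1)%:C%C).
  apply: csmooth_on_real; apply: (smooth_onN oU); apply: (smooth_onV oU).
    by move=> x ix; rewrite gt_eqF// dens_gt0.
  exact: smooth_on_dens.
have ss : csmooth_on (cimg phi) (fun x => \sum_a cpd a (cflux phi u a) x).
  apply: (csmooth_on_sum _ oU) => a _; apply: csmooth_on_cpd.
  exact: csmooth_on_cflux.
apply: (csmooth_on_eq oU _ (csmooth_onM oU sd ss)) => x ix.
have [dx Kx] := cinvK (atlas_chart ap) ix.
by rewrite (boxE ap dx su) box_inE Kx raddfN.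
Qed.

Lemma csmooth_inner u v : csmooth N u -> csmooth N v -> csmooth N (inner g u v).
Proof.
move=> su sv phi ap; have oU := atlas_cimg_open ap.
have S : csmooth_on (cimg phi) (fun x => \sum_a \sum_b
  (invmx (gmx g phi (cinv phi x)) a b)%:C%C
    * cpd a (fun x => u (cinv phi x)) x * cpd b (fun x => v (cinv phi x)) x).
  apply: (csmooth_on_sum _ oU) => a _; apply: (csmooth_on_sum _ oU) => b _.
  apply: (csmooth_onM oU); last by apply: csmooth_on_cpd; exact: sv.
  apply: (csmooth_onM oU); last by apply: csmooth_on_cpd; exact: su.
  by apply: csmooth_on_real; exact: smooth_on_invg.
apply: (csmooth_on_eq oU _ S) => x ix.
have [dx Kx] := cinvK (atlas_chart ap) ix.
by rewrite (innerE ap dx su sv) /inner_in Kx.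
Qed.

Section AtPoint.
Variable p : X.
Let phi := chart_at N p.
Let x := cmap phi p.
Let U := cimg phi.
Let ap : atlas N phi := chart_at_atlas N p.
Let dp : cdom phi p := chart_at_cdom N p.
Let Ux : U x := cimg_cmap dp.
Let oU : open U := atlas_cimg_open ap.
Let Kp : cinv phi x = p. Proof. by have [_ _ -> //] := atlas_chart ap. Qed.

Let ginv a b : R := invmx (gmx g phi p) a b.

Let ginv_sym a b : ginv a b = ginv b a.
Proof.
by rewrite /ginv -[X in invmx X a b](g_sym g ap dp) -trmx_inv mxE.
Qed.

Lemma innerC u v : inner g u v p = inner g v u p.
Proof.
rewrite /inner /inner_in exchange_big/=; apply: eq_bigr => a _; apply: eq_bigr => b _.
by rewrite -/(ginv _ _) ginv_sym mulrAC.
Qed.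

Lemma innerZr u v (a : R[i]) : csmooth N v ->
  inner g u (fun q => a * v q) p = a * inner g u v p.
Proof.
move=> sv; rewrite /inner /inner_in mulr_sumr; apply: eq_bigr => i _.
rewrite mulr_sumr; apply: eq_bigr => j _.
by rewrite (cpdZ Ux j a (sv _ ap)) mulrCA.
Qed.

Lemma innerZl u v (a : R[i]) : csmooth N u ->
  inner g (fun q => a * u q) v p = a * inner g u v p.
Proof.
by move=> su; exact: (etrans (innerC _ _) (etrans (innerZr _ _ su) (congr1 _ (innerC _ _)))).
Qed.

Lemma inner_cexp u v : csmooth N u ->
  inner g (fun q => cexp (u q)) v p = cexp (u p) * inner g u v p.
Proof.
move=> su; rewrite /inner /inner_in mulr_sumr; apply: eq_bigr => i _.
rewrite mulr_sumr; apply: eq_bigr => j _.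
have -> := cpd_cexp Ux i (su _ ap).
by rewrite Kp; ring.
Qed.

Let cdens0 : (dens g phi x)%:C%C != 0 :> R[i].
Proof.
by rewrite eq_complex /= negb_and gt_eqF// dens_gt0.
Qed.

Let boxp u : box g u p = - ((dens g phi x)%:C%C)^-1 * \sum_a cpd a (cflux phi u a) x.
Proof. by rewrite /box box_inE fmorphV. Qed.

Let flux_inner u v :
  \sum_a cflux phi u a x * cpd a (fun y => v (cinv phi y)) x =
  (dens g phi x)%:C%C * inner g u v p.
Proof.
rewrite innerC /inner /inner_in -/phi -/x mulr_sumr; apply: eq_bigr => a _.
rewrite mulr_suml mulr_sumr; apply: eq_bigr => b _.
by rewrite Kp rmorphM/=; ring.
Qed.

(** The flux of u v is u flux(v) + v flux(u). Its divergence has two cross terms, each equal to the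
    density times <grad u, grad v> by symmetry of the inverse metric; the minus sign is that of the
    convention for [box]. *)
Lemma boxM u v : csmooth N u -> csmooth N v ->
  box g (fun q => u q * v q) p =
  u p * box g v p + v p * box g u p - 2%:R * inner g u v p.
Proof.
move=> su sv.
pose uu y := u (cinv phi y); pose vv y := v (cinv phi y).
have suu : csmooth_on U uu by exact: su.
have svv : csmooth_on U vv by exact: sv.
have fluxM a y : U y -> cflux phi (fun q => u q * v q) a y =
    uu y * cflux phi v a y + vv y * cflux phi u a y.
  move=> Uy; rewrite !mulr_sumr -big_split/=; apply: eq_bigr => b _.
  by rewrite (cpdM Uy b suu svv) -/uu -/vv; ring.
have D a : cpd a (cflux phi (fun q => u q * v q) a) x =
    uu x * cpd a (cflux phi v a) x + vv x * cpd a (cflux phi u a) x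
    + (cflux phi v a x * cpd a uu x + cflux phi u a x * cpd a vv x).
  have sfu := csmooth_on_cflux a ap su; have sfv := csmooth_on_cflux a ap sv.
  rewrite (cpd_eq a oU Ux (fluxM a)).
  rewrite (cpdD Ux a (csmooth_onM oU suu sfv) (csmooth_onM oU svv sfu)).
  rewrite (cpdM Ux a suu sfv) (cpdM Ux a svv sfu).
  move: (uu x) (vv x) (cpd a uu x) (cpd a vv x) (cflux phi u a x) (cflux phi v a x).
  move: (cpd a (cflux phi u a) x) (cpd a (cflux phi v a) x) => *; ring.
have S : \sum_a cpd a (cflux phi (fun q => u q * v q) a) x =
    uu x * (\sum_a cpd a (cflux phi v a) x) + vv x * (\sum_a cpd a (cflux phi u a) x)
    + ((dens g phi x)%:C%C * inner g u v p + (dens g phi x)%:C%C * inner g u v p).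
  apply: (etrans (eq_bigr _ (fun a _ => D a))).
  apply: (etrans (sum_lin2 _ _ _ _ _ _)).
  by rewrite (flux_inner v u) (flux_inner u v) (innerC v u).
have -> : u p = uu x by rewrite /uu Kp.
have -> : v p = vv x by rewrite /vv Kp.
rewrite !boxp; apply: (etrans (congr1 _ S)).
exact: leibniz_cancel cdens0.
Qed.

(** For u = i Phi / h the last term becomes + <grad Phi, grad Phi> / h^2. This power explains why
    c_j is matched with b_(j-2) and why the solution starts at order h^2. *)
Lemma box_cexp u : csmooth N u ->
  box g (fun q => cexp (u q)) p = cexp (u p) * (box g u p - inner g u u p).
Proof.
move=> su; pose uu y := u (cinv phi y).
have suu : csmooth_on U uu by exact: su.
have sE := csmooth_on_cexp oU suu.
have fluxE a y : U y -> cflux phi (fun q => cexp (u q)) a y =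
    cexp (uu y) * cflux phi u a y.
  move=> Uy; rewrite !mulr_sumr; apply: eq_bigr => b _.
  by rewrite (cpd_cexp Uy b suu) mulrCA.
have D a : cpd a (cflux phi (fun q => cexp (u q)) a) x =
    cexp (uu x) * (cpd a (cflux phi u a) x + cflux phi u a x * cpd a uu x).
  rewrite (cpd_eq a oU Ux (fluxE a)) (cpdM Ux a sE (csmooth_on_cflux a ap su)).
  rewrite (cpd_cexp Ux a suu).
  move: (cexp (uu x)) (cpd a uu x) (cflux phi u a x) (cpd a (cflux phi u a) x).
  by move=> *; ring.
have S : \sum_a cpd a (cflux phi (fun q => cexp (u q)) a) x =
    cexp (uu x) * (\sum_a cpd a (cflux phi u a) x + (dens g phi x)%:C%C * inner g u u p).
  apply: (etrans (eq_bigr _ (fun a _ => D a))).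
  apply: (etrans (sum_lin1 _ _ _)).
  by rewrite (flux_inner u u).
have -> : u p = uu x by rewrite /uu Kp.
rewrite !boxp; apply: (etrans (congr1 _ S)).
exact: cexp_cancel cdens0.
Qed.

Lemma boxZ u (a : R[i]) : csmooth N u -> box g (fun q => a * u q) p = a * box g u p.
Proof.
move=> su.
have fluxZ c y : U y -> cflux phi (fun q => a * u q) c y = a * cflux phi u c y.
  move=> Uy; rewrite !mulr_sumr; apply: eq_bigr => b _.
  by rewrite (cpdZ Uy b a (su _ ap)) mulrCA.
rewrite !boxp mulrCA; apply: congr1; rewrite mulr_sumr; apply: eq_bigr => c _.
by rewrite (cpd_eq c oU Ux (fluxZ c)) (cpdZ Ux c a (csmooth_on_cflux c ap su)).
Qed.

Lemma box_sum (I : Type) (r : seq I) (P : pred I) (u : I -> X -> R[i]) :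
  (forall k, P k -> csmooth N (u k)) ->
  box g (fun q => \sum_(k <- r | P k) u k q) p = \sum_(k <- r | P k) box g (u k) p.
Proof.
move=> su.
have fluxS c y : U y -> cflux phi (fun q => \sum_(k <- r | P k) u k q) c y =
    \sum_(k <- r | P k) cflux phi (u k) c y.
  move=> Uy; rewrite exchange_big/=; apply: eq_bigr => b _.
  by rewrite (cpd_sum Uy b r (fun k Pk => su k Pk _ ap)) mulr_sumr.
rewrite (eq_bigr _ (fun k _ => boxp (u k))) -mulr_sumr boxp; apply: congr1.
rewrite exchange_big/=; apply: eq_bigr => c _.
rewrite (cpd_eq c oU Ux (fluxS c)).
exact: (cpd_sum Ux c r (fun k Pk => csmooth_on_cflux c ap (su k Pk))).
Qed.

(** Locality: the complement of A is open, so u vanishes near p together with its derivatives. With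
    A empty this treats the zero function. *)
Lemma box_inner_vanish (A : set X) u v : closed A -> (forall q, ~ A q -> u q = 0) ->
  ~ A p -> box g u p = 0 /\ inner g v u p = 0.
Proof.
move=> cA u0 nA.
pose W := cmap phi @` (cdom phi `&` ~` A).
have oW : open W.
  by apply: chart_image_open; [exact: atlas_chart ap|exact: closed_openC].
have Wx : W x by exists p.
have uW y : W y -> u (cinv phi y) = 0.
  move=> [q [dq nq] <-]; have [_ _ K _ _] := atlas_chart ap.
  by rewrite K//; exact: u0.
have d0 b y : W y -> cpd b (fun y => u (cinv phi y)) y = 0.
  by move=> Wy; rewrite (cpd_eq b oW Wy uW) cpd_cst.
split.
- rewrite boxp big1 ?mulr0// => a _.
  have f0 y : W y -> cflux phi u a y = 0.
    by move=> Wy; rewrite /cflux big1// => b _; rewrite d0// mulr0.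
  by rewrite (cpd_eq a oW Wx f0) cpd_cst.
- rewrite /inner /inner_in big1// => a _; rewrite big1// => b _.
  by rewrite d0// mulr0.
Qed.

End AtPoint.

End WaveOperator.

(** * The formal solution *)

Section FormalSolution.
Context {R : realType} {X : topologicalType} {n : nat}.
Context {N : manifold R X n.+1}.
Variable g : lorentzian N.
Variables (Q q Phi : X -> R[i]) (b : nat -> X -> R[i]) (A : set X).
Hypotheses (sQ : csmooth N Q) (sq : csmooth N q) (sPhi : csmooth N Phi).
Hypotheses (sb : forall l, csmooth N (b l)) (b0 : forall l p, ~ A p -> b l p = 0).
Hypotheses (cA : closed A) (nullA : forall p, A p -> inner g Phi Phi p != 0).

(** Numerator of the recursion for c_(k+2), with u and v in the places of c_k and c_(k+1). *)
Definition coef_num k (u v : X -> R[i]) p : R[i] :=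
  q p * b k p - (box g u p + Q p * u p) - 'i%C * box g Phi p * v p
  + 2%:R * 'i%C * inner g Phi v p.

(* [coef_pair k] is the pair of c_k and c_(k+1). *)
Fixpoint coef_pair k : (X -> R[i]) * (X -> R[i]) :=
  if k is k'.+1 then
    let uv := coef_pair k' in
    (uv.2, fun p => coef_num k' uv.1 uv.2 p / inner g Phi Phi p)
  else (fun=> 0, fun=> 0).

Definition coef k := (coef_pair k).1.

Lemma coefSS k p :
  coef k.+2 p = coef_num k (coef k) (coef k.+1) p / inner g Phi Phi p.
Proof. by []. Qed.

Lemma coef_recursion j p : (2 <= j)%N ->
  coef j p = recursion_rhs g Q q Phi b coef j p.
Proof.
case: j => [|[|k]]// _; rewrite coefSS /recursion_rhs.
by rewrite !subSS !subn0.
Qed.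

(** For closed A this is [csmooth_supp N A u] without the closure, a form that passes pointwise
    through the recursion. *)
Definition vanishing_off (u : X -> R[i]) := csmooth N u /\ forall p, ~ A p -> u p = 0.

Lemma coef_num_vanishing k u v : vanishing_off u -> vanishing_off v ->
  vanishing_off (coef_num k u v).
Proof.
move=> [su u0] [sv v0]; split.
  have s1 := csmoothN (csmoothD (csmooth_box g su) (csmoothM sQ su)).
  have s2 := csmoothN (csmoothM (csmoothZ 'i%C (csmooth_box g sPhi)) sv).
  have s3 := csmoothZ (2%:R * 'i%C) (csmooth_inner g sPhi sv).
  exact: (csmoothD (csmoothD (csmoothD (csmoothM sq (sb k)) s1) s2) s3).
move=> p nA; rewrite /coef_num b0// v0// u0//.
have [-> _] := box_inner_vanish g Phi cA u0 nA.
have [_ ->] := box_inner_vanish g Phi cA v0 nA.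
by rewrite !(mulr0, addr0, subr0).
Qed.

Lemma coef_vanishing k : vanishing_off (coef k).
Proof.
suff : vanishing_off (coef k) /\ vanishing_off (coef k.+1) by case.
elim: k => [|k [IH1 IH2]].
  by split; split; [exact: csmooth_cst|by []|exact: csmooth_cst|by []].
split; first exact: IH2.
have [sn n0] := coef_num_vanishing k IH1 IH2; split.
  exact: csmooth_div cA sn (csmooth_inner g sPhi sPhi) n0 nullA.
by move=> p nA; rewrite coefSS n0// mul0r.
Qed.

(** The recursion cleared of its denominator, now valid everywhere: on A the denominator is nonzero,
    off A both sides are 0. *)
Lemma coef_num_zero p k : coef_num k (coef k) (coef k.+1) p =
  inner g Phi Phi p * coef k.+2 p.
Proof.
have [Ap|nA] := pselect (A p).
  by rewrite coefSS mulrC divfK// nullA.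
rewrite (coef_vanishing k.+2).2// mulr0.
exact: (coef_num_vanishing k (coef_vanishing k) (coef_vanishing k.+1)).2.
Qed.

(* On c_j these are L_j and M_j in the notation of the header. *)
Definition zeroth_order u p : R[i] := box g u p + Q p * u p.
Definition first_order u p : R[i] :=
  'i%C * box g Phi p * u p - 2%:R * 'i%C * inner g Phi u p.

Lemma zeroth_order0 p : zeroth_order (fun=> 0) p = 0.
Proof.
have [E _] := @box_inner_vanish _ _ _ _ g p set0 (fun=> 0) (fun=> 0) closed0
  (fun _ _ => erefl) id.
by rewrite /zeroth_order E mulr0 addr0.
Qed.

Lemma first_order0 p : first_order (fun=> 0) p = 0.
Proof.
have [_ E] := @box_inner_vanish _ _ _ _ g p set0 (fun=> 0) Phi closed0
  (fun _ _ => erefl) id.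
by rewrite /first_order E !mulr0 subr0.
Qed.

Lemma zeroth_order_vanishing u : vanishing_off u -> vanishing_off (zeroth_order u).
Proof.
move=> [su u0]; split; last first.
  move=> p nA; rewrite /zeroth_order u0//.
  by have [-> _] := box_inner_vanish g u cA u0 nA; rewrite mulr0 addr0.
exact: (csmoothD (csmooth_box g su) (csmoothM sQ su)).
Qed.

Lemma first_order_vanishing u : vanishing_off u -> vanishing_off (first_order u).
Proof.
move=> [su u0]; split; last first.
  move=> p nA; rewrite /first_order u0//.
  by have [_ ->] := box_inner_vanish g Phi cA u0 nA; rewrite !mulr0 subr0.
have s1 := csmoothM (csmoothZ 'i%C (csmooth_box g sPhi)) su.
exact: (csmoothD s1 (csmoothN (csmoothZ (2%:R * 'i%C) (csmooth_inner g sPhi su)))).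
Qed.

(** The term L_k at order h^k cancels against the contribution of c_k two steps earlier, M_(k+1)
    against that of c_(k+1) one step earlier. The sum starts with c_2, so the first partners are
    missing; L_0 = L_1 = M_1 = 0 makes up for them. *)
Lemma telescope_orders (F : comPzRingType) (h : F) (L M B : nat -> F) J :
  L 0%N = 0 -> L 1%N = 0 -> M 1%N = 0 ->
  \sum_(k < J) (h ^+ k.+2 * L k.+2 + h ^+ k.+1 * M k.+2
                + h ^+ k * (B k - L k - M k.+1)) =
  \sum_(k < J) B k * h ^+ k
  + (h ^+ J * (L J + M J.+1) + h ^+ J.+1 * L J.+1).
Proof.
move=> L0 L1 M1; elim: J => [|J IH].
  by rewrite !big_ord0 L0 L1 M1 addr0 !mulr0 !addr0.
by rewrite !big_ord_recr /= IH !exprS; ring.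
Qed.

Lemma num_regroup (V : zmodType) (a z x t : V) : a - z - x + t = a - z - (x - t).
Proof. by rewrite opprB addrA addrAC. Qed.

(** The algebra of (box + Q) (E a u) with E = e^(i Phi / h) and a constant: bu = box u, bP = box
    Phi, P = <grad Phi, grad Phi>, Pu = <grad Phi, grad u>. The relation i^2 = -1 turns - (i / h)^2
    P into P / h^2. *)
Lemma conjugated_term (F : fieldType) (i h E a bu bP u P Pu Qp : F) (k : nat) :
  i * i = -1 -> h != 0 ->
  E * (a * bu) + a * u * (E * (i / h * bP - i / h * (i / h * P)))
    - 2%:R * (E * (i / h * (a * Pu))) + Qp * (E * (a * u)) =
  E * (a * (bu + Qp * u) + a / h * (i * bP * u - 2%:R * i * Pu)
       + a / h / h * (P * u)).
Proof.
move=> ii h0.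
have -> : i / h * (i / h * P) = - (P / h / h).
  by rewrite -[RHS]mulN1r -ii; field.
by field.
Qed.

Variables (h : R) (h0 : h != 0) (J : nat).
Let hC : R[i] := h%:C%C.

Let hC0 : hC != 0.
Proof. by rewrite eq_complex /= negb_and h0. Qed.

Definition wave_ansatz p : R[i] :=
  cexp ('i%C * Phi p / hC) * \sum_(k < J) coef k.+2 p * hC ^+ k.+2.

Definition residual_amp p : R[i] :=
  hC ^+ J * (zeroth_order (coef J) p + first_order (coef J.+1) p)
  + hC ^+ J.+1 * zeroth_order (coef J.+1) p.

Definition residual p : R[i] := cexp ('i%C * Phi p / hC) * residual_amp p.

Let phase p := 'i%C / hC * Phi p.
Let sphase : csmooth N phase := csmoothZ _ sPhi.

Let phaseE p : 'i%C * Phi p / hC = phase p.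
Proof. by rewrite mulrAC. Qed.

Let smooth_exp : csmooth N (fun p => cexp ('i%C * Phi p / hC)).
Proof.
have := csmooth_cexp sphase; congr csmooth.
by apply/funext => p; rewrite phaseE.
Qed.

Lemma csmooth_wave_ansatz : csmooth N wave_ansatz.
Proof.
have st (k : 'I_J) (_ : true) : csmooth N (fun p => coef k.+2 p * hC ^+ k.+2).
  exact: (csmoothM (coef_vanishing k.+2).1 (@csmooth_cst _ _ _ N (hC ^+ k.+2))).
exact: (csmoothM smooth_exp (csmooth_sum _ st)).
Qed.

Lemma residual_amp_vanishing : vanishing_off residual_amp.
Proof.
have [s1 z1] := zeroth_order_vanishing (coef_vanishing J).
have [s2 z2] := zeroth_order_vanishing (coef_vanishing J.+1).
have [s3 z3] := first_order_vanishing (coef_vanishing J.+1).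
split; first exact: (csmoothD (csmoothZ _ (csmoothD s1 s3)) (csmoothZ _ s2)).
by move=> p nA; rewrite /residual_amp z1// z2// z3// addr0 !mulr0 addr0.
Qed.

Lemma residual_vanishing : vanishing_off residual.
Proof.
have [s z] := residual_amp_vanishing; split; first exact: (csmoothM smooth_exp s).
by move=> p nA; rewrite /residual z// mulr0.
Qed.

Let termE (a : R[i]) u p : csmooth N u ->
  box g (fun p => cexp (phase p) * (a * u p)) p + Q p * (cexp (phase p) * (a * u p)) =
  cexp (phase p) * (a * zeroth_order u p + a / hC * first_order u p
     + a / hC / hC * (inner g Phi Phi p * u p)).
Proof.
move=> su; have sau := csmoothZ a su.
rewrite (boxM g p (csmooth_cexp sphase) sau).
rewrite (box_cexp g p sphase) (inner_cexp g p _ sphase).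
rewrite (boxZ g p a su) (boxZ g p _ sPhi) (innerZr g p phase a su).
rewrite (innerZl g p phase ('i%C / hC) sPhi) (innerZr g p Phi ('i%C / hC) sPhi).
rewrite (innerZl g p u ('i%C / hC) sPhi).
rewrite [a * ('i%C / hC * _)]mulrCA.
apply: conjugated_term => //.
by rewrite -expr2 sqr_i.
Qed.

Lemma wave_ansatz_equation p :
  box g wave_ansatz p + Q p * wave_ansatz p =
  cexp ('i%C * Phi p / hC) * (\sum_(l < J) q p * b l p * hC ^+ l) + residual p.
Proof.
pose t k p := cexp (phase p) * (hC ^+ k.+2 * coef k.+2 p).
have st k : csmooth N (t k).
  exact: (csmoothM (csmooth_cexp sphase) (csmoothZ _ (coef_vanishing k.+2).1)).
have wE : wave_ansatz = (fun p => \sum_(k < J) t k p).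
  apply/funext => x; rewrite /wave_ansatz phaseE mulr_sumr.
  by apply: eq_bigr => k _; rewrite /t [_ * hC ^+ _]mulrC.
have tE k : box g (t k) p + Q p * t k p = cexp (phase p) *
   (hC ^+ k.+2 * zeroth_order (coef k.+2) p + hC ^+ k.+1 * first_order (coef k.+2) p
    + hC ^+ k * (q p * b k p - zeroth_order (coef k) p - first_order (coef k.+1) p)).
  have [sc _] := coef_vanishing k.+2.
  have num : coef_num k (coef k) (coef k.+1) p =
      q p * b k p - zeroth_order (coef k) p - first_order (coef k.+1) p.
    exact: num_regroup.
  apply: (etrans (termE _ p sc)).
  rewrite -coef_num_zero num; apply: congr1.
  (* The divisions by h and h^2 lower h^(k+2) to h^(k+1) and h^k. *)
  by rewrite [in X in _ + X * _ + _]exprSr [in X in _ + _ + X * _]exprSr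
    [in X in _ + _ + X * _]exprSr !mulfK.
have boxS := @box_sum _ _ _ _ g p 'I_J (index_enum _) xpredT (fun k => t k)
  (fun k _ => st k).
rewrite wE boxS mulr_sumr -big_split.
apply: (etrans (eq_bigr _ (fun (k : 'I_J) _ => tE k))).
rewrite -mulr_sumr /residual phaseE -mulrDr; apply: congr1.
apply: (telescope_orders hC (L := fun k => zeroth_order (coef k) p)
  (M := fun k => first_order (coef k) p) (fun k => q p * b k p)).
- exact: zeroth_order0.
- exact: zeroth_order0.
- exact: first_order0.
Qed.

End FormalSolution.

(** * The product of the two beams *)

Section Compactness.
Context {R : realType}.

(** Compactness in near-covering form, along the filter of large integers k: around each point of K,
    |f| <= k holds for all large k. *)
Lemma compact_bounded_fun (T : topologicalType) (K : set T) (f : T -> R) :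
  compact K -> (forall x, K x -> {for x, continuous f}) ->
  exists2 B : R, 0 <= B & forall x, K x -> `|f x| <= B.
Proof.
move=> /compact_near_coveringP cK cf.
have : \forall k \near \oo, K `<=` (fun x => `|f x| <= k%:R).
  apply: cK => x Kx.
  have n1 : \forall x' \near x, `|f x - f x'| < 1.
    by have /cvgrPdist_lt := cf x Kx; apply.
  have n2 : \forall k \near \oo, `|f x| + 1 <= k%:R.
    exact: nbhs_infty_ger.
  exists ([set x' | `|f x - f x'| < 1], [set k | `|f x| + 1 <= k%:R]) => //=.
  move=> [x' k] /= [H1 H2]; apply: le_trans H2.
  have := ler_distD (f x) (f x') 0; rewrite !subr0 => /le_trans; apply.
  by rewrite addrC lerD2l distrC ltW.
move=> [k _ H]; exists k%:R => // x Kx; exact: (H k (leqnn k)).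
Qed.

(** Heine-Borel. The square of each coordinate of x - c is one summand of [esq], so the Euclidean
    ball lies in the sup-norm ball of the same radius. *)
Lemma esq_ball_compact m (c : 'rV[R]_m) (rho : R) : 0 <= rho ->
  compact [set x | esq (x - c) <= rho ^+ 2].
Proof.
move=> rho0; apply: bounded_closed_compact.
  exists (rho + `|c|); split; first exact: num_real.
  move=> B HB x /= Hx; rewrite (le_trans _ (ltW HB))//.
  rewrite -[x](subrK c) (le_trans (ler_normD _ _))// lerD2r.
  apply: mx_norm_le => // i j; rewrite -(ler_sqr (normr_ge0 _ : _ \is Num.nneg))//.
  rewrite real_normK ?num_real// (le_trans _ Hx)// /esq (bigD1 j)//= ord1.
  by rewrite lerDl sumr_ge0// => k _; exact: sqr_ge0.
have -> : [set x | esq (x - c) <= rho ^+ 2] =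
    (fun x : 'rV[R]_m => esq (x - c)) @^-1` [set y | y <= rho ^+ 2] by [].
apply: preimage_closed; last exact: closed_le.
move=> x _; rewrite /esq.
have -> : (fun x : 'rV[R]_m => \sum_i ((x - c) 0 i) ^+ 2) =
   \sum_i (fun x : 'rV[R]_m => (x 0 i - c 0 i) * (x 0 i - c 0 i)).
  apply/funext => y; rewrite fct_sumE; apply: eq_bigr => i _.
  by rewrite !mxE expr2.
elim/big_ind : _ => [|u v cu cv|i _]; first exact: cst_continuous.
  exact: continuousD.
have ci : {for x, continuous (fun x : 'rV[R]_m => x 0 i - c 0 i)}.
  by apply: continuousB; [exact: coord_continuous|exact: cst_continuous].
exact: (continuousM ci ci).
Qed.

End Compactness.

Section BeamProduct.
Context {R : realType} {X : topologicalType} {n K : nat}.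
Context {N : manifold R X n.+1}.
Variables (g : lorentzian N) (S : set X) (Q : X -> R[i]).
Variables (D1 D2 : beam_data R X n K).
Hypotheses (hD1 : formal_beam g S Q D1) (hD2 : formal_beam g S Q D2).
Variables (p0 : X) (chiB : X -> R).
Hypothesis (hchiB : cutoff_near (N := N) D1 D2 p0 chiB).

Let N0 := supp_p0 D1 D2 chiB.

Lemma closed_supp_p0 : closed N0.
Proof. exact: closed_closure. Qed.

Lemma beam_fermi_atlas (D : beam_data R X n K) : formal_beam g S Q D ->
  atlas N (beam_fermi D).
Proof. by move=> hD; case: (beam_fermiP hD). Qed.

Lemma supp_cutoff_tubes p : closure [set p | chiB p != 0] p ->
  cdom (beam_fermi D1) p /\ cdom (beam_fermi D2) p.
Proof.
have [_ [beta [rho [_ _ _ ball sub]]]] := hchiB.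
by move=> /sub[x /= xr <-]; have [_ []] := ball x (ltW xr).
Qed.

Lemma supp_p0_sub : N0 `<=` closure [set p | chiB p != 0].
Proof.
apply: closureS => p /=; apply: contra_neq => E.
by rewrite /chi_p0 E mulr0.
Qed.

(** N_0 is closed and lies in the image of a closed coordinate ball under the continuous inverse
    chart, which is compact. *)
Lemma compact_supp_p0 : compact N0.
Proof.
have [_ [beta [rho [abeta _ rho0 ball sub]]]] := hchiB.
have [_ _ _ _ cinvC] := atlas_chart abeta.
have cK : compact (cinv beta @` [set x | esq (x - cmap beta p0) <= rho ^+ 2]).
  apply: continuous_compact; last exact/esq_ball_compact/ltW.
  apply: continuous_in_subspaceT => x; rewrite inE /= => /ball[ix _].
  exact: cinvC.
apply: (subclosed_compact closed_supp_p0 cK) => p /supp_p0_sub/sub[x /= xr <-].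
by exists x => //=; exact: ltW.
Qed.

Lemma sum_phase_smooth : csmooth N (sum_phase D1 D2).
Proof. exact: (csmoothD (beam_phase_smooth hD1) (beam_phase_smooth hD2)). Qed.

Lemma beam_phase_Im_ge0 (D : beam_data R X n K) p : formal_beam g S Q D ->
  cdom (beam_fermi D) p -> 0 <= complex.Im (beam_phase D p).
Proof.
move=> hD dp; have [C C0 H] := beam_phase_Im hD; apply: le_trans (H p dp).
by apply: mulr_ge0; [exact: ltW|apply: sumr_ge0 => i _; exact: sqr_ge0].
Qed.

(** The support of the cut-off lies in both Fermi tubes, and in each tube the imaginary part of the
    phase is at least C |z'|^2. *)
Lemma sum_phase_Im_ge0 p : N0 p -> 0 <= complex.Im (sum_phase D1 D2 p).
Proof.
move=> /supp_p0_sub/supp_cutoff_tubes[d1 d2].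
by rewrite /sum_phase cImD addr_ge0// beam_phase_Im_ge0.
Qed.

Lemma csmooth_on_transfer phi psi (u : X -> R[i]) : atlas N phi -> atlas N psi ->
  csmooth_on (cimg phi) (fun x => u (cinv phi x)) ->
  csmooth_on (cmap psi @` (cdom psi `&` cdom phi)) (fun x => u (cinv psi x)).
Proof.
move=> aphi apsi [sr si]; split.
- exact: (smooth_on_transfer (f := fun p => complex.Re (u p)) aphi apsi).
- exact: (smooth_on_transfer (f := fun p => complex.Im (u p)) aphi apsi).
Qed.

Lemma prod_coef_off l p : ~ N0 p -> prod_coef D1 D2 chiB l p = 0.
Proof.
move=> nN; rewrite /prod_coef; have [->|nz] := eqVneq (chi_p0 D1 D2 chiB p) 0.
  by rewrite mul0r.
by case: nN; apply: subset_closure.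
Qed.

(** Beam cut-offs and amplitudes are smooth only in their tubes. A point in the support of [chiB]
    has a neighbourhood inside both tubes, where all factors are smooth; the complement of this
    support is open and the product vanishes on it. *)
Lemma csmooth_prod_coef l : csmooth N (prod_coef D1 D2 chiB l).
Proof.
move=> psi apsi; have a1 := beam_fermi_atlas hD1; have a2 := beam_fermi_atlas hD2.
have oi := atlas_cimg_open apsi.
apply: csmooth_on_local => x ix.
have [dx Kx] := cinvK (atlas_chart apsi) ix.
have [Sp|nSp] := pselect (closure [set p | chiB p != 0] (cinv psi x)).
- have [t1 t2] := supp_cutoff_tubes Sp.
  pose U1 := cmap psi @` (cdom psi `&` cdom (beam_fermi D1)).
  pose U2 := cmap psi @` (cdom psi `&` cdom (beam_fermi D2)).
  have oU1 : open U1 := overlap_open apsi a1.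
  have oU2 : open U2 := overlap_open apsi a2.
  pose U := U1 `&` U2; have oU : open U by exact: openI.
  exists U; first by split; exists (cinv psi x).
  have c1 : smooth_on U (fun x => beam_cut D1 (cinv psi x)).
    apply: (smooth_on_sub (@subIsetl _ U1 U2)).
    exact: (smooth_on_transfer a1 apsi (beam_cut_smooth hD1)).
  have c2 : smooth_on U (fun x => beam_cut D2 (cinv psi x)).
    apply: (smooth_on_sub (@subIsetr _ U1 U2)).
    exact: (smooth_on_transfer a2 apsi (beam_cut_smooth hD2)).
  have c3 : smooth_on U (fun x => chiB (cinv psi x)).
    apply: smooth_on_sub (hchiB.1 psi apsi) => y [/(overlap_mem apsi)[]].
    by [].
  have amp1 (m : 'I_K.+1) : csmooth_on U (fun x => beam_amp D1 m (cinv psi x)).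
    apply: (csmooth_on_sub (@subIsetl _ U1 U2)).
    exact: (csmooth_on_transfer a1 apsi (beam_amp_smooth hD1 (ltn_ord m))).
  have amp2 (m : 'I_K.+1) : csmooth_on U (fun x => beam_amp D2 m (cinv psi x)).
    apply: (csmooth_on_sub (@subIsetr _ U1 U2)).
    exact: (csmooth_on_transfer a2 apsi (beam_amp_smooth hD2 (ltn_ord m))).
  apply: (csmooth_onM oU).
    apply: csmooth_on_real; apply: (smooth_onM oU _ c3).
    exact: (smooth_onM oU c1 c2).
  apply: (csmooth_on_sum _ oU) => m _; apply: (csmooth_on_sum _ oU) => m' _.
  exact: (csmooth_onM oU (amp1 m) (amp2 m')).
- exists (cmap psi @` (cdom psi `&` ~` closure [set p | chiB p != 0])).
    by exists (cinv psi x).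
  have oW : open (cmap psi @` (cdom psi `&` ~` closure [set p | chiB p != 0])).
    apply: chart_image_open; first exact: atlas_chart apsi.
    exact/closed_openC/closed_closure.
  apply: (csmooth_on_eq oW _ (csmooth_on_cst _ 0)) => y [p [dp nC] <-].
  have [_ _ Kpsi _ _] := atlas_chart apsi.
  rewrite Kpsi// prod_coef_off//; exact: contra_not (@supp_p0_sub _) nC.
Qed.

End BeamProduct.

(** * Derivatives of oscillating functions *)

Section IteratedDerivatives.
Context {R : realType} {m : nat}.
Implicit Types (U : set 'rV[R]_m) (u v : 'rV[R]_m -> R[i]) (s : seq 'I_m).

Lemma csmooth_on_fcpd U u s : csmooth_on U u -> csmooth_on U (foldr cpd u s).
Proof.
by move=> su; elim: s => [|i s IH]; [exact: su|exact: (csmooth_on_cpd i IH)].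
Qed.

Lemma fcpd_eq U u v s x : open U -> (forall y, U y -> u y = v y) -> U x ->
  foldr cpd u s x = foldr cpd v s x.
Proof.
move=> oU uv; elim: s x => [|i s IH] x Ux /=; first exact: uv.
by apply: (cpd_eq _ oU Ux) => y Uy; exact: IH.
Qed.

Lemma fcpd0 s x : foldr cpd (fun=> 0 : R[i]) s x = 0.
Proof.
elim: s x => [|i s IH] x //=.
by rewrite (_ : foldr _ _ _ = fun=> 0) ?cpd_cst//; apply/funext.
Qed.

Lemma fcpd_lin U (c d : R[i]) u v s x : open U -> csmooth_on U u -> csmooth_on U v ->
  U x -> foldr cpd (fun y => c * u y + d * v y) s x =
  c * foldr cpd u s x + d * foldr cpd v s x.
Proof.
move=> oU su sv; elim: s x => [|i s IH] x Ux //=.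
have su' := csmooth_on_fcpd s su; have sv' := csmooth_on_fcpd s sv.
rewrite (cpd_eq i oU Ux IH).
rewrite (cpdD Ux i (csmooth_onM oU (csmooth_on_cst _ c) su')
  (csmooth_onM oU (csmooth_on_cst _ d) sv')).
by rewrite (cpdZ Ux i c su') (cpdZ Ux i d sv').
Qed.

Lemma oscillating_derivs U (ph a : 'rV[R]_m -> R[i]) s : open U ->
  csmooth_on U ph -> csmooth_on U a ->
  exists A : nat -> 'rV[R]_m -> R[i],
    [/\ forall l, csmooth_on U (A l),
        forall l, (size s < l)%N -> A l = (fun=> 0) &
        forall (h : R[i]) x, U x ->
          foldr cpd (fun y => cexp ('i%C * ph y / h) * a y) s x =
          cexp ('i%C * ph x / h) * \sum_(l < (size s).+1) h^-1 ^+ l * A l x].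
Proof.
move=> oU sph sa; elim: s => [|i s [A [sA A0 AE]]].
  exists (fun l => if l == 0%N then a else fun=> 0); split.
  - by case=> [|l]; [exact: sa|exact: csmooth_on_cst].
  - by case.
  - by move=> h x Ux; rewrite big_ord_recl big_ord0 addr0 expr0 mul1r.
exists (fun l x => cpd i (A l) x +
  (if l is l'.+1 then 'i%C * cpd i ph x * A l' x else 0)); split.
- move=> l; apply: (csmooth_onD oU (csmooth_on_cpd i (sA l))).
  case: l => [|l]; first exact: csmooth_on_cst.
  have s1 := csmooth_onM oU (csmooth_on_cst U 'i%C) (csmooth_on_cpd i sph).
  exact: (csmooth_onM oU s1 (sA l)).
- case=> [//|l] /= sl; apply/funext => x.
  rewrite A0; last exact: ltnW.
  by rewrite cpd_cst A0// mulr0 addr0.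
- move=> h x Ux /=.
  pose f y := 'i%C / h * ph y.
  have fE y : 'i%C * ph y / h = f y by rewrite mulrAC.
  pose S y := \sum_(l < (size s).+1) h^-1 ^+ l * A l y.
  have sf : csmooth_on U f by exact: (csmooth_onM oU (csmooth_on_cst _ _) sph).
  have st (l : 'I_(size s).+1) (_ : true) : csmooth_on U (fun y => h^-1 ^+ l * A l y).
    exact: (csmooth_onM oU (csmooth_on_cst _ _) (sA l)).
  have sS : csmooth_on U S by exact: (csmooth_on_sum _ oU st).
  have E1 y : U y -> foldr cpd (fun y => cexp ('i%C * ph y / h) * a y) s y =
      cexp (f y) * S y by move=> Uy; rewrite AE// fE.
  rewrite (cpd_eq i oU Ux E1) (cpdM Ux i (csmooth_on_cexp oU sf) sS).
  rewrite (cpd_cexp Ux i sf) fE mulrCA -mulrDr; apply: congr1.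
  have -> : cpd i f x = 'i%C / h * cpd i ph x by exact: (cpdZ Ux i _ sph).
  have -> : cpd i S x = \sum_(l < (size s).+1) h^-1 ^+ l * cpd i (A l) x.
    rewrite (cpd_sum Ux i _ st); apply: eq_bigr => l _.
    exact: (cpdZ Ux i _ (sA l)).
  under [RHS]eq_bigr do rewrite mulrDr.
  rewrite [RHS]big_split /=; congr (_ + _).
    by rewrite [RHS]big_ord_recr /= A0// cpd_cst mulr0 addr0.
  rewrite [RHS]big_ord_recl /= mulr0 add0r mulr_suml; apply: eq_bigr => l _.
  by rewrite exprSr; ring.
Qed.

End IteratedDerivatives.

Import Normc.

Section ComplexNorm.
Context {R : realType}.
Implicit Types z w : R[i].

Lemma csqnormE z : csqnorm z = normc z ^+ 2.
Proof. by case: z => a b; rewrite /normc sqr_sqrtr// addr_ge0// sqr_ge0. Qed.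

Lemma csqnorm0 : csqnorm (0 : R[i]) = 0.
Proof. by rewrite csqnormE normc0 expr0n. Qed.

Lemma normc_ge0 z : 0 <= normc z.
Proof. by case: z => a b; exact: sqrtr_ge0. Qed.

Lemma normc_le z : normc z <= `|complex.Re z| + `|complex.Im z|.
Proof.
rewrite -(ler_sqr (normc_ge0 z : _ \is Num.nneg)) ?nnegrE ?addr_ge0//.
rewrite -csqnormE /csqnorm sqrrD !real_normK ?num_real//.
rewrite addrAC lerDl mulrn_wge0// mulr_ge0//.
Qed.

Lemma normc_sum (I : Type) (r : seq I) (P : pred I) (F : I -> R[i]) :
  normc (\sum_(i <- r | P i) F i) <= \sum_(i <- r | P i) normc (F i).
Proof.
elim/big_ind2 : _ => //; first by rewrite normc0.
by move=> x a y b xa yb; rewrite (le_trans (le_normcD _ _))// lerD.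
Qed.

Lemma normc_real (a : R) : 0 <= a -> normc a%:C%C = a.
Proof. by move=> a0; rewrite /= expr0n addr0 sqrtr_sqr ger0_norm. Qed.

Lemma normcX z k : normc (z ^+ k) = normc z ^+ k.
Proof. by elim: k => [|k IH]; rewrite ?normc1// !exprS normcM IH. Qed.

(** The modulus of e^(i w / h) is e^(- Im w / h). *)
Lemma normc_phase (w : R[i]) (h : R) : 0 < h -> 0 <= complex.Im w ->
  normc (cexp ('i%C * w / h%:C%C)) <= 1.
Proof.
move=> h0 w0; rewrite /cexp normcM normc_real ?expR_ge0//.
rewrite /normc cos2Dsin2 sqrtr1 mulr1.
rewrite expR_le1 -fmorphV mulrC cReZ cReM /= mul0r mul1r sub0r mulrN oppr_le0.
by rewrite mulr_ge0// invr_ge0 ltW.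
Qed.

End ComplexNorm.

Section OscillatingBound.
Context {R : realType} {X : topologicalType} {m : nat}.

(** The h-free amplitudes are bounded on the compact C, the exponential by 1, and for h < 1 every
    power h^(-l) by the highest one. *)
Lemma oscillating_bound (phi : chart R X m) (C : set X)
    (ph a : 'rV[R]_m -> R[i]) (s : seq 'I_m) :
  is_chart phi -> compact C -> C `<=` cdom phi ->
  csmooth_on (cimg phi) ph -> csmooth_on (cimg phi) a ->
  exists2 B : R, 0 <= B & forall (h : R) p, 0 < h < 1 -> C p ->
    0 <= complex.Im (ph (cmap phi p)) ->
    normc (foldr cpd (fun y => cexp ('i%C * ph y / h%:C%C) * a y) s (cmap phi p))
    <= B * h ^- size s.
Proof.
move=> ch cC Cd sph sa; have [_ oU _ cm _] := ch.
have [A [sA _ AE]] := oscillating_derivs s oU sph sa.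
have bd (f : 'rV[R]_m -> R) : smooth_on (cimg phi) f ->
    exists2 B : R, 0 <= B & forall p, C p -> `|f (cmap phi p)| <= B.
  move=> sf; apply: (compact_bounded_fun (f := fun p => f (cmap phi p))) => // p Cp.
  apply: continuous_comp; first exact/cm/Cd.
  by apply: (smooth_on_cont sf); exact/cimg_cmap/Cd.
have bA l : exists B : R, 0 <= B /\ forall p, C p -> normc (A l (cmap phi p)) <= B.
  have [B1 B10 H1] := bd _ (sA l).1; have [B2 B20 H2] := bd _ (sA l).2.
  exists (B1 + B2); split; first exact: addr_ge0.
  by move=> p Cp; rewrite (le_trans (normc_le _))// lerD ?H1 ?H2.
have [B HB] := choice bA.
exists (\sum_(l < (size s).+1) B l).
  by apply: sumr_ge0 => l _; case: (HB l).
move=> h p /andP[h0 h1] Cp Im0.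
rewrite AE; last exact/cimg_cmap/Cd.
rewrite normcM -[leRHS]mul1r; apply: ler_pM; [exact: normc_ge0|exact: normc_ge0| |].
  exact: normc_phase.
rewrite (le_trans (normc_sum _ _ _))// mulr_suml; apply: ler_sum => l _.
rewrite normcM normcX normcV (normc_real (ltW h0)) mulrC.
apply: ler_pM; [exact: normc_ge0|by rewrite exprn_ge0// invr_ge0 ltW| |].
  by case: (HB l) => _; exact.
rewrite -exprVn ler_weXn2l//; last by rewrite -ltnS.
by rewrite invf_ge1// ltW.
Qed.

End OscillatingBound.

(** * The Sobolev estimate *)

Section IteratedIntegral.
Context {R : realType}.

Definition sym_segment (L : R) : set R := `[- L, L]%classic.

Lemma lebesgue_measure_sym_segment (L : R) : 0 <= L ->
  lebesgue_measure (sym_segment L) = (L + L)%:E.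
Proof.
move=> L0; have := @lebesgue_measure_itv R `[- L, L].
rewrite /= lte_fin => ->; case: ltP => LL; first by rewrite -EFinD opprK.
have -> : L = 0 by apply/eqP; rewrite eq_le L0 andbT; move: LL; rewrite lerNr; lra.
by rewrite addr0.
Qed.

Local Open Scope ereal_scope.

(* No measurability is needed: the integral of a nonnegative function is a
   supremum over the simple functions below it. *)
Lemma le_nonneg_integral d (T : measurableType d) (mu : {measure set T -> \bar R})
    (f1 f2 : T -> \bar R) :
  (forall x, 0 <= f1 x) -> (forall x, f1 x <= f2 x) ->
  \int[mu]_x f1 x <= \int[mu]_x f2 x.
Proof.
move=> f10 f12; have f20 x : 0 <= f2 x by exact: le_trans (f10 x) (f12 x).
rewrite !ge0_integralTE//; apply: ereal_sup_le => _ [h /= hf <-].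
by exists h => //= x; exact: le_trans (hf x) (f12 x).
Qed.

Lemma iterint_ge0 m (f : 'rV[R]_m -> \bar R) : (forall x, 0 <= f x) -> 0 <= iterint f.
Proof.
elim: m f => [|m IH] f f0 /=; first exact: f0.
by apply: integral_ge0 => t _; apply: IH.
Qed.

Lemma le_iterint m (f1 f2 : 'rV[R]_m -> \bar R) :
  (forall x, 0 <= f1 x) -> (forall x, f1 x <= f2 x) -> iterint f1 <= iterint f2.
Proof.
elim: m f1 f2 => [|m IH] f1 f2 f10 f12 /=; first exact: f12.
apply: le_nonneg_integral => t; first by apply: iterint_ge0.
by apply: IH.
Qed.

Lemma iterint0 m : iterint (fun _ : 'rV[R]_m => 0) = 0.
Proof.
elim: m => [|m IH] //=; rewrite IH.
exact: integral0.
Qed.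

(** Indicator of the cube [-L, L]^m, as a product so that its iterated integral factors. *)
Definition box_indic (L : R) m (x : 'rV[R]_m) : R :=
  (\prod_i \1_(sym_segment L) (x 0%R i))%R.

Lemma iterint_box (L c : R) m : (0 <= L)%R -> (0 <= c)%R ->
  iterint (fun x : 'rV[R]_m => (c * box_indic L x)%:E) = (c * (L + L) ^+ m)%:E.
Proof.
(* The constant c is generalised because the indicator of the outer variable joins it in the inner
   integral. *)
move=> L0; elim: m c => [|m IH] c c0 /=.
  by rewrite /box_indic big_ord0 expr0.
have E (t : R) : iterint (fun y : 'rV[R]_m =>
     (c * box_indic L (row_mx (const_mx t : 'rV[R]_1) y : 'rV[R]_m.+1))%:E) =
     (c * (L + L) ^+ m * \1_(sym_segment L) t)%:E.
  have c1 : (0 <= c * \1_(sym_segment L) t)%R by rewrite mulr_ge0.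
  rewrite mulrAC -(IH _ c1); congr iterint; apply/funext => y.
  rewrite /box_indic big_ord_recl mulrA; congr ((_ * _ * _)%:E).
    have -> : ord0 = lshift m (ord0 : 'I_1) by exact/val_inj.
    apply: congr1; apply: (etrans (row_mxEl (const_mx t) y 0%R ord0)).
    by rewrite mxE.
  apply: eq_bigr => i _; have -> : lift ord0 i = rshift 1 i by exact/val_inj.
  by apply: congr1; exact: (row_mxEr (const_mx t) y 0%R i).
rewrite (_ : (fun t => iterint _) =
    (fun t => (c * (L + L) ^+ m * \1_(sym_segment L) t)%:E)); last first.
  by apply/funext => t; exact: E.
rewrite (@integralZl_indic _ _ _ lebesgue_measure setT measurableT
  (fun=> sym_segment L) (c * (L + L) ^+ m)%R)//; last 2 first.
- by rewrite ltNge mulr_ge0// exprn_ge0// addr_ge0.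
- exact: measurable_itv.
rewrite integral_indic//; last exact: measurable_itv.
rewrite setIT; apply: (etrans (congr1 _ (lebesgue_measure_sym_segment L0))).
by rewrite -EFinM exprSr mulrA.
Qed.

End IteratedIntegral.

Section SobolevBound.
Context {R : realType} {X : topologicalType} {m : nat}.
Variable N : manifold R X m.

Lemma size_multi_index (alpha : 'I_m -> nat) :
  size (flatten [seq nseq (alpha i) i | i <- enum 'I_m]) = (\sum_i alpha i)%N.
Proof.
rewrite size_flatten /shape -map_comp sumnE big_map big_enum /=.
by apply: eq_bigr => i _; rewrite /= size_nseq.
Qed.

Variables (Phi r1 r2 : X -> R[i]) (N0 : set X) (J : nat).
Hypotheses (sPhi : csmooth N Phi) (s1 : csmooth N r1) (s2 : csmooth N r2).
Hypotheses (z1 : forall p, ~ N0 p -> r1 p = 0) (z2 : forall p, ~ N0 p -> r2 p = 0).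
Hypotheses (cN0 : closed N0) (Im0 : forall p, N0 p -> 0 <= complex.Im (Phi p)).

(** The shape of [residual], with its two powers of h separated so that r1 and r2 are free of h. *)
Definition wave_packet (h : R) p : R[i] :=
  cexp ('i%C * Phi p / h%:C%C) *
  (h%:C%C ^+ J * r1 p + h%:C%C ^+ J.+1 * r2 p).

(** Im Phi >= 0 is available only on N_0. Off N_0, and off the support of chi, the function is 0 on
    an open set, hence so are all its derivatives, and the exponential need not be bounded there. *)
Lemma wave_packet_derivs (phi : chart R X m) (chi : X -> R) (s : seq 'I_m) :
  atlas N phi -> smooth N chi -> compact (closure [set p | chi p != 0]) ->
  closure [set p | chi p != 0] `<=` cdom phi ->
  exists2 B : R, 0 <= B & forall (h : R) x, 0 < h < 1 -> cimg phi x ->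
    let d := foldr cpd (fun y => (chi (cinv phi y))%:C%C
                                 * wave_packet h (cinv phi y)) s x in
    csqnorm d <= B * (h ^+ J * h ^- size s) ^+ 2 /\
    (~ closure [set p | chi p != 0] (cinv phi x) -> d = 0).
Proof.
move=> aphi schi cC Cd; set C := closure _ in cC Cd *.
have ch := atlas_chart aphi; have oU := atlas_cimg_open aphi.
have [_ _ K _ _] := ch.
pose ph y := Phi (cinv phi y).
pose a1 y := (chi (cinv phi y))%:C%C * r1 (cinv phi y).
pose a2 y := (chi (cinv phi y))%:C%C * r2 (cinv phi y).
have sph : csmooth_on (cimg phi) ph by exact: sPhi.
have sa1 : csmooth_on (cimg phi) a1.
  exact: (csmooth_onM oU (csmooth_on_real (schi _ aphi)) (s1 aphi)).
have sa2 : csmooth_on (cimg phi) a2.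
  exact: (csmooth_onM oU (csmooth_on_real (schi _ aphi)) (s2 aphi)).
have [B1 B10 H1] := oscillating_bound s ch cC Cd sph sa1.
have [B2 B20 H2] := oscillating_bound s ch cC Cd sph sa2.
exists ((B1 + B2) ^+ 2); first exact: sqr_ge0.
move=> h x h01 ix d; have [dx Kx] := cinvK ch ix.
have /andP[h0 h1] := h01.
have vanish (A : set X) : closed A -> ~ A (cinv phi x) ->
    (forall q, ~ A q -> (chi q)%:C%C * wave_packet h q = 0) -> d = 0.
  move=> cA nA zA; pose W := cmap phi @` (cdom phi `&` ~` A).
  have oW : open W by apply: chart_image_open ch _; exact: closed_openC.
  have Wx : W x by exists (cinv phi x).
  apply: etrans (fcpd0 s x); apply: (fcpd_eq s oW _ Wx) => y [q [dq nq] <-].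
  by rewrite K// zA.
have offC q : ~ C q -> chi q = 0.
  by move=> nC; apply/eqP; apply: contrapT => /negP ne; apply/nC/subset_closure.
have vC : ~ C (cinv phi x) -> d = 0.
  move=> nC; apply: (vanish C (@closed_closure _ _) nC) => q nq.
  by rewrite offC// mul0r.
have bound0 : d = 0 -> csqnorm d <= (B1 + B2) ^+ 2 * (h ^+ J * h ^- size s) ^+ 2.
  by move=> ->; rewrite csqnorm0 mulr_ge0// sqr_ge0.
split=> //.
have [Cx|nC] := pselect (C (cinv phi x)); last exact: (bound0 (vC nC)).
have [Nx|nN] := pselect (N0 (cinv phi x)); last first.
  apply: bound0; apply: (vanish N0 cN0 nN) => q nq.
  by rewrite /wave_packet z1// z2// !mulr0 addr0 !mulr0.
pose E y := cexp ('i%C * ph y / h%:C%C).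
have sE : csmooth_on (cimg phi) E.
  have sf : csmooth_on (cimg phi) (fun y => 'i%C / h%:C%C * ph y).
    exact: (csmooth_onM oU (csmooth_on_cst _ _) sph).
  apply: (csmooth_on_eq oU _ (csmooth_on_cexp oU sf)) => y _.
  by rewrite /E mulrAC.
have sE1 := csmooth_onM oU sE sa1; have sE2 := csmooth_onM oU sE sa2.
have dE : d = h%:C%C ^+ J * foldr cpd (fun y => E y * a1 y) s x
            + h%:C%C ^+ J.+1 * foldr cpd (fun y => E y * a2 y) s x.
  rewrite -(fcpd_lin _ _ s oU sE1 sE2 ix); apply: (fcpd_eq s oU _ ix) => y _.
  by rewrite /wave_packet -/(ph y) -/(E y) /a1 /a2; ring.
have Imx : 0 <= complex.Im (ph (cmap phi (cinv phi x))).
  by rewrite /ph K//; exact: Im0.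
have b1 := H1 h _ h01 Cx Imx; have b2 := H2 h _ h01 Cx Imx.
rewrite Kx in b1 b2.
have nh k : normc (h%:C%C ^+ k) = h ^+ k by rewrite normcX (normc_real (ltW h0)).
rewrite csqnormE -exprMn ler_sqr ?nnegrE ?normc_ge0//; last first.
  by rewrite !mulr_ge0 ?addr_ge0 ?exprn_ge0 ?invr_ge0 ?exprn_ge0// ltW.
rewrite dE (le_trans (le_normcD _ _))// !normcM !nh mulrDl lerD//.
  by rewrite mulrCA; apply: ler_wpM2l b1; exact/exprn_ge0/ltW.
(* The term of order J + 1 is absorbed into order J because h < 1. *)
rewrite mulrCA; apply: ler_pM; [exact/exprn_ge0/ltW|exact: normc_ge0| |exact: b2].
by rewrite exprS ler_piMl// ?exprn_ge0// ltW.
Qed.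

(** The integrand is at most a constant times the indicator of a cube that contains the coordinate
    image of the support of chi. Monotonicity of [iterint] then suffices, and the cube contributes
    (2 L)^m whatever the set S. *)
Lemma wave_packet_iterint (S : set X) (phi : chart R X m) (chi : X -> R) k
    (alpha : 'I_m -> nat) :
  atlas N phi -> smooth N chi -> compact (closure [set p | chi p != 0]) ->
  closure [set p | chi p != 0] `<=` cdom phi -> (\sum_i alpha i <= k)%N ->
  exists G : R, 0 <= G /\ forall h : R, 0 < h < 1 ->
    (iterint (fun x : 'rV[R]_m =>
       (\1_(cmap phi @` (cdom phi `&` S)) x *
        csqnorm (multi_pd alpha (fun y => let p := cinv phi y in
            (chi p)%:C%C * wave_packet h p) x))%:E)
     <= (G * (h ^+ J * h ^- k) ^+ 2)%:E)%E.
Proof.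
move=> aphi schi cC Cd ak; have ch := atlas_chart aphi.
pose s := flatten [seq nseq (alpha i) i | i <- enum 'I_m].
have [B B0 HB] := wave_packet_derivs s aphi schi cC Cd.
have [L L0 HL] : exists2 L : R, 0 <= L &
    forall p, closure [set p | chi p != 0] p -> `| `|cmap phi p| | <= L.
  apply: (compact_bounded_fun (f := fun p => `|cmap phi p|)) => // p Cp.
  have [_ _ _ cm _] := ch.
  by apply: continuous_comp; [exact/cm/Cd|exact: norm_continuous].
exists (B * (L + L) ^+ m); split; first by rewrite mulr_ge0// exprn_ge0// addr_ge0.
move=> h h01; have /andP[h0 h1] := h01.
have q0 : 0 <= B * (h ^+ J * h ^- k) ^+ 2 by rewrite mulr_ge0// sqr_ge0.
rewrite mulrAC -iterint_box//; apply: le_iterint => x; rewrite lee_fin.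
  by rewrite mulr_ge0// ?indicE// csqnormE sqr_ge0.
have box0 : 0 <= box_indic L x by apply: prodr_ge0 => i _; rewrite indicE.
rewrite indicE; have [|_] := boolP (x \in _); last first.
  by rewrite mul0r mulr_ge0.
rewrite inE mul1r => -[p [dp _] px].
have ix : cimg phi x by exists p.
have [Kp pE] := cinvK ch ix.
have [b zero] := HB h x h01 ix.
have [Cp|nC] := pselect (closure [set p | chi p != 0] (cinv phi x)); last first.
  rewrite [multi_pd _ _ _]zero// csqnorm0.
  by rewrite mulr_ge0.
have -> : box_indic L x = 1.
  rewrite /box_indic big1// => i _; rewrite indicE mem_set//.
  rewrite /sym_segment /= in_itv /= -ler_norml.
  rewrite (le_trans (mx_entry_le x 0 i))//.
  by have := HL _ Cp; rewrite pE normr_id.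
rewrite mulr1; apply: (le_trans b); apply: ler_wpM2l => //.
have hJ : 0 <= h ^+ J by exact/exprn_ge0/ltW.
have hV l : 0 <= h ^- l by rewrite invr_ge0; exact/exprn_ge0/ltW.
rewrite ler_sqr ?nnegrE ?mulr_ge0//; apply: ler_wpM2l => //.
rewrite -!exprVn ler_weXn2l//; first by rewrite invf_ge1// ltW.
by rewrite size_multi_index.
Qed.

Hypothesis compN0 : compact N0.

(** Only finitely many terms of the series are nonzero, with a number [n0] that depends on N_0
    alone; C is the root of the sum of their constants. *)
Lemma wave_packet_sobolev (P : partition_of_unity N) (S : set X) (k : nat) :
  exists C : R, forall h : R, 0 < h < 1 ->
    (sobolev_norm P S k (wave_packet h) <= (C * (h ^+ J * h ^- k))%:E)%E.
Proof.
pose supp i := closure [set p | pu_fun P i p != 0].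
pose term h i (alpha : {ffun 'I_m -> 'I_k.+1}) :=
  iterint (fun x : 'rV[R]_m =>
    (\1_(cmap (pu_chart P i) @` (cdom (pu_chart P i) `&` S)) x *
     csqnorm (multi_pd (fun a => alpha a : nat)
       (fun y => let p := cinv (pu_chart P i) y in
                 (pu_fun P i p)%:C%C * wave_packet h p) x))%:E).
have term_ge0 h i alpha : (0 <= term h i alpha)%E.
  apply: iterint_ge0 => x; rewrite lee_fin mulr_ge0// ?indicE//.
  by rewrite csqnormE sqr_ge0.
(* The order condition on alpha sits inside the statement, so that one use of [choice] picks G for
   all indices at once; G = 0 serves when it fails. *)
have bounds (ia : nat * {ffun 'I_m -> 'I_k.+1}) : exists G : R, 0 <= G /\
    forall h : R, 0 < h < 1 -> (\sum_a ia.2 a <= k)%N ->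
     (term h ia.1 ia.2 <= (G * (h ^+ J * h ^- k) ^+ 2)%:E)%E.
  case: ia => i alpha /=.
  have [ak|nak] := boolP (\sum_a alpha a <= k)%N; last by exists 0; split.
  have [G [G0 HG]] := @wave_packet_iterint S (pu_chart P i) (pu_fun P i) k
    (fun a => alpha a) (pu_atlas P i) (@pu_smooth _ _ _ _ P i) (@pu_compact _ _ _ _ P i)
    (@pu_supp _ _ _ _ P i) ak.
  by exists G; split=> // h h01 _; exact: HG.
have [G HG] := choice bounds.
(* Local finiteness gives each point of N_0 a neighbourhood that meets no support of large index;
   compactness makes the threshold uniform. *)
have [n0 Hn0] : exists n0, forall i, (n0 <= i)%N -> forall p, N0 p -> ~ supp i p.
  have /compact_near_coveringP cN := compN0.
  have : \forall j \near \oo, N0 `<=` (fun p => forall i, (j <= i)%N -> ~ supp i p).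
    apply: cN => p Np; have [V nV /finite_seqP[l lE]] := pu_locally_finite P p.
    pose j0 := (\max_(i <- l) i).+1.
    exists (V, [set j | (j0 <= j)%N]) => /=.
      by split; [exact: nV|exact: nbhs_infty_ge].
    move=> [x' j] /= [Vx' jj] i ji Sx'.
    have : [set` l] i by rewrite -lE; exists x'.
    move=> /= il; have := @leq_bigmax_seq _ l xpredT id i il isT.
    by move=> /(leq_ltn_trans)/(_ (leq_trans jj ji)); rewrite ltnn.
  by move=> [n0 _ H]; exists n0 => i ni p Np; exact: (H n0 (leqnn n0) p Np i ni).
have tail h i : (n0 <= i)%N -> forall alpha, term h i alpha = 0%E.
  move=> ni alpha; rewrite /term.
  have Z : (fun y => let p := cinv (pu_chart P i) y in
      (pu_fun P i p)%:C%C * wave_packet h p) = (fun=> 0).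
    apply/funext => y /=; set p := cinv _ y.
    have [Np|nN] := pselect (N0 p).
      suff -> : pu_fun P i p = 0 by rewrite mul0r.
      apply/eqP; apply: contrapT => /negP ne.
      by apply: (Hn0 i ni p Np); exact: subset_closure.
    by rewrite /wave_packet z1// z2// !mulr0 addr0 !mulr0.
  rewrite Z -[RHS](@iterint0 R m); congr iterint; apply/funext => x.
  by rewrite /multi_pd fcpd0 csqnorm0 mulr0.
pose T := \sum_(0 <= i < n0)
  \sum_(alpha : {ffun 'I_m -> 'I_k.+1} | (\sum_a alpha a <= k)%N) G (i, alpha).
exists (Num.sqrt T) => h h01; have /andP[h0 h1] := h01.
pose q := h ^+ J * h ^- k.
have q0 : 0 <= q by rewrite mulr_ge0 ?invr_ge0 ?exprn_ge0// ltW.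
have T0 : 0 <= T.
  apply: sumr_ge0 => i _; apply: sumr_ge0 => alpha _.
  by case: (HG (i, alpha)).
have -> : (Num.sqrt T * q)%:E = sqrte (T * q ^+ 2)%:E.
  by rewrite /= sqrtrM// sqrtr_sqr ger0_norm.
rewrite /sobolev_norm lee_sqrt; last by rewrite lee_fin mulr_ge0// sqr_ge0.
rewrite (nneseries_split 0 n0); last first.
  by move=> i _; apply: sume_ge0 => alpha _; exact: term_ge0.
rewrite [X in (_ + X)%E]eseries0 ?adde0; last first.
  by move=> i; rewrite add0n => ni _; rewrite big1// => alpha _; exact: tail.
rewrite add0n /T mulr_suml -sumEFin; apply: lee_sum => i _.
rewrite mulr_suml -sumEFin; apply: lee_sum => alpha ak.
by have [_ H] := HG (i, alpha); exact: H.
Qed.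

End SobolevBound.

(* C^oo(M_T) is the space of restrictions to M_T = [0, T] x M of smooth functions
   on R x M: its elements are represented by smooth functions on R x M, and all
   equations are imposed on M_T only. *)
Theorem lemma3p3 (R : realType) (M : topologicalType) (n K : nat)
  (MM : manifold R M n) (N : manifold R (R * M)%type n.+1)
  (hN : is_cylinder MM N)
  (g : lorentzian N) (hg : globally_hyperbolic g)
  (T : R) (hT : 0 < T)
  (Q q : R * M -> R[i]) (hQ : csmooth N Q) (hq : csmooth N q)
  (D1 D2 : beam_data R (R * M)%type n K)
  (hD1 : formal_beam g (slab T) Q D1) (hD2 : formal_beam g (slab T) Q D2)
  (p0 : R * M) (hp0 : distinct_geodesics_through D1 D2 p0)
  (chiB : R * M -> R) (hchiB : cutoff_near (N := N) D1 D2 p0 chiB)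
  (hN0 : nbhs p0 (supp_p0 D1 D2 chiB))
  (hPhi : forall p, supp_p0 D1 D2 chiB p ->
     inner g (sum_phase D1 D2) (sum_phase D1 D2) p != 0) :
  let Phi := sum_phase D1 D2 in
  let N0 := supp_p0 D1 D2 chiB in
  let b := prod_coef D1 D2 chiB in
  let F := source D1 D2 chiB q in
  exists (c : nat -> R * M -> R[i]) (w r : R -> R * M -> R[i]),
    [/\ forall j, (j <= 2 * K + 2)%N -> csmooth_supp N N0 (c j),
        forall p, slab T p -> c 0%N p = 0 /\ c 1%N p = 0,
        forall j p, (2 <= j <= 2 * K + 2)%N -> slab T p -> N0 p ->
          c j p = recursion_rhs g Q q Phi b c j p,
        forall h : R, 0 < h < 1 ->
          [/\ csmooth N (w h),
              forall p, slab T p ->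
                box g (w h) p + Q p * w h p = F h p + r h p,
              forall p, slab T p ->
                w h p = cexp ('i%C * Phi p / h%:C%C) *
                        \sum_(2 <= j < 2 * K + 3) c j p * h%:C%C ^+ j &
              csmooth_supp N N0 (r h)] &
        forall (P : partition_of_unity N) (k : nat),
          exists C : R, forall h : R, 0 < h < 1 ->
            (sobolev_norm P (slab T) k (r h)
               <= (C * h ^ ((2 * K)%:Z - k%:Z + 1))%:E)%E].
Proof.
move=> Phi N0 b F.
have sPhi : csmooth N Phi := sum_phase_smooth hD1 hD2.
have sb l : csmooth N (b l) := csmooth_prod_coef hD1 hD2 hchiB l.
have b0 l p : ~ N0 p -> b l p = 0 by exact: prod_coef_off.
have cN0 : closed N0 by exact: closed_closure.
have compN0 : compact N0 by exact: compact_supp_p0 hchiB.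
(* J is the number of source terms b_0, ..., b_(2K), hence of coefficients c_2, ..., c_(2K+2), and
   also the leading order in h of the residual amplitude. *)
pose J := (2 * K).+1.
pose c := coef g Q q Phi b.
have vc j : csmooth N (c j) /\ forall p, ~ N0 p -> c j p = 0.
  exact: (coef_vanishing hQ hq sPhi sb b0 cN0 hPhi j).
pose w (h : R) := wave_ansatz g Q q Phi b h J.
pose r (h : R) := residual g Q q Phi b h J.
have hne (h : R) : 0 < h < 1 -> h != 0 by move=> /andP[h0 _]; rewrite gt_eqF.
exists c, w, r; split.
- by move=> j _; exact: ((@csmooth_suppP _ _ _ N _ (c j) cN0).2 (vc j)).
- by [].
- by move=> j p /andP[j2 _] _ _; exact: coef_recursion.
- move=> h h01; have h0 := hne h h01; split.
  + exact: (csmooth_wave_ansatz hQ hq sPhi sb b0 cN0 hPhi).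
  + move=> p _; exact: (wave_ansatz_equation hQ hq sPhi sb b0 cN0 hPhi h0).
  + move=> p _; rewrite /w /wave_ansatz; apply: congr1.
    rewrite (_ : (2 * K + 3 = J + 2)%N); last by rewrite addnS addSn -addnS.
    rewrite -{1}[2%N]add0n big_addn addnK big_mkord.
    by apply: eq_bigr => k _; rewrite addn2.
  + apply: (@csmooth_suppP _ _ _ N _ (r h) cN0).2.
    exact: (residual_vanishing hQ hq sPhi sb b0 cN0 hPhi).
- move=> P k.
  have [s1 z1] := zeroth_order_vanishing g hQ cN0 (vc J).
  have [s2 z2] := zeroth_order_vanishing g hQ cN0 (vc J.+1).
  have [s3 z3] := first_order_vanishing g sPhi cN0 (vc J.+1).
  have z13 p : ~ N0 p -> zeroth_order g Q (c J) p + first_order g Phi (c J.+1) p = 0.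
    by move=> nN; rewrite z1// z3// addr0.
  have ImPhi p : N0 p -> 0 <= complex.Im (Phi p).
    by move=> Np; exact: (sum_phase_Im_ge0 hD1 hD2 hchiB).
  (* The residual is convertible to the wave packet with r1 = L_J + M_(J+1) and r2 = L_(J+1). *)
  have [C HC] := wave_packet_sobolev J sPhi (csmoothD s1 s3) s2 z13 z2 cN0
    ImPhi compN0 P (slab T) k.
  exists C => h h01; have h0 := hne h h01.
  (* The exponent is the integer J - k, negative as soon as k > 2K + 1. *)
  rewrite (_ : h ^ ((2 * K)%:Z - k%:Z + 1) = h ^+ J * h ^- k); first exact: HC.
  rewrite addrAC expfzDr// -exprnN; congr (_ * _).
  by rewrite -[RHS]/(h ^ J%:Z) /J intS addrC.
Qed.
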